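(* There exist positive constants $c_d$ ($d\ge 2$ an integer), not depending on $n$, with $c_d\uparrow 1$ as $d\to\infty$, such that the following holds for every $d\ge 2$. Let $G=\mathbb T_d$ and let $(y_n)$ be a positive sequence with $y_n\to\infty$. (1) If $\mathbb E\xi^4<\infty$ and $y_n=o(n^{1/6})$, then $$\limsup_{n\to\infty} y_n^{-2}\log \mathbb P\otimes P\left(\frac{T_n\sqrt n}{V_nL_{n,2}}\ge y_n\right)\le -\frac{c_d}{2}.$$ (2) If $\mathbb E\xi^6<\infty$ and $y_n=o(n^{1/6})$, then $$\liminf_{n\to\infty} y_n^{-2}\log \mathbb P\otimes P\left(\frac{T_n\sqrt n}{V_nL_{n,2}}\ge y_n\right)\ge -\frac12.$$
   Context: $\mathbb T_d$ is the $d$-ary tree rooted at $o$: the infinite tree with $\deg(o)=d$ and $\deg(v)=d+1$ for every vertex $v\ne o$; $V$ is its vertex set. $\{S_n:n\in\mathbb N_0\}$ is the simple random walk on $\mathbb T_d$ started at $S_0=o$, with law $P$. The scenery $\{\xi(v):v\in V\}$ is a family of independent copies of a real random variable $\xi$, with law $\mathbb P$ and expectation $\mathbb E$, independent of the walk; $\mathbb P\otimes P$ is the joint law. It is always assumed that $\mathbb E\xi=0$ and $\mathbb E\xi^2>0$. The local time is $\ell_n(v)=\sum_{k=0}^n \mathbf 1\{S_k=v\}$, and $$T_n=\sum_{k=0}^n\xi(S_k)=\sum_{v\in V}\ell_n(v)\xi(v),\quad V_n=\Big(\sum_{v\in V}\ell_n(v)\xi^2(v)\Big)^{1/2},\quad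 L_{n,2}=\Big(\sum_{v\in V}\ell_n^2(v)\Big)^{1/2}.$$ $a_n=o(b_n)$ means $a_n/b_n\to0$; $c_d\uparrow1$ means that $c_d$ is nondecreasing in $d$ with limit $1$. When $V_n=0$ (so that $T_n=0$) the ratio is interpreted as $0$. Also $\log 0=-\infty$. *)

(* Defs.v *)
From mathcomp Require Import all_boot all_order all_algebra.
From mathcomp Require Import all_classical all_reals all_analysis.

Set Implicit Arguments.
Unset Strict Implicit.
Unset Printing Implicit Defensive.

Import Order.TTheory GRing.Theory Num.Theory.
Import numFieldNormedType.Exports.

Local Open Scope classical_set_scope.
Local Open Scope ring_scope.

(* A vertex of the d-ary tree is the word of child labels read from the vertex
   back to the root: the parent of [i :: u] is [u], its children are the
   [j :: i :: u] with [j < d]. *)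
Definition vertex (d : nat) : choiceType := seq 'I_d.

Section Tree.
Variable d : nat.
Implicit Types u v : vertex d.

Definition root : vertex d := [::].

Definition children u : seq (vertex d) := [seq i :: u | i <- enum 'I_d].

Definition parents u : seq (vertex d) :=
  if u is _ :: p then [:: p : vertex d] else [::].

Definition neighbors u : seq (vertex d) := parents u ++ children u.

Definition deg u : nat := size (neighbors u).

Lemma deg_root : deg root = d.
Proof. by rewrite /deg size_map size_enum_ord. Qed.

Lemma deg_nonroot u : u != root -> deg u = d.+1.
Proof. by case: u => [//|i u] _; rewrite /deg size_cat size_map size_enum_ord. Qed.

Lemma mem_children u v : (v \in children u) = (u \in parents v).
Proof.
case: v => [|i v] /=; first by apply/mapP => -[].
rewrite inE; apply/mapP/eqP => [[j _ [_ ->]] //|->].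
by exists i; rewrite // mem_enum.
Qed.

Lemma neighbors_sym u v : (v \in neighbors u) = (u \in neighbors v).
Proof. by rewrite !mem_cat !mem_children orbC. Qed.

Lemma neighbors_uniq u : uniq (neighbors u).
Proof.
have ci w : injective (fun i : 'I_d => i :: w) by move=> i j [].
case: u => [|i u]; rewrite /neighbors /= map_inj_uniq ?enum_uniq ?andbT //.
apply/mapP => -[j _] /(congr1 size) /=.
by elim: (size u) => // n IHn [].
Qed.

Definition srw_kernel (R : realType) u v : R :=
  (v \in neighbors u)%:R / (deg u)%:R.

End Tree.

Record simple_random_walk (d : nat) (R : realType) (dO : measure_display)
    (O : measurableType dO) (P : probability O R)
    (S : nat -> O -> vertex d) : Prop := {
  srw_measurable : forall n v, measurable (S n @^-1` [set v]);
  srw_start : P (S 0%N @^-1` [set root d]) = 1%E;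
  srw_step : forall (n : nat) (x : nat -> vertex d),
    P [set w | forall k, (k <= n.+1)%N -> S k w = x k] =
    (P [set w | forall k, (k <= n)%N -> S k w = x k]
       * (srw_kernel R (x n) (x n.+1))%:E)%E
}.

(* Mutual independence: the product rule for every finite subfamily. *)
Definition independent_family (I : choiceType) (R : realType)
    (dO : measure_display) (O : measurableType dO) (P : probability O R)
    (X : I -> {RV P >-> R}) : Prop :=
  forall (J : seq I) (A : I -> set R), uniq J ->
    (forall i, measurable (A i)) ->
    P (\bigcap_(i in [set` J]) (X i @^-1` A i)) =
    (\prod_(i <- J) P (X i @^-1` A i))%E.

Definition same_law (R : realType) (dO : measure_display)
    (O : measurableType dO) (P : probability O R) (X Y : {RV P >-> R}) : Prop :=
  forall A : set R, measurable A -> P (X @^-1` A) = P (Y @^-1` A).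

Definition independent_copies (I : choiceType) (R : realType)
    (dO : measure_display) (O : measurableType dO) (P : probability O R)
    (X : {RV P >-> R}) (Y : I -> {RV P >-> R}) : Prop :=
  independent_family Y /\ forall i, same_law (Y i) X.

(* For one trajectory [s] of the walk and one realization [z] of the scenery. *)
Section Functionals.
Variables (R : realType) (d : nat).
Implicit Types (s : nat -> vertex d) (z : vertex d -> R).

Definition local_time s (n : nat) (v : vertex d) : nat :=
  \sum_(0 <= k < n.+1) (s k == v).

Definition rwrs s z (n : nat) : R := \sum_(0 <= k < n.+1) z (s k).

Definition self_norm s z (n : nat) : R :=
  Num.sqrt (\sum_(v \in [set: vertex d]) (local_time s n v)%:R * z v ^+ 2).

Definition local_time_norm2 s (n : nat) : R :=
  Num.sqrt (\sum_(v \in [set: vertex d]) ((local_time s n v)%:R ^+ 2 : R)).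

(* Division by zero is zero, so the ratio is 0 when [self_norm] vanishes. *)
Definition self_normalized_ratio s z (n : nat) : R :=
  rwrs s z n * Num.sqrt n%:R / (self_norm s z n * local_time_norm2 s n).

(* The sums over all vertices have finite support, so that the finitely
   supported sum [\sum_(v \in _)] is the true sum. *)
Lemma local_time_finite s n : finite_set [set v | local_time s n v != 0%N].
Proof.
pose r := [seq s k | k <- index_iota 0 n.+1].
apply: (@sub_finite_set _ _ [set` r]) => [v /=|].
  apply: contraNT => vr; rewrite sum_nat_seq_eq0.
  apply/allP => k kn; apply/implyP => _; rewrite eqb0.
  by apply: contra vr => /eqP <-; apply: (map_f s).
exact: finite_seq.
Qed.

Lemma sum_local_time s n (f : vertex d -> R) :
  \sum_(v \in [set: vertex d]) (local_time s n v)%:R * f v =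
  \sum_(0 <= k < n.+1) f (s k).
Proof.
pose r := undup [seq s k | k <- index_iota 0 n.+1].
have rP k : (k < n.+1)%N -> s k \in r.
  by move=> kn; rewrite mem_undup; apply: (map_f s); rewrite mem_index_iota.
rewrite -(@fsbig_widen _ _ _ _ [set` r]) //; last first.
  move=> v [_ /=] /negP vr.
  suff -> : local_time s n v = 0%N by rewrite mul0r.
  apply/eqP; rewrite sum_nat_seq_eq0; apply/allP => k; rewrite mem_index_iota.
  move=> /rP skr; apply/implyP => _; rewrite eqb0.
  by apply: contra vr => /eqP <-.
rewrite -fsbig_seq ?undup_uniq //.
under eq_bigr do rewrite natr_sum mulr_suml.
rewrite exchange_big /= [LHS]big_nat [RHS]big_nat; apply: eq_bigr => k /= /rP skr.
rewrite (bigD1_seq (s k)) ?undup_uniq //= eqxx mul1r big1 ?addr0 // => v.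
by rewrite eq_sym => /negbTE ->; rewrite mul0r.
Qed.

Lemma rwrsE s z n :
  rwrs s z n = \sum_(v \in [set: vertex d]) (local_time s n v)%:R * z v.
Proof. by rewrite sum_local_time. Qed.

End Functionals.

(* Main.v *)
Require Import Defs.
From mathcomp Require Import all_boot all_order all_algebra.
From mathcomp Require Import all_classical all_reals all_analysis.
From mathcomp Require Import measurable_realfun.
From mathcomp Require Import ring lra zify.

Set Implicit Arguments.
Unset Strict Implicit.
Unset Printing Implicit Defensive.

Import Order.TTheory GRing.Theory Num.Theory.
Import numFieldNormedType.Exports.

Local Open Scope classical_set_scope.
Local Open Scope ring_scope.

(** Fix a trajectory s of the walk with N = n+1 points, write ell v for the number
of its visits to v, Q for the sum of the ell v ^ 2, and s2, m4 for the second
and fourth moments of the scenery variable. Given s, T is a weighted sum of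
independent centred variables, and T sqrt n >= y V L is a self-normalized
moderate deviation. Gaussian behaviour suggests the cost y^2/2: tilting each
variable by exp(h ell xi) with h = y / sqrt(Q s2) gives T the mean
y sqrt(Q s2), while V^2 stays close to N s2 and L^2 = Q. Both bounds are
proved for every trajectory with few heavily visited vertices and then
averaged over the walk.

Upper bound (ratio_upper, annealed_upper). If T sqrt n >= y V L, then one of
three things happens (large_ratio_split): the part of T over the vertices with
ell xi <= tau is at least (1-e)^2 y sqrt(Q s2); or V^2 <= (1-e) N s2; or, by
Cauchy-Schwarz, the vertices with ell xi > tau carry local time at least
e^2 y^2. The first two have exponential bounds along the trajectory. The third
has the right order only after averaging over the walk: by Markov's inequality
it costs exp(- th e^2 y^2 / 2) times the expectation of the product of the
1 + p exp(th ell v) over the visited vertices, where p is of order y^4/n^2.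
As th grows with d, e can be chosen to decrease to 0, and this is the origin
of the constants c_d.

Visits of the walk (walk_visits_prod_le). Expanding the product turns its
expectation into a sum over sets A of marked vertices, and each marked vertex
multiplies the expectation by p times the supremum of E exp(th visits to A).
The weight d^(-|v|/2) is an eigenfunction of the walk away from the root, with
eigenvalue rho = 2 sqrt d / (d+1), so reversibility gives
P(S_j = b) <= 2 rho^j from any starting point, hence
P(S_j in A) <= sqrt(2 |A|) rho^(j/2). For exp(th) = rho^(-1/4) the supremum is
then at most a constant times sqrt |A|, and the expectation is at most
(1 + C p sqrt(n+1))^(n+1) = exp(o(y^2)) because y^2 = o(n^(1/3)).

Lower bound (ratio_lower, annealed_lower). With probability at least 1/2 no
vertex is visited more than n^(1/24) times, by the same estimate. For such a
trajectory the scenery is cut off at n^(1/4) and tilted. Under the tilt T lies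
in a window of relative width eta around its mean and V^2 is below
(1+eta) N s2, up to events that a further change of the tilt shows to be
negligible. The density of the tilt on that window gives the cost
(1/2 + O(eta)) y^2. *)

(** * Walk averages and visits to finite sets *)

Section WalkOperator.
Variables (R : realType) (d : nat).
Hypothesis d_ge2 : (2 <= d)%N.
Local Notation V := (vertex d).
Implicit Types (u v w : V) (f g : V -> R) (A : seq V) (F : seq V -> R).

Definition step_mean f v : R := (\sum_(w <- neighbors v) f w) / (deg v)%:R.

(** Expectation of F along the first k steps from v, as a finite iterated average:
estimates over the walk become inductions on k. *)
Fixpoint walk_mean (k : nat) F v : R :=
  if k is k'.+1 then step_mean (walk_mean k' (fun s => F (v :: s))) v
  else F [:: v].

Lemma deg_gt0 v : (0 < deg v)%N.
Proof.
case: (eqVneq v (Defs.root d)) => [->|/deg_nonroot -> //].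
by rewrite deg_root; lia.
Qed.

Lemma degR_gt0 v : 0 < (deg v)%:R :> R.
Proof. by rewrite ltr0n deg_gt0. Qed.

Lemma deg_ge v : (d <= deg v)%N.
Proof.
case: (eqVneq v (Defs.root d)) => [->|/deg_nonroot -> //].
by rewrite deg_root.
Qed.

Lemma deg_le v : (deg v <= d.+1)%N.
Proof.
case: (eqVneq v (Defs.root d)) => [->|/deg_nonroot -> //].
by rewrite deg_root.
Qed.

Lemma step_mean_le f g v : (forall w, f w <= g w) ->
  step_mean f v <= step_mean g v.
Proof.
move=> fg; rewrite ler_wpM2r ?invr_ge0 ?ler0n//.
by apply: ler_sum => w _; exact: fg.
Qed.

Lemma eq_step_mean f g v : f =1 g -> step_mean f v = step_mean g v.
Proof. by move=> fg; rewrite /step_mean; congr (_ / _); apply: eq_bigr. Qed.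

Lemma step_mean_cst c v : step_mean (fun=> c) v = c.
Proof.
rewrite /step_mean big_const_seq iter_addr addr0 count_predT -/(deg v).
by rewrite -[c *+ _]mulr_natr mulfK// gt_eqF// degR_gt0.
Qed.

Lemma step_meanD f g v :
  step_mean (fun w => f w + g w) v = step_mean f v + step_mean g v.
Proof. by rewrite /step_mean big_split mulrDl. Qed.

Lemma step_meanZ c f v : step_mean (fun w => c * f w) v = c * step_mean f v.
Proof. by rewrite /step_mean -mulr_sumr mulrA. Qed.

Lemma step_mean_sum (I : Type) (r : seq I) (F : I -> V -> R) v :
  step_mean (fun w => \sum_(i <- r) F i w) v = \sum_(i <- r) step_mean (F i) v.
Proof. by rewrite /step_mean exchange_big/= mulr_suml. Qed.

Lemma step_mean_ge0 f v : (forall w, 0 <= f w) -> 0 <= step_mean f v.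
Proof. by move=> f0; rewrite -[leLHS](step_mean_cst 0 v); exact: step_mean_le. Qed.

Lemma walk_mean_le k F G v : (forall s, size s = k.+1 -> F s <= G s) ->
  walk_mean k F v <= walk_mean k G v.
Proof.
elim: k F G v => [|k IH] F G v FG /=; first exact: FG.
by apply: step_mean_le => w; apply: IH => s sk; apply: FG; rewrite /= sk.
Qed.

Lemma eq_walk_mean k F G v : (forall s, size s = k.+1 -> F s = G s) ->
  walk_mean k F v = walk_mean k G v.
Proof.
by move=> FG; apply/eqP; rewrite eq_le !walk_mean_le// => s /FG ->.
Qed.

Lemma walk_mean_cst k c v : walk_mean k (fun=> c) v = c.
Proof.
elim: k v => [//|k IH] v /=.
by rewrite (eq_step_mean (g := fun=> c)) ?step_mean_cst.
Qed.

Lemma walk_meanD k F G v :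
  walk_mean k (fun s => F s + G s) v = walk_mean k F v + walk_mean k G v.
Proof.
elim: k F G v => [//|k IH] F G v /=.
by rewrite -step_meanD; apply: eq_step_mean => w; rewrite IH.
Qed.

Lemma walk_meanZ k c F v :
  walk_mean k (fun s => c * F s) v = c * walk_mean k F v.
Proof.
elim: k F v => [//|k IH] F v /=.
by rewrite -step_meanZ; apply: eq_step_mean => w; rewrite IH.
Qed.

(** The spectral radius of simple random walk on the (d+1)-regular tree. *)
Definition heat_decay : R := 2 * Num.sqrt d%:R / d.+1%:R.

Definition height_weight v : R := (Num.sqrt d%:R)^-1 ^+ size v.

Let sqd_gt0 : 0 < Num.sqrt d%:R :> R.
Proof. by rewrite sqrtr_gt0 ltr0n; lia. Qed.

Lemma height_weight_gt0 v : 0 < height_weight v.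
Proof. by rewrite exprn_gt0// invr_gt0. Qed.

Lemma heat_decay_gt0 : 0 < heat_decay.
Proof. by rewrite divr_gt0// mulr_gt0. Qed.

Lemma heat_decay_lt1 : heat_decay < 1.
Proof.
rewrite ltr_pdivrMr// mul1r.
have sq : Num.sqrt d%:R ^+ 2 = d%:R :> R by rewrite sqr_sqrtr.
have : (Num.sqrt d%:R - 1 :> R) ^+ 2 > 0.
  rewrite exprn_even_gt0//= subr_eq0; apply/eqP => s1.
  move: sq; rewrite s1 expr1n -[1]/(1%:R) => /eqP; rewrite eqr_nat; lia.
rewrite -natr1; nra.
Qed.

(** At a vertex other than the root the parent contributes sqrt d and the d
children contribute d / sqrt d, which makes this an equality; at the root
only the children remain, and 1 / sqrt d <= 2 sqrt d / (d+1). *)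
Lemma step_mean_height v : step_mean height_weight v <= heat_decay * height_weight v.
Proof.
set s := Num.sqrt d%:R : R.
have sq : s ^+ 2 = d%:R by rewrite sqr_sqrtr.
have dE : d%:R * s^-1 = s by rewrite -sq expr2 mulfK// gt_eqF.
have chE u : \sum_(w <- children u) height_weight w = s * height_weight u.
  rewrite big_map /height_weight /= -/s.
  rewrite big_const_seq iter_addr addr0 count_predT size_enum_ord.
  by rewrite -mulr_natl exprS mulrA dE.
case: v => [|i v]; rewrite /step_mean /neighbors /=.
  rewrite chE -/(Defs.root d) deg_root /heat_decay -/s mulrAC.
  apply: ler_wpM2r; first exact: ltW (height_weight_gt0 _).
  rewrite -mulrA mulrCA ler_pM2l// ler_pdivlMr// ler_pdivrMl ?ltr0n; last lia.
  by rewrite -natrM ler_nat; lia.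
rewrite big_cons chE deg_nonroot// /heat_decay -/s.
have -> : height_weight v = s * height_weight (i :: v).
  by rewrite /height_weight /= exprS mulrA divff ?mul1r// gt_eqF.
by rewrite le_eqVlt; apply/orP; left; apply/eqP; ring.
Qed.

(** The j-step transition probability from v to b divided by deg b, which is the
symmetric kernel of the reversible walk. *)
Fixpoint heat (j : nat) v b : R :=
  if j is j'.+1 then step_mean (fun w => heat j' w b) v
  else (v == b)%:R / (deg b)%:R.

Lemma sum_indic_uniq (r : seq V) b : uniq r ->
  \sum_(w <- r) (w == b)%:R = (b \in r)%:R :> R.
Proof.
elim: r => [|a r IH] /=; first by rewrite big_nil.
move=> /andP[ar ur]; rewrite big_cons IH// in_cons eq_sym.
by case: eqVneq => [->|_]; rewrite ?(negbTE ar) ?addr0 ?add0r.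
Qed.

(** Decomposing at the last step instead of the first one; together with the
definition this gives symmetry by induction. *)
Lemma heat_forward j v b : heat j.+1 v b = step_mean (heat j v) b.
Proof.
elim: j v b => [|j IH] v b.
  rewrite /= /step_mean -mulr_suml sum_indic_uniq ?neighbors_uniq//.
  under eq_bigr => w _ do rewrite eq_sym.
  have -> : \sum_(w <- neighbors b) (w == v)%:R / (deg w)%:R =
      (\sum_(w <- neighbors b) (w == v)%:R) / (deg v)%:R :> R.
    rewrite mulr_suml; apply: eq_bigr => w _.
    by case: eqVneq => [->//|_]; rewrite !mul0r.
  by rewrite sum_indic_uniq ?neighbors_uniq// neighbors_sym mulrAC.
rewrite [LHS]/=; rewrite -/(heat j.+1).
under eq_step_mean => w do rewrite -/(heat j.+1 w b) IH.
rewrite [RHS]/step_mean /= /step_mean -!mulr_suml exchange_big/=.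
by rewrite mulrAC.
Qed.

Lemma heat_sym j v b : heat j v b = heat j b v.
Proof.
elim: j v b => [|j IH] v b; first by rewrite /= eq_sym; case: eqVneq => [->//|_]; rewrite !mul0r.
by rewrite heat_forward; apply: eq_step_mean => w; rewrite IH.
Qed.

Lemma heat_le_height j v b :
  (deg b)%:R * heat j v b <= heat_decay ^+ j * (height_weight v / height_weight b).
Proof.
elim: j v => [|j IH] v /=.
  rewrite mulrC divfK ?gt_eqF ?degR_gt0// expr0 mul1r.
  case: eqVneq => [->|_]; first by rewrite divff// gt_eqF// height_weight_gt0.
  by rewrite divr_ge0// ltW// height_weight_gt0.
rewrite -step_meanZ (le_trans (step_mean_le _ IH))//.
rewrite (eq_step_mean (g := fun w => heat_decay ^+ j / height_weight b * height_weight w)).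
  rewrite step_meanZ exprSr (_ : heat_decay ^+ j * heat_decay * _ = heat_decay ^+ j / height_weight b * (heat_decay * height_weight v)).
    apply: ler_wpM2l; last exact: step_mean_height.
    by rewrite divr_ge0 ?exprn_ge0// ltW ?heat_decay_gt0 ?height_weight_gt0.
  by ring.
by move=> w; ring.
Qed.

Lemma height_weight_le v b : (size b <= size v)%N -> height_weight v / height_weight b <= 1.
Proof.
move=> bv; rewrite ler_pdivrMr ?height_weight_gt0// mul1r /height_weight.
apply: ler_wiXn2l => //.
by rewrite invf_le1// -[leLHS]sqrtr1 ler_sqrt// ler1n; lia.
Qed.

(** The height weight bounds transitions from the lower to the higher vertex,
since the ratio of the weights is then at most 1; symmetry of the kernel
covers the other case. *)
Lemma heat_le j v b : (deg b)%:R * heat j v b <= 2 * heat_decay ^+ j.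
Proof.
have s0 := exprn_gt0 j heat_decay_gt0.
have [bv|/ltnW vb] := leqP (size b) (size v).
  rewrite (le_trans (heat_le_height j v b))//.
  by rewrite mulrC ler_pM2r// (le_trans (height_weight_le bv))// ler1n.
have h := le_trans (heat_le_height j b v)
  (ler_wpM2l (ltW s0) (height_weight_le vb)).
rewrite mulr1 in h.
have h0 : 0 <= heat j v b.
  elim: j {s0 h} v {vb} => [|j IH] v /=; first by rewrite divr_ge0.
  exact: step_mean_ge0.
rewrite heat_sym in h0 *.
have db : (deg b)%:R <= 2 * (deg v)%:R :> R.
  rewrite -natrM ler_nat; have := deg_ge v; have := deg_le b; lia.
nra.
Qed.

(** The probability that the walk started at v is in A at time j, by conditioning on
its first step. *)
Fixpoint hit_prob (j : nat) A v : R :=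
  if j is j'.+1 then step_mean (hit_prob j' A) v else (v \in A)%:R.

Lemma hit_prob_ge0 j A v : 0 <= hit_prob j A v.
Proof. by elim: j v => [|j IH] v //=; exact: step_mean_ge0. Qed.

Lemma hit_prob_le1 j A v : hit_prob j A v <= 1.
Proof.
elim: j v => [|j IH] v /=; first by case: (v \in A).
by rewrite (le_trans (step_mean_le _ IH))// step_mean_cst.
Qed.

Lemma hit_prob_le_size j A v :
  hit_prob j A v <= (2 * size A)%:R * heat_decay ^+ j.
Proof.
have : hit_prob j A v <= \sum_(b <- A) (deg b)%:R * heat j v b.
  elim: j v => [|j IH] v /=.
    elim: A => [|b A IH]; first by rewrite big_nil.
    rewrite in_cons big_cons mulrC divfK ?gt_eqF ?degR_gt0//.
    case: eqVneq => /= [_|_]; last by rewrite add0r.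
    by rewrite lerDl (le_trans _ IH).
  under [leRHS]eq_bigr => b _ do rewrite -step_meanZ.
  by rewrite -step_mean_sum; apply: step_mean_le.
move/le_trans; apply.
rewrite (le_trans (ler_sum _ (fun b _ => heat_le j v b)))//.
by rewrite big_const_seq iter_addr addr0 count_predT -mulr_natl natrM; lra.
Qed.

(** Half of the decay of hit_prob_le_sqrt compensates the exponential weight of
the visits, and the other half makes the series over time converge. *)
Definition decay_qroot : R := Num.sqrt (Num.sqrt heat_decay).

Lemma decay_qroot_gt0 : 0 < decay_qroot.
Proof. by rewrite !sqrtr_gt0 heat_decay_gt0. Qed.

Lemma decay_qroot_lt1 : decay_qroot < 1.
Proof.
rewrite /decay_qroot -[ltRHS]sqrtr1 ltr_sqrt// -[ltRHS]sqrtr1 ltr_sqrt//.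
exact: heat_decay_lt1.
Qed.

(** A probability is at most the square root of any of its upper bounds. Passing
from |A| to its square root is what keeps the exponential moments below
affordable when A is large. *)
Lemma hit_prob_le_sqrt j A v :
  hit_prob j A v <= Num.sqrt (2 * size A)%:R * (decay_qroot ^+ 2) ^+ j.
Proof.
have o0 := hit_prob_ge0 j A v.
rewrite [decay_qroot ^+ 2]sqr_sqrtr ?sqrtr_ge0// -[leLHS]ger0_norm// -sqrtr_sqr.
have -> : Num.sqrt heat_decay ^+ j = Num.sqrt (heat_decay ^+ j).
  elim: j {o0} => [|j IH]; first by rewrite !expr0 sqrtr1.
  by rewrite !exprS IH -(@sqrtrM _ heat_decay)// ltW// heat_decay_gt0.
rewrite -sqrtrM// ler_sqrt; last first.
  by rewrite mulr_ge0 ?ler0n ?exprn_ge0 ?(ltW heat_decay_gt0).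
rewrite expr2; apply: le_trans (hit_prob_le_size j A v).
by rewrite -[leRHS]mulr1 ler_wpM2l// hit_prob_le1.
Qed.

Definition visit_base : R := decay_qroot^-1.

Lemma visit_base_gt1 : 1 < visit_base.
Proof. by rewrite invf_gt1 ?decay_qroot_gt0 ?decay_qroot_lt1. Qed.

Let K := visit_base.
Let K_gt0 : 0 < K. Proof. exact: lt_trans visit_base_gt1. Qed.
Let K_ge0 : 0 <= K. Proof. exact: ltW. Qed.

(** The expectation of K^(number of visits to A) during the first k steps. *)
Fixpoint visit_moment (k : nat) A v : R :=
  K ^+ (v \in A) * (if k is k'.+1 then step_mean (visit_moment k' A) v else 1).

Lemma visit_moment_ge1 k A v : 1 <= visit_moment k A v.
Proof.
have K1 : 1 <= K ^+ (v \in A) by rewrite exprn_ege1// ltW// visit_base_gt1.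
elim: k v K1 => [|k IH] v K1 /=; first by rewrite mulr1.
apply: mulr_ege1 => //; rewrite -[leLHS](step_mean_cst 1 v).
apply: step_mean_le => w; apply: IH.
by rewrite exprn_ege1// ltW// visit_base_gt1.
Qed.

(** Expanding K^(visits) and using 1 + (K-1) 1_A <= K on all steps but one
reduces the exponential moment to a weighted sum of hitting probabilities. *)
Lemma visit_moment_le_sum k A v :
  visit_moment k A v <= 1 + (K - 1) * \sum_(j < k.+1) K ^+ j * hit_prob j A v.
Proof.
have K1 : 0 <= K - 1 by rewrite subr_ge0 ltW// visit_base_gt1.
have KA u : K ^+ (u \in A) = 1 + (K - 1) * (u \in A)%:R.
  by case: (u \in A); rewrite ?expr1 ?expr0 ?mulr1 ?mulr0 ?addr0 // addrC subrK.
elim: k v => [|k IH] v.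
  by rewrite /= big_ord1 /= mulr1 expr0 mul1r KA.
rewrite [leLHS]/= -/visit_moment.
set T := step_mean _ _.
have TE : T <= 1 + (K - 1) * \sum_(j < k.+1) K ^+ j * hit_prob j.+1 A v.
  rewrite (le_trans (step_mean_le _ IH))// step_meanD step_mean_cst step_meanZ.
  rewrite step_mean_sum lerD2l ler_wpM2l//.
  by apply: ler_sum => j _; rewrite step_meanZ.
have {}TE := ler_wpM2l (exprn_ge0 (v \in A) K_ge0) TE.
apply: (le_trans TE); rewrite [in leRHS]big_ord_recl /= expr0 mul1r.
set S1 := \sum_(j < k.+1) _; set S2 := \sum_(j < k.+1) _.
have S12 : K ^+ (v \in A) * S1 <= S2.
  rewrite mulr_sumr; apply: ler_sum => j _.
  rewrite mulrA ler_wpM2r ?(step_mean_ge0 _ (hit_prob_ge0 _ _))//.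
  rewrite exprS ler_wpM2r ?exprn_ge0//.
  by case: (v \in A); rewrite ?expr1 ?expr0// ltW// visit_base_gt1.
have := ler_wpM2l K1 S12.
have := KA v; move: (K ^+ (v \in A)) ((v \in A)%:R : R) => x a -> h.
by rewrite mulrDr mulr1 mulrCA mulrDr addrA lerD2l.
Qed.

Definition visit_cst : R := 1 + 2 * (K - 1) / (1 - decay_qroot).

Lemma visit_cst_ge1 : 1 <= visit_cst.
Proof.
rewrite lerDl divr_ge0 ?subr_ge0 ?(ltW decay_qroot_lt1)// mulr_ge0// subr_ge0.
exact/ltW/visit_base_gt1.
Qed.

Lemma visit_moment_le k A v : (0 < size A)%N ->
  visit_moment k A v <= visit_cst * Num.sqrt (size A)%:R.
Proof.
move=> A0; rewrite (le_trans (visit_moment_le_sum k A v))//.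
have K1 : 0 <= K - 1 by rewrite subr_ge0 ltW// visit_base_gt1.
have q1 : 0 < 1 - decay_qroot by rewrite subr_gt0 decay_qroot_lt1.
rewrite /visit_cst [leRHS]mulrDl mul1r; apply: lerD.
  by rewrite -[leLHS]sqrtr1 ler_sqrt// ler1n.
rewrite -!mulrA mulrCA [2 * _]mulrC -!mulrA ler_wpM2l//.
have h j : K ^+ j * hit_prob j A v <= Num.sqrt (2 * size A)%:R * decay_qroot ^+ j.
  have := ler_wpM2l (exprn_ge0 j K_ge0) (hit_prob_le_sqrt j A v).
  move/le_trans; apply.
  rewrite mulrCA ler_wpM2l ?sqrtr_ge0// -exprMn expr2 mulrA.
  by rewrite /K /visit_base mulVf ?mul1r// gt_eqF// decay_qroot_gt0.
apply: (le_trans (ler_sum _ (fun (j : 'I_k.+1) _ => h j))).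
rewrite -mulr_sumr.
have geo : \sum_(i < k.+1) decay_qroot ^+ i <= (1 - decay_qroot)^-1.
  rewrite -[leRHS]mul1r ler_pdivlMr// mulrC -(opprB _ 1) mulNr -subrX1 opprB.
  by rewrite gerBl exprn_ge0// ltW// decay_qroot_gt0.
rewrite natrM sqrtrM// -mulrA.
have s2 : Num.sqrt 2%:R <= 2 :> R.
  have s20 := sqrtr_ge0 (2%:R : R).
  have : Num.sqrt 2%:R ^+ 2 = 2%:R :> R by rewrite sqr_sqrtr.
  by nra.
rewrite [leRHS]mulrC [_ * 2]mulrC -mulrA.
apply: ler_pM => //; first by rewrite mulr_ge0// ?sumr_ge0// => j _; rewrite exprn_ge0// ltW// decay_qroot_gt0.
by rewrite ler_wpM2l.
Qed.

(** Running through the trajectory, each vertex outside A may be marked at any of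
its visits, at the price p; from then on its visits are weighted by K. The sum
over all ways of marking bounds the expanded product of the factors 1 + p K^ell,
and unlike that product it is defined by recursion along the trajectory. *)
Fixpoint mark_sum (p : R) A (s : seq V) : R :=
  if s is v :: s' then
    K ^+ (v \in A) * mark_sum p A s'
    + (v \notin A)%:R * p * K * mark_sum p (v :: A) s'
  else 1.

(** Marking each vertex of a subset of J at its first visit already produces the
whole expansion of the product; marking at later visits only adds nonnegative
terms. *)
Lemma mark_sum_ge p A s (J : seq V) : 0 <= p -> uniq J -> {subset J <= s} ->
  K ^+ (count (mem A) s) *
    \prod_(v <- J | v \notin A) (1 + p * K ^+ count_mem v s)
  <= mark_sum p A s.
Proof.
move=> p0; elim: s A J => [|v s IH] A J uJ Js.
  case: J uJ Js => [|b J] _ Js; first by rewrite big_nil /= mulr1.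
  by have := Js b (mem_head _ _).
pose J' := [seq w <- J | w != v].
have uJ' : uniq J' by rewrite filter_uniq.
have J's : {subset J' <= s}.
  by move=> w; rewrite mem_filter => /andP[wv /Js]; rewrite inE (negbTE wv).
have cnt w : w != v -> count_mem w (v :: s) = count_mem w s.
  by move=> wv; rewrite /= eq_sym (negbTE wv).
have prodE (Q : pred V) : \prod_(w <- J' | Q w) (1 + p * K ^+ count_mem w (v :: s)) =
    \prod_(w <- J' | Q w) (1 + p * K ^+ count_mem w s).
  by rewrite !big_filter_cond; apply: eq_bigr => w /andP[/cnt ->].
have p1 (w : V) (m : nat) : 1 <= 1 + p * K ^+ m by rewrite lerDl mulr_ge0// exprn_ge0.
have prodge0 (r : seq V) (Q : pred V) (m : V -> nat) : 0 <= \prod_(w <- r | Q w) (1 + p * K ^+ m w).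
  by apply: prodr_ge0 => w _; exact: le_trans (p1 _ _).
have splitJ (Q : pred V) : \prod_(w <- J | Q w) (1 + p * K ^+ count_mem w (v :: s)) <=
    (if Q v then 1 + p * K ^+ count_mem v (v :: s) else 1) *
    \prod_(w <- J' | Q w) (1 + p * K ^+ count_mem w s).
  rewrite -prodE big_filter_cond (bigID (fun w => w != v))/= mulrC.
  apply: ler_pM => //.
  - rewrite (eq_bigl (fun w => (w == v) && Q v)); last first.
      by move=> w; rewrite negbK andbC; case: eqVneq => // ->.
    case: (Q v); last by rewrite big_pred0// => w; rewrite andbF.
    under eq_bigl => w do rewrite andbT.
    rewrite -big_filter; have [vJ|vJ] := boolP (v \in J).
      by rewrite filter_pred1_uniq// big_seq1.
    rewrite (_ : [seq w <- J | w == v] = [::]) ?big_nil; first exact: (p1 v).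
    by apply/eqP; apply: contraNT vJ; rewrite -has_filter => /hasP[w wJ /eqP <-].
  - by rewrite (eq_bigl (fun w => (w != v) && Q w))// => w; rewrite andbC.
set X := \prod_(_ <- J | _) _; have := splitJ (fun w => w \notin A).
rewrite -/X /=; case: (boolP (v \in A)) => vA /= => XJ.
  rewrite mul0r mul0r mul0r addr0 exprD -mulrA ler_wpM2l ?exprn_ge0//.
  rewrite mul1r in XJ.
  apply: le_trans (IH A J' uJ' J's).
  by rewrite ler_wpM2l// exprn_ge0.
rewrite add0n expr0 !mul1r.
apply: (le_trans (ler_wpM2l (exprn_ge0 _ K_ge0) XJ)).
rewrite mulrDl mul1r mulrDr lerD ?IH//.
rewrite mulrA [_ * (p * _)]mulrCA -!mulrA ler_wpM2l//.
rewrite eqxx exprS mulrCA -!mulrA ler_wpM2l//.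
apply: le_trans (IH (v :: A) J' uJ' J's).
rewrite [X in _ <= X * _](_ : _ = K ^+ count_mem v s * K ^+ count (mem A) s); last first.
  rewrite -exprD -count_predUI [X in (_ + X)%N](_ : _ = 0%N); last first.
    apply/eqP; rewrite -leqn0 leqNgt -has_count; apply/hasPn => w _ /=.
    by apply/negP => /andP[/eqP -> ]; apply/negP.
  by rewrite addn0; congr (_ ^+ _); apply: eq_count => w; rewrite !inE.
rewrite -mulrA ler_wpM2l ?exprn_ge0// ler_wpM2l ?exprn_ge0//.
rewrite !big_filter_cond le_eqVlt; apply/orP; left; apply/eqP/eq_bigl => w.
by rewrite !inE negb_or andbA andbb.
Qed.

(** The exponential moment of the visits to the marked set is preserved by a step of
the walk. Marking one more vertex replaces it by a quantity that is at most
visit_cst sqrt N by visit_moment_le, while its value is at least 1: each step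
therefore costs at most the factor 1 + p visit_cst sqrt N. *)
Lemma walk_mark_sum_le (p : R) (N k : nat) A v : 0 <= p -> (size A + k < N)%N ->
  walk_mean k (mark_sum p A) v <=
  (1 + p * visit_cst * Num.sqrt N%:R) ^+ k.+1 * visit_moment k A v.
Proof.
move=> p0.
set del := p * visit_cst * Num.sqrt N%:R.
have del0 : 0 <= del.
  by rewrite !mulr_ge0 ?sqrtr_ge0// (le_trans _ visit_cst_ge1).
have new k' A' w : (size A' < N)%N -> p * visit_moment k' (w :: A') w <= del.
  move=> AN; rewrite /del -mulrA ler_wpM2l//.
  apply: (le_trans (visit_moment_le _ _ _)) => //=.
  rewrite ler_wpM2l ?(le_trans _ visit_cst_ge1)// ler_sqrt// ler_nat.
  exact: AN.
have D k' : 1 <= (1 + del) ^+ k' by rewrite exprn_ege1// lerDl.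
have comb k' A' w : (size A' < N)%N ->
   visit_moment k' A' w + (w \notin A')%:R * (p * visit_moment k' (w :: A') w)
   <= (1 + del) * visit_moment k' A' w.
  move=> AN; rewrite mulrDl mul1r lerD2l.
  apply: (@le_trans _ _ del).
    case: (w \notin A'); rewrite ?mul1r ?mul0r//; exact: new.
  by rewrite -[leLHS]mulr1 ler_wpM2l// visit_moment_ge1.
elim: k A v => [|k IH] A v AN.
  have /(comb 0%N A v) : (size A < N)%N by lia.
  by rewrite /= !mulr1 mem_head/= !expr1 mulrA.
rewrite [walk_mean _ _ _]/=.
pose F1 s := K ^+ (v \in A) * mark_sum p A s.
pose F2 s := (v \notin A)%:R * p * K * mark_sum p (v :: A) s.
rewrite (eq_step_mean (g := fun w => K ^+ (v \in A) * walk_mean k (mark_sum p A) w +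
    (v \notin A)%:R * p * K * walk_mean k (mark_sum p (v :: A)) w)); last first.
  by move=> w; rewrite -!walk_meanZ -walk_meanD.
rewrite step_meanD !step_meanZ exprSr -[leRHS]mulrA.
have /(comb k.+1 A v) /(ler_wpM2l (le_trans ler01 (D k.+1))) : (size A < N)%N.
  by lia.
apply: le_trans.
rewrite mulrDr lerD//.
  rewrite [visit_moment _ _ _]/= [leRHS]mulrCA ler_wpM2l ?exprn_ge0// -step_meanZ.
  by apply: step_mean_le => w; apply: IH; lia.
rewrite [visit_moment _ _ _]/= -/visit_moment mem_head expr1.
rewrite -!mulrA [leRHS]mulrCA ler_wpM2l// [leRHS]mulrCA ler_wpM2l// [leRHS]mulrCA ler_wpM2l//.
rewrite -step_meanZ.
by apply: step_mean_le => w; apply: IH; rewrite /= addSnnS.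
Qed.

(** The sublinear growth sqrt (n+1) of the cost of a mark matters: the exponent
p n^(3/2) is negligible compared with y^2 for p of order y^4/n^2, and a
linear growth would not be. *)
Theorem walk_visits_prod_le (p : R) (n : nat) : 0 <= p ->
  walk_mean n (fun s => \prod_(v <- undup s) (1 + p * K ^+ count_mem v s)) (Defs.root d)
  <= (1 + p * visit_cst * Num.sqrt n.+1%:R) ^+ n.+1.
Proof.
move=> p0.
have v1 k v : visit_moment k [::] v = 1.
  elim: k v => [|k IH] v /=; first by rewrite mulr1.
  by rewrite (eq_step_mean (g := fun=> 1)) ?step_mean_cst ?mulr1.
have := walk_mark_sum_le (N := n.+1) (k := n) (A := [::]) (Defs.root d) p0 (ltnSn n).
rewrite v1 mulr1; apply: le_trans.
apply: walk_mean_le => s _.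
have := @mark_sum_ge p [::] s (undup s) p0 (undup_uniq s).
rewrite (_ : count _ s = 0%N); last by elim: s.
rewrite mul1r; apply => w.
by rewrite mem_undup.
Qed.

End WalkOperator.

(** * Products over independent copies *)

Section IndependentProducts.
Import HBNNSimple.
Variables (R : realType) (dO : measure_display) (O : measurableType dO).
Variables (P : probability O R).

Let nn_indic (phi : {nnsfun R >-> R}) (r x : R) :
  0 <= r * \1_(phi @^-1` [set r]) x.
Proof.
have [r0|r0] := leP 0 r; first by rewrite mulr_ge0.
rewrite indicE memNset ?mulr0//= => phixr.
by move: r0; rewrite -phixr ltNge => /negP; apply.
Qed.

(** An identity of two measures on the line, one of them weighted by G, extends
from Borel sets to nonnegative functions through simple functions and monotone
convergence. *)
Lemma integral_weighted_comp (G Y X : O -> R) (c : \bar R) (f : R -> R) :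
  measurable_fun setT G -> measurable_fun setT Y -> measurable_fun setT X ->
  measurable_fun setT f -> (forall w, 0 <= G w) -> (forall x, 0 <= f x) ->
  (0 <= c)%E -> c \is a fin_num ->
  (forall B : set R, measurable B ->
    (\int[P]_w (G w * \1_B (Y w))%:E = c * P (X @^-1` B))%E) ->
  (\int[P]_w (G w * f (Y w))%:E = c * \int[P]_w (f (X w))%:E)%E.
Proof.
move=> mG mY mX mf G0 f0 c0 cfin H.
have simple (phi : {nnsfun R >-> R}) :
    (\int[P]_w (G w * phi (Y w))%:E = c * \int[P]_w (phi (X w))%:E)%E.
  have mphi r : measurable (phi @^-1` [set r]) by exact: measurable_sfunP.
  have mI r (Z : O -> R) : measurable_fun setT Z ->
      measurable_fun setT (fun w => \1_(phi @^-1` [set r]) (Z w) : R).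
    by move=> mZ; apply: measurableT_comp => //; exact: measurable_indic.
  have LE : (fun w => (G w * phi (Y w))%:E) = (fun w =>
      \sum_(r \in range phi) (r * (G w * \1_(phi @^-1` [set r]) (Y w)))%:E)%E.
    apply/funext => w; rewrite fimfunE mulr_fsumr// fsumEFin//.
    by congr EFin; apply: eq_fsbigr => r _; rewrite mulrCA.
  have RE : (fun w => (phi (X w))%:E) = (fun w =>
      \sum_(r \in range phi) (r * \1_(phi @^-1` [set r]) (X w))%:E)%E.
    by apply/funext => w; rewrite fimfunE fsumEFin.
  rewrite LE RE !ge0_integral_fsum//.
  - rewrite ge0_mule_fsumr; last first.
      by move=> r; apply: integral_ge0 => w _; rewrite lee_fin.
    apply: eq_fsbigr => r /set_mem[x _ <-].
    under eq_integral => w _ do rewrite EFinM.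
    under [X in (_ = c * X)%E]eq_integral => w _ do rewrite EFinM.
    rewrite !ge0_integralZl//.
    + rewrite H// muleCA; congr (_ * (_ * _))%E.
      have -> : (fun w => (\1_(phi @^-1` [set phi x]) (X w) : R)%:E) =
          (fun w => (\1_(X @^-1` (phi @^-1` [set phi x])) w)%:E) by [].
      rewrite integral_indic// ?setIT//.
      by rewrite -[X in measurable X]setTI; apply: mX.
    + by apply/measurable_EFinP; exact: mI.
    + by rewrite lee_fin; exact: fun_ge0.
    + by apply/measurable_EFinP/measurable_funM => //; exact: mI.
    + by move=> w _; rewrite lee_fin mulr_ge0.
    + by rewrite lee_fin; exact: fun_ge0.
  - by move=> r; apply/measurable_EFinP/measurable_funM => //; exact: mI.
  - by move=> r w _; rewrite lee_fin.
  - move=> r; apply/measurable_EFinP/measurable_funM => //.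
    by apply: measurable_funM => //; exact: mI.
  - by move=> r w _; rewrite lee_fin mulrCA mulr_ge0.
have mfE : measurable_fun setT (EFin \o f) by exact/measurable_EFinP.
pose phi := nnsfun_approx measurableT mfE.
have phic x : (phi n x)%:E @[n --> \oo] --> (f x)%:E.
  by apply: (@cvg_nnsfun_approx _ _ _ _ measurableT _ mfE) => // z _; rewrite lee_fin f0.
have nd x : {homo (fun n => phi n x) : n m / (n <= m)%N >-> n <= m}.
  by move=> n m nm; exact/lefP/nd_nnsfun_approx.
have mono (H' Z : O -> R) : measurable_fun setT H' -> measurable_fun setT Z ->
    (forall w, 0 <= H' w) ->
    (\int[P]_w (H' w * phi n (Z w))%:E)%E @[n --> \oo] -->
    (\int[P]_w (H' w * f (Z w))%:E)%E.
  move=> mH mZ H'0.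
  have -> : (\int[P]_w (H' w * f (Z w))%:E =
    \int[P]_w (limn (fun n => (H' w * phi n (Z w))%:E)))%E.
    apply: eq_integral => w _; apply/esym/cvg_lim => //.
    rewrite EFinM; under eq_fun do rewrite EFinM.
    by apply: cvgeZl => //; exact: phic.
  apply: cvg_monotone_convergence => //.
  - move=> n; apply/measurable_EFinP/measurable_funM => //.
    by apply: measurableT_comp => //; exact: measurable_funP.
  - by move=> n w _; rewrite lee_fin mulr_ge0.
  - by move=> w _ n m nm; rewrite lee_fin ler_wpM2l// nd.
have L := mono G Y mG mY G0.
have := mono (fun=> 1) X (measurable_cst _) mX (fun=> ler01).
under eq_integral do rewrite mul1r.
under eq_fun do under eq_integral do rewrite mul1r.
move: L; under eq_fun do rewrite simple.
move=> L Rr.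
exact: (cvg_unique (@ereal_hausdorff R) L (cvgeZl cfin Rr)).
Qed.

Variables (I : choiceType) (X : {RV P >-> R}) (xi : I -> {RV P >-> R}).
Hypothesis xi_copies : independent_copies X xi.

(** The product rule for events is the case where J1 is empty; the indicators are
turned into general functions one index at a time. *)
Lemma integral_prod_copies_aux (J1 J2 : seq I) (f : I -> R -> R)
    (A : I -> set R) : uniq (J1 ++ J2) ->
  (forall i, measurable_fun setT (f i)) -> (forall i x, 0 <= f i x) ->
  (forall i, (\int[P]_w (f i (X w))%:E < +oo)%E) ->
  (forall i, measurable (A i)) ->
  (\int[P]_w (\prod_(i <- J1) f i (xi i w) * \prod_(i <- J2) \1_(A i) (xi i w))%:E
  = \prod_(i <- J1) \int[P]_w (f i (X w))%:E * \prod_(i <- J2) P (X @^-1` A i))%E.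
Proof.
move=> + mf f0 ff; elim: J1 J2 A => [|i J1 IH] J2 A uJ mA.
  rewrite big_nil mul1e.
  have -> : (fun w => (\prod_(i <- [::]) f i (xi i w) * \prod_(i <- J2) \1_(A i) (xi i w))%:E)
     = (fun w => (\1_(\bigcap_(i in [set` J2]) xi i @^-1` A i) w)%:E).
    apply/funext => w; rewrite big_nil mul1r; congr EFin.
    rewrite indicE; have [/set_mem Aw|Aw] := boolP (w \in _).
      rewrite big_seq big1// => i iJ; rewrite indicE mem_set//.
      exact: Aw.
    apply/eqP; rewrite prodf_seq_eq0; apply/hasP.
    apply: contrapT => h; move/negP: Aw; apply; apply/mem_set => i /= iJ.
    apply: contrapT => Ai; apply: h; exists i => //=.
    by rewrite indicE memNset.
  rewrite integral_indic//; last first.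
    apply: fin_bigcap_measurable; first exact: finite_seq.
    by move=> i _; rewrite -[X in measurable X]setTI; exact: measurable_funP.
  rewrite setIT; apply: (eq_trans (xi_copies.1 J2 A uJ mA)); apply: eq_bigr => i _.
  exact: xi_copies.2.
have fge i' : (0 <= \int[P]_w (f i' (X w))%:E)%E.
  by apply: integral_ge0 => w _; rewrite lee_fin.
pose G w := \prod_(i <- J1) f i (xi i w) * \prod_(i <- J2) \1_(A i) (xi i w).
pose c := (\prod_(i <- J1) \int[P]_w (f i (X w))%:E * \prod_(i <- J2) P (X @^-1` A i))%E.
have -> : (fun w => (\prod_(i0 <- i :: J1) f i0 (xi i0 w) * \prod_(i0 <- J2) \1_(A i0) (xi i0 w))%:E)
  = (fun w => (G w * f i (xi i w))%:E).
  by apply/funext => w; rewrite big_cons; congr EFin; rewrite /G; ring.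
have mAx i' : measurable (X @^-1` A i').
  by rewrite -[X in measurable X]setTI; exact: measurable_funP.
rewrite (integral_weighted_comp (X := X) (c := c))//.
- by rewrite big_cons [LHS]muleC -muleA.
- apply: measurable_funM; apply: measurable_prod => j _.
    exact: measurableT_comp.
  by apply: measurableT_comp => //; exact: measurable_indic.
- by move=> w; rewrite mulr_ge0// prodr_ge0.
- rewrite mule_ge0// ?prode_ge0//.
- rewrite fin_numM//.
    by apply: prode_fin_num => j _; rewrite ge0_fin_numE.
  by apply: prode_fin_num => j _; rewrite fin_num_measure.
- move=> B mB; pose A' j := if j == i then B else A j.
  have iJ : i \notin J2 by move: uJ; rewrite /= mem_cat negb_or => /andP[/andP[]].
  have A'J j : j \in J2 -> A' j = A j.
    by rewrite /A'; case: eqVneq => // -> ji; rewrite ji in iJ.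
  have uJ' : uniq (J1 ++ i :: J2).
    have pe : perm_eq (J1 ++ i :: J2) (i :: J1 ++ J2).
      by rewrite (perm_catCA J1 [:: i] J2).
    by rewrite (perm_uniq pe).
  have mA' j : measurable (A' j) by rewrite /A'; case: eqP.
  have PE : (\prod_(j <- i :: J2) P (X @^-1` A' j) =
      P (X @^-1` B) * \prod_(j <- J2) P (X @^-1` A j))%E.
    rewrite big_cons {1}/A' eqxx; congr (_ * _)%E.
    by apply: eq_big_seq => j /A'J ->.
  have IE w : \prod_(j <- i :: J2) \1_(A' j) (xi j w) =
      \1_B (xi i w) * \prod_(j <- J2) \1_(A j) (xi j w) :> R.
    rewrite big_cons {1}/A' eqxx; congr (_ * _).
    by apply: eq_big_seq => j /A'J ->.
  have := IH _ A' uJ' mA'.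
  rewrite PE muleCA [(P _ * _)%E]muleC -/c => <-.
  by apply: eq_integral => w _; rewrite IE /G; congr EFin; ring.
Qed.

Lemma integral_prod_copies (J : seq I) (f : I -> R -> R) : uniq J ->
  (forall i, measurable_fun setT (f i)) -> (forall i x, 0 <= f i x) ->
  (forall i, (\int[P]_w (f i (X w))%:E < +oo)%E) ->
  (\int[P]_w (\prod_(i <- J) f i (xi i w))%:E
  = \prod_(i <- J) \int[P]_w (f i (X w))%:E)%E.
Proof.
move=> uJ mf f0 ff.
have := @integral_prod_copies_aux J [::] f (fun=> setT).
rewrite cats0 big_nil mule1 => <- //.
by apply: eq_integral => w _; rewrite big_nil mulr1.
Qed.

Hypothesis EX0 : ('E_P[X] = 0)%E.
Hypothesis EX4 : ('E_P[fun w => (X w ^+ 4)%R] < +oo)%E.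

Definition second_moment : R := fine ('E_P[fun w => (X w ^+ 2)%R])%E.
Definition fourth_moment : R := fine ('E_P[fun w => (X w ^+ 4)%R])%E.
Local Notation s2 := second_moment.
Local Notation m4 := fourth_moment.

Let mX : measurable_fun setT X. Proof. exact: measurable_funP. Qed.

Let EE (f : O -> R) : ('E_P[f] = \int[P]_w (f w)%:E)%E.
Proof. by rewrite unlock. Qed.

Lemma integrable_power4 : P.-integrable setT (fun w => (X w ^+ 4)%:E).
Proof.
apply/integrableP; split.
  by apply/measurable_EFinP; exact: measurable_funX.
move: EX4; rewrite EE; apply: le_lt_trans.
rewrite le_eqVlt; apply/orP; left; apply/eqP; apply: eq_integral => w _ /=.
by rewrite ger0_norm// exprn_even_ge0.
Qed.

Lemma integrable_power_le4 k : (k <= 4)%N -> P.-integrable setT (fun w => (X w ^+ k)%:E).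
Proof.
move=> k4; have i4 := integrable_power4.
have i1 : P.-integrable setT (fun w : O => 1%:E : \bar R) by exact: finite_measure_integrable_cst.
have := integrableD measurableT i1 i4.
apply: le_integrable => //; first by apply/measurable_EFinP; exact: measurable_funX.
move=> w _; rewrite /= lee_fin normrX.
rewrite [leRHS]ger0_norm; last by rewrite addr_ge0// exprn_even_ge0.
have -> : X w ^+ 4 = `|X w| ^+ 4 by rewrite -normrX ger0_norm// exprn_even_ge0.
have [x1|x1] := leP `|X w| 1.
  by rewrite (le_trans (exprn_ile1 _ _ x1))// lerDl exprn_ge0.
by rewrite (le_trans (ler_weXn2l (ltW x1) k4))// lerDr.
Qed.

(** All the functions of the scenery used below are compared with polynomials
without a cubic term, whose expectation depends only on the second and fourth
moments because the linear term vanishes. *)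
Lemma integral_quartic (a b c : R) :
  P.-integrable setT (fun w => (1 + a * X w + b * X w ^+ 2 + c * X w ^+ 4)%:E) /\
  (\int[P]_w (1 + a * X w + b * X w ^+ 2 + c * X w ^+ 4)%:E = (1 + b * s2 + c * m4)%:E)%E.
Proof.
have iZ (k : nat) (r : R) : (k <= 4)%N ->
    P.-integrable setT (fun w => (r%:E * (X w ^+ k)%:E)%E).
  by move=> k4; apply: integrableZl => //; exact: integrable_power_le4.
have fE : (fun w => (1 + a * X w + b * X w ^+ 2 + c * X w ^+ 4)%:E) =
  ((((fun w => (1%:E * (X w ^+ 0)%:E)%E) \+ (fun w => (a%:E * (X w ^+ 1)%:E)%E)) \+
   (fun w => (b%:E * (X w ^+ 2)%:E)%E)) \+ (fun w => (c%:E * (X w ^+ 4)%:E)%E))%E.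
  apply/funext => w /=; rewrite -!EFinM -!EFinD; congr EFin.
  by rewrite expr0 mulr1 expr1.
have i1 := iZ 0%N 1 isT; have ia := iZ 1%N a isT.
have ib := iZ 2%N b isT; have ic := iZ 4%N c isT.
have i1a := integrableD measurableT i1 ia.
have i1ab := integrableD measurableT i1a ib.
split; first by rewrite fE; exact: integrableD.
rewrite fE integralD// integralD// integralD// !integralZl// ?integrable_power_le4//.
have e0 : (\int[P]_w (X w ^+ 0)%:E = 1)%E.
  under eq_integral do rewrite expr0.
  by rewrite integral_cst// mul1e; exact: probability_setT.
have e1 : (\int[P]_w (X w ^+ 1)%:E = 0)%E.
  by rewrite -EX0 EE.
have ek k : (k <= 4)%N -> (\int[P]_w (X w ^+ k)%:E)%E \is a fin_num.
  by move=> k4; apply: integrable_fin_num => //; exact: integrable_power_le4.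
rewrite e0 e1 mule0 adde0 mule1 /s2 /m4 !EE.
by rewrite -(fineK (ek 2%N isT)) -(fineK (ek 4%N isT)) -!EFinM -!EFinD.
Qed.

Lemma integral_prod_le (J : seq I) (f : I -> R -> R) (a b c : I -> R) : uniq J ->
  (forall i, measurable_fun setT (f i)) -> (forall i x, 0 <= f i x) ->
  (forall i x, f i x <= 1 + a i * x + b i * x ^+ 2 + c i * x ^+ 4) ->
  (\int[P]_w (\prod_(i <- J) f i (xi i w))%:E
   <= (\prod_(i <- J) (1 + b i * s2 + c i * m4))%:E)%E.
Proof.
move=> uJ mf f0 fle.
have int_le i : (\int[P]_w (f i (X w))%:E <= (1 + b i * s2 + c i * m4)%:E)%E.
  have [iq <-] := integral_quartic (a i) (b i) (c i).
  apply: ge0_le_integral => //.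
  - by move=> w _; rewrite lee_fin.
  - by apply/measurable_EFinP; exact: measurableT_comp.
  - by case/integrableP : iq.
  - by move=> w _; rewrite lee_fin.
rewrite integral_prod_copies//; last by move=> i; rewrite (le_lt_trans (int_le i))// ltry.
rewrite -prodEFin.
elim: J {uJ} => [|i J IH]; first by rewrite !big_nil.
rewrite !big_cons; apply: lee_pmul => //.
- by apply: integral_ge0 => w _; rewrite lee_fin.
- by apply: prode_ge0 => j _; apply: integral_ge0 => w _; rewrite lee_fin.
Qed.

Lemma integral_prod_ge (J : seq I) (f : I -> R -> R) (a b c a' b' c' : I -> R) :
  uniq J ->
  (forall i, measurable_fun setT (f i)) -> (forall i x, 0 <= f i x) ->
  (forall i x, f i x <= 1 + a' i * x + b' i * x ^+ 2 + c' i * x ^+ 4) ->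
  (forall i x, 1 + a i * x + b i * x ^+ 2 + c i * x ^+ 4 <= f i x) ->
  (forall i, 0 <= 1 + b i * s2 + c i * m4) ->
  ((\prod_(i <- J) (1 + b i * s2 + c i * m4))%:E
    <= \int[P]_w (\prod_(i <- J) f i (xi i w))%:E)%E.
Proof.
move=> uJ mf f0 fle fge b0.
have [iq iqE] : (forall i, P.-integrable setT (fun w => (f i (X w))%:E)) /\
    forall i, ((1 + b i * s2 + c i * m4)%:E <= \int[P]_w (f i (X w))%:E)%E.
  have intf i : P.-integrable setT (fun w => (f i (X w))%:E).
    have [iq _] := integral_quartic (a' i) (b' i) (c' i).
    apply: le_integrable iq => //.
      by apply/measurable_EFinP; exact: measurableT_comp.
    move=> w _; rewrite /= lee_fin ger0_norm// (le_trans (fle i (X w)))//.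
    exact: ler_norm.
  split=> // i.
  have [iq <-] := integral_quartic (a i) (b i) (c i).
  by apply: le_integral => // w _; rewrite lee_fin.
rewrite integral_prod_copies//; last first.
  move=> i; rewrite -ge0_fin_numE; last by apply: integral_ge0 => w _; rewrite lee_fin.
  exact: integrable_fin_num.
rewrite -prodEFin.
elim: J {uJ} => [|i J IH]; first by rewrite !big_nil.
rewrite !big_cons; apply: lee_pmul => //.
- by rewrite lee_fin.
- by apply: prode_ge0 => j _; rewrite lee_fin.
Qed.

End IndependentProducts.

(** * Elementary bounds for the exponential *)

Section ExponentialBounds.
Variable R : realType.
Implicit Types u c x : R.

(** Used to obtain Taylor bounds for the exponential one order at a time. *)
Lemma ge0_of_derive (f g : R -> R) : (forall x, is_derive x 1 f (g x)) ->
  f 0 = 0 -> (forall x, 0 <= x -> 0 <= g x) -> forall x, 0 <= x -> 0 <= f x.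
Proof.
move=> df f0 g0 x; rewrite le_eqVlt => /orP[/eqP <-|x0]; first by rewrite f0.
have fc : {within `[0, x], continuous f}.
  apply: continuous_subspaceT => y; apply: differentiable_continuous.
  by apply/derivable1_diffP; have := df y => /@ex_derive.
have [c] := @MVT _ f g 0 x x0 (fun y _ => df y) fc.
rewrite in_itv/= => /andP[c0 _]; rewrite f0 !subr0 => ->.
by rewrite mulr_ge0// ?g0// ltW.
Qed.

Lemma expR_ge_quadratic u : 0 <= u -> 1 + u + u ^+ 2 / 2 <= expR u.
Proof.
move=> u0; rewrite -subr_ge0.
apply: (ge0_of_derive (f := fun x => expR x - (1 + x + x ^+ 2 / 2))
  (g := fun x => expR x - (1 + x))) u0 => [x||x _].
- by apply: is_derive_eq; rewrite /GRing.scale /=; field.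
- by rewrite expR0; ring.
- by rewrite subr_ge0 expR_ge1Dx.
Qed.

(** One-sided: u may be arbitrarily negative, so that only large positive values
of the scenery have to be cut off. *)
Lemma expR_le_quadratic u c : u <= c -> 0 <= c ->
  expR u <= 1 + u + u ^+ 2 * expR c / 2.
Proof.
move=> uc c0; have [u0|/ltW u0] := leP 0 u.
  apply: (@le_trans _ _ (1 + u + u ^+ 2 * expR u / 2)); last first.
    by rewrite lerD2l ler_pM2r ?invr_gt0// ler_wpM2l ?sqr_ge0// ler_expR.
  rewrite -subr_ge0.
  apply: (ge0_of_derive (f := fun x => 1 + x + x ^+ 2 * expR x / 2 - expR x)
    (g := fun x => 1 + x * expR x + x ^+ 2 * expR x / 2 - expR x)) u0 => [x||x x0].
  - by apply: is_derive_eq; rewrite /GRing.scale /=; field.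
  - by rewrite expR0; field.
  - have e1 : expR x * (1 - x) <= 1.
      rewrite -[leRHS](expRxMexpNx_1 x) ler_pM2l ?expR_gt0//.
      exact: expR_ge1Dx.
    have : 0 <= x ^+ 2 * expR x / 2 by rewrite divr_ge0 ?mulr_ge0 ?sqr_ge0 ?expR_ge0.
    by lra.
have e0 := expR_gt0 u; have e0' := expR_gt0 (- u).
have eE := expRxMexpNx_1 u.
have := @expR_ge_quadratic (- u); rewrite oppr_ge0 => /(_ u0) en.
have : expR u <= 1 + u + u ^+ 2 / 2.
  have h : expR u * (1 + - u + (- u) ^+ 2 / 2) <= 1 by rewrite -[leRHS]eE ler_pM2l.
  have q : 1 <= (1 + u + u ^+ 2 / 2) * (1 + - u + (- u) ^+ 2 / 2).
    have -> : (1 + u + u ^+ 2 / 2) * (1 + - u + (- u) ^+ 2 / 2) = 1 + (u ^+ 2 / 2) ^+ 2 by field.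
    by rewrite lerDl sqr_ge0.
  have q0 : 0 < 1 + - u + (- u) ^+ 2 / 2.
    by have := sqr_ge0 (- u); lra.
  by rewrite -(ler_pM2r q0) (le_trans h).
move/le_trans; apply; rewrite lerD2l ler_pM2r ?invr_gt0//.
by rewrite ler_peMr ?sqr_ge0// -[leLHS]expR0 ler_expR.
Qed.

Lemma expR_le_geom u : 0 <= u -> u < 1 -> expR u <= (1 - u)^-1.
Proof.
move=> u0 u1; rewrite -[leLHS]invrK lef_pV2 ?posrE ?invr_gt0 ?expR_gt0 ?subr_gt0//.
by rewrite -expRN expR_ge1Dx.
Qed.

Lemma expR_ge_quadratic_abs u c : `|u| <= c -> c <= 2^-1 ->
  1 + u + (1 - 2 * c) * u ^+ 2 / 2 <= expR u.
Proof.
move=> uc c2; have [u0|u0] := leP 0 u.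
  apply: le_trans (expR_ge_quadratic u0).
  have : 0 <= u ^+ 2 by rewrite sqr_ge0.
  have : 0 <= c by exact: le_trans uc.
  by nra.
rewrite ltr0_norm// in uc; set v := - u in uc; have uE : u = - v by rewrite opprK.
rewrite uE in u0 *; have v0 : 0 < v by rewrite -oppr_lt0.
have c0 : 0 < c by exact: lt_le_trans uc.
have E1 : 1 + c <= expR c by exact: expR_ge1Dx.
have E2 : expR c <= 1 + 2 * c.
  apply: (le_trans (expR_le_geom (ltW c0) _)); first by lra.
  by rewrite invf_ple ?posrE; [|lra|lra]; rewrite -[leLHS]mul1r ler_pdivrMr; [nra|lra].
have ev := expR_le_quadratic uc (ltW c0).
have evN := expRxMexpNx_1 v; have en0 := expR_gt0 (- v).
set E := expR c in E1 E2 ev; set X := expR (- v) in evN en0 *.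
have h : 1 <= (1 + v + v ^+ 2 * E / 2) * X by rewrite -[leLHS]evN ler_pM2r.
have q0 : 0 < 1 + v + v ^+ 2 * E / 2.
  by rewrite addr_gt0 ?addr_gt0// divr_gt0// mulr_gt0 ?exprn_gt0//; lra.
rewrite -(ler_pM2l q0); apply: le_trans h.
have -> : (1 + v + v ^+ 2 * E / 2) * (1 - v + (1 - 2 * c) * (- v) ^+ 2 / 2) =
  1 + v ^+ 2 / 2 * ((E - 1 - 2 * c) + v * (1 - 2 * c - E) + E * (1 - 2 * c) * v ^+ 2 / 2) by field.
rewrite gerDl mulr_ge0_le0 ?divr_ge0 ?sqr_ge0//.
have a1 : E * (1 - 2 * c) <= 1 by nra.
have : E * (1 - 2 * c) * v ^+ 2 <= v ^+ 2 by rewrite -[leRHS]mul1r ler_wpM2r ?sqr_ge0.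
nra.
Qed.

Lemma expR_le3 : expR 1 <= 3 :> R.
Proof.
have -> : 1 = 3%:R^-1 + 3%:R^-1 + 3%:R^-1 :> R by field.
have i0 : 0 <= 3%:R^-1 :> R by rewrite invr_ge0.
have i1 : 3%:R^-1 < 1 :> R by lra.
have h : expR 3%:R^-1 <= 17 / 12 :> R.
  have := expR_le_quadratic (lexx 3%:R^-1) i0; have := expR_le_geom i0 i1.
  have -> : (1 - 3%:R^-1)^-1 = 3 / 2 :> R by field.
  by lra.
rewrite !expRD; set e := expR _ in h *.
have e0 : 0 < e by exact: expR_gt0.
have : e * e <= (17 / 12) * (17 / 12) by apply: ler_pM; lra.
move=> h2.
have : e * e * e <= (17 / 12) * (17 / 12) * (17 / 12) by apply: ler_pM; rewrite ?mulr_ge0; lra.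
lra.
Qed.

Lemma expR_ge_shrunk u c : 0 <= u -> u <= c -> c <= 1 -> expR ((1 - c) * u) <= 1 + u.
Proof.
move=> u0 uc c1.
have v1 : (1 - c) * u < 1 by nra.
apply: (le_trans (expR_le_geom _ v1)); first by rewrite mulr_ge0 ?subr_ge0.
rewrite -[leLHS]mul1r ler_pdivrMr ?subr_gt0//; nra.
Qed.

Lemma expR_le_1B u : 0 <= u -> u <= 2^-1 -> expR (- 2 * u) <= 1 - u.
Proof.
move=> u0 u2; rewrite mulNr expRN.
rewrite -[leRHS]invrK lef_pV2 ?posrE ?expR_gt0 ?invr_gt0//; last by lra.
have : 1 + 2 * u <= expR (2 * u) by exact: expR_ge1Dx.
apply: le_trans.
rewrite -[leLHS]mul1r ler_pdivrMr; nra.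
Qed.

End ExponentialBounds.

(** * Chernoff bounds for the scenery *)

Section SceneryTails.
Variables (R : realType) (dO : measure_display) (O : measurableType dO).
Variables (P : probability O R) (I : choiceType).
Variables (X : {RV P >-> R}) (xi : I -> {RV P >-> R}).
Hypothesis xi_copies : independent_copies X xi.
Hypothesis EX0 : ('E_P[X] = 0)%E.
Hypothesis EX4 : ('E_P[fun w => (X w ^+ 4)%R] < +oo)%E.
Local Notation s2 := (second_moment X).
Local Notation m4 := (fourth_moment X).

Lemma second_moment_ge0 : 0 <= s2.
Proof. by apply: fine_ge0; rewrite unlock; apply: integral_ge0 => w _; rewrite lee_fin sqr_ge0. Qed.

Lemma fourth_moment_ge0 : 0 <= m4.
Proof. by apply: fine_ge0; rewrite unlock; apply: integral_ge0 => w _; rewrite lee_fin exprn_even_ge0. Qed.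

(** Otherwise the expectation of (1 - X^2/s2)^2 would be -1. *)
Lemma fourth_moment_gt0 : 0 < s2 -> 0 < m4.
Proof.
move=> s0; rewrite lt_neqAle fourth_moment_ge0 andbT eq_sym; apply/eqP => m40.
have [_ iq] := integral_quartic EX0 EX4 0 (- 2 / s2) (s2^-1 ^+ 2).
have : (0 <= (1 + - 2 / s2 * s2 + s2^-1 ^+ 2 * m4)%:E)%E.
  rewrite -iq; apply: integral_ge0 => w _; rewrite lee_fin.
  have -> : 1 + 0 * X w + - 2 / s2 * X w ^+ 2 + s2^-1 ^+ 2 * X w ^+ 4 =
    (1 - X w ^+ 2 / s2) ^+ 2 by field; rewrite gt_eqF.
  exact: sqr_ge0.
rewrite lee_fin m40 mulr0 addr0 divfK ?gt_eqF//; lra.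
Qed.

Lemma prob_le_integral (E : set O) (G : O -> R) : measurable E ->
  measurable_fun setT G -> (forall w, 0 <= G w) -> (forall w, E w -> 1 <= G w) ->
  (P E <= \int[P]_w (G w)%:E)%E.
Proof.
move=> mE mG G0 EG; rewrite -[E in X in (X <= _)%E]setIT -integral_indic//.
apply: ge0_le_integral => //.
- by apply/measurable_EFinP; exact: measurable_indic.
- exact/measurable_EFinP.
- move=> w _; rewrite lee_fin indicE.
  by have [/set_mem/EG|_] := boolP (w \in E).
Qed.

Lemma measurable_fun_prod_scenery (J : seq I) (f : I -> R -> R) :
  (forall i, measurable_fun setT (f i)) ->
  measurable_fun setT (fun w => \prod_(i <- J) f i (xi i w)).
Proof.
move=> mf; apply: measurable_prod => i _.
by apply: measurableT_comp => //; exact: measurable_funP.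
Qed.

Lemma measurable_fun_sum_scenery (J : seq I) (f : I -> R -> R) :
  (forall i, measurable_fun setT (f i)) ->
  measurable_fun setT (fun w => \sum_(i <- J) f i (xi i w)).
Proof.
move=> mf; apply: measurable_sum => i.
by apply: measurableT_comp => //; exact: measurable_funP.
Qed.

Lemma measurable_ge (g : O -> R) (A : R) : measurable_fun setT g ->
  measurable [set w | A <= g w].
Proof.
move=> mg; have -> : [set w | A <= g w] = g @^-1` `[A, +oo[%classic.
  by apply/seteqP; split => w /=; rewrite in_itv/= andbT.
by rewrite -[X in measurable X]setTI; apply: mg.
Qed.

(** Chernoff's inequality in product form: an exponential moment is never computed,
it is replaced by a quartic polynomial that dominates it pointwise. *)
Lemma prob_le_prod (J : seq I) (f : I -> R -> R) (a b c : I -> R)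
    (E : set O) (C : R) : uniq J -> 0 <= C -> measurable E ->
  (forall i, measurable_fun setT (f i)) -> (forall i x, 0 <= f i x) ->
  (forall i x, f i x <= 1 + a i * x + b i * x ^+ 2 + c i * x ^+ 4) ->
  (forall w, E w -> 1 <= C * \prod_(i <- J) f i (xi i w)) ->
  (P E <= (C * \prod_(i <- J) (1 + b i * s2 + c i * m4))%:E)%E.
Proof.
move=> uJ C0 mE mf f0 fle Ew.
have mpr := measurable_fun_prod_scenery J mf.
apply: (le_trans (prob_le_integral mE _ _ Ew)).
- by apply: measurable_funM.
- by move=> w; rewrite mulr_ge0// prodr_ge0.
under eq_integral do rewrite EFinM.
rewrite ge0_integralZl//.
- rewrite EFinM; apply: lee_wpmul2l; first by rewrite lee_fin.
  exact: (integral_prod_le xi_copies EX0 EX4 uJ mf f0 fle).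
- exact/measurable_EFinP.
- by move=> w _; rewrite lee_fin prodr_ge0.
Qed.

Variables (J : seq I) (ell : I -> R).
Hypothesis uJ : uniq J.
Hypothesis ell_ge0 : forall i, 0 <= ell i.

Lemma measurable_set_le (g : R -> R) (A : R) : measurable_fun setT g ->
  measurable [set x | g x <= A].
Proof.
move=> mg; have -> : [set x | g x <= A] = g @^-1` `]-oo, A]%classic.
  by apply/seteqP; split => w /=; rewrite in_itv.
by rewrite -[X in measurable X]setTI; apply: mg.
Qed.

Definition below_ind (tau : R) (i : I) : R -> R := \1_[set x | ell i * x <= tau].
Definition above_ind (tau : R) (i : I) : R -> R := \1_[set x | tau < ell i * x].

Lemma below_indE tau i x : below_ind tau i x = (ell i * x <= tau)%R%:R.
Proof.
rewrite /below_ind indicE; have [h|/negP h] := boolP (ell i * x <= tau).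
  by rewrite mem_set.
by rewrite memNset.
Qed.

Lemma above_indE tau i x : above_ind tau i x = (tau < ell i * x)%R%:R.
Proof.
rewrite /above_ind indicE; have [h|/negP h] := boolP (tau < ell i * x).
  by rewrite mem_set.
by rewrite memNset.
Qed.

Lemma measurable_below_ind tau i : measurable_fun setT (below_ind tau i).
Proof. by apply: measurable_indic; apply: measurable_set_le; exact: measurable_funM. Qed.

Lemma measurable_above_ind tau i : measurable_fun setT (above_ind tau i).
Proof.
apply: measurable_indic.
rewrite (_ : [set x | _] = ~` [set x | ell i * x <= tau]).
  by apply: measurableC; apply: measurable_set_le; exact: measurable_funM.
by apply/seteqP; split => x /=; rewrite ltNge => /negP.
Qed.

(** Where ell x > tau the truncated exponential is 1, which is at most
1 + h ell x: cutting off large positive values only lowers the mean, so the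
truncation needs no recentring. *)
Lemma bounded_part_tail (h tau A : R) : 0 <= h -> 0 <= tau ->
  (P [set w | (A <= \sum_(i <- J) ell i * xi i w * below_ind tau i (xi i w))%R] <=
   (expR (- h * A + h ^+ 2 * (\sum_(i <- J) ell i ^+ 2) * s2 * expR (h * tau) / 2))%:E)%E.
Proof.
move=> h0 tau0.
pose f i x := expR (h * (ell i * x * below_ind tau i x)).
pose b i := h ^+ 2 * ell i ^+ 2 * expR (h * tau) / 2.
have mg i : measurable_fun setT (fun x => ell i * x * below_ind tau i x).
  by apply: measurable_funM; [exact: measurable_funM|exact: measurable_below_ind].
have mf i : measurable_fun setT (f i).
  apply: measurableT_comp; first exact: measurable_expR.
  exact: measurable_funM.
have fle i x : f i x <= 1 + h * ell i * x + b i * x ^+ 2 + 0 * x ^+ 4.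
  rewrite /f /b below_indE; have [lx|lx] := leP (ell i * x) tau.
    rewrite mulr1 mulrA.
    apply: le_trans (expR_le_quadratic (_ : _ <= h * tau) (mulr_ge0 h0 tau0)) _.
      by rewrite -mulrA ler_wpM2l.
    by rewrite le_eqVlt; apply/orP; left; apply/eqP; field.
  rewrite mulr0 mulr0 expR0 mul0r addr0 -addrA lerDl addr_ge0//.
    by rewrite -mulrA mulr_ge0// ltW// (le_lt_trans tau0).
  by rewrite mulr_ge0 ?sqr_ge0// divr_ge0// mulr_ge0 ?expR_ge0// mulr_ge0 ?sqr_ge0.
have := @prob_le_prod J f (fun i => h * ell i) b (fun=> 0) _ (expR (- h * A)) uJ
  (expR_ge0 _) (measurable_ge A (measurable_fun_sum_scenery J mg)) mf
  (fun i x => expR_ge0 _) fle.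
move=> /(_ _)/le_trans; apply.
  move=> w /= Aw; rewrite /f -expR_sum -expRD -[leLHS]expR0 ler_expR -mulr_sumr.
  by rewrite mulNr addrC subr_ge0 ler_wpM2l.
rewrite lee_fin expRD ler_wpM2l ?expR_ge0//.
apply: (@le_trans _ _ (\prod_(i <- J) expR (b i * s2))).
  apply: ler_prod => i _; rewrite mul0r addr0 expR_ge1Dx andbT addr_ge0//.
  by rewrite mulr_ge0 ?second_moment_ge0// !mulr_ge0 ?sqr_ge0 ?expR_ge0.
rewrite -expR_sum ler_expR le_eqVlt; apply/orP; left; apply/eqP.
by rewrite mulr_sumr !mulr_suml; apply: eq_bigr => i _; rewrite /b; field.
Qed.

(** The indicator of ell x > tau is at most (ell x / tau)^4. *)
Lemma large_part_tail (th tau m : R) : 0 <= th -> 0 < tau ->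
  (P [set w | (m <= \sum_(i <- J) ell i * above_ind tau i (xi i w))%R] <=
   (expR (- th * m) *
    \prod_(i <- J) (1 + expR (th * ell i) * ell i ^+ 4 / tau ^+ 4 * m4))%:E)%E.
Proof.
move=> th0 tau0.
pose f i x := expR (th * (ell i * above_ind tau i x)).
pose c i := expR (th * ell i) * ell i ^+ 4 / tau ^+ 4.
have mg i : measurable_fun setT (fun x => ell i * above_ind tau i x).
  by apply: measurable_funM => //; exact: measurable_above_ind.
have mf i : measurable_fun setT (f i).
  apply: measurableT_comp; first exact: measurable_expR.
  exact: measurable_funM.
have c0 i : 0 <= c i.
  by rewrite divr_ge0 ?(exprn_even_ge0 tau)// mulr_ge0 ?expR_ge0 ?(exprn_even_ge0 (ell i)).
have fle i x : f i x <= 1 + 0 * x + 0 * x ^+ 2 + c i * x ^+ 4.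
  rewrite !mul0r !addr0 /f above_indE; have [lx|lx] := ltP tau (ell i * x).
    rewrite mulr1 /c -[leLHS]mulr1 -mulrA -mulrA.
    rewrite (@le_trans _ _ (expR (th * ell i) * (ell i ^+ 4 * ((tau ^+ 4)^-1 * x ^+ 4))))//.
      rewrite ler_pM2l ?expR_gt0// [_^-1 * _]mulrC mulrA -exprMn.
      rewrite ler_pdivlMr ?exprn_gt0// mul1r lerXn2r ?nnegrE// ltW//.
      exact: lt_trans lx.
    by rewrite lerDr.
  by rewrite mulr0 mulr0 expR0 lerDl mulr_ge0// exprn_even_ge0.
have := @prob_le_prod J f (fun=> 0) (fun=> 0) c _ (expR (- th * m)) uJ
  (expR_ge0 _) (measurable_ge m (measurable_fun_sum_scenery J mg)) mf
  (fun i x => expR_ge0 _) fle.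
move=> /(_ _)/le_trans; apply.
  move=> w /= Aw; rewrite /f -expR_sum -expRD -[leLHS]expR0 ler_expR -mulr_sumr.
  by rewrite mulNr addrC subr_ge0 ler_wpM2l.
rewrite lee_fin ler_wpM2l ?expR_ge0//.
by apply: ler_prod => i _; rewrite mul0r addr0 lexx andbT addr_ge0// mulr_ge0// fourth_moment_ge0.
Qed.

(** A lower tail of a sum of nonnegative terms is controlled by the moments alone,
since exp(-u) <= 1 - u + u^2/2 for u >= 0. *)
Lemma norm_lower_tail (s A : R) : 0 <= s ->
  (P [set w | (\sum_(i <- J) ell i * xi i w ^+ 2 <= A)%R] <=
   (expR (s * A - s * (\sum_(i <- J) ell i) * s2 +
      s ^+ 2 * (\sum_(i <- J) ell i ^+ 2) * m4 / 2))%:E)%E.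
Proof.
move=> s0.
pose f i x := expR (- s * (ell i * x ^+ 2)).
pose b i := - s * ell i.
pose c i := s ^+ 2 * ell i ^+ 2 / 2.
have mg i : measurable_fun setT (fun x : R => - (ell i * x ^+ 2)).
  by apply: measurableT_comp => //; apply: measurable_funM => //; exact: measurable_funX.
have mf i : measurable_fun setT (f i).
  apply: measurableT_comp; first exact: measurable_expR.
  by apply: measurable_funM => //; apply: measurable_funM => //; exact: measurable_funX.
have fle i x : f i x <= 1 + 0 * x + b i * x ^+ 2 + c i * x ^+ 4.
  rewrite /f; apply: le_trans (expR_le_quadratic (_ : _ <= 0) (lexx 0)) _.
    by rewrite mulNr oppr_le0 mulr_ge0// mulr_ge0// sqr_ge0.
  by rewrite expR0 /b /c le_eqVlt; apply/orP; left; apply/eqP; field.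
have mE : measurable [set w | (\sum_(i <- J) ell i * xi i w ^+ 2 <= A)%R].
  have -> : [set w | (\sum_(i <- J) ell i * xi i w ^+ 2 <= A)%R] =
      [set w | (- A <= \sum_(i <- J) - (ell i * xi i w ^+ 2))%R].
    by apply/seteqP; split => w /=; rewrite sumrN lerN2.
  exact: (measurable_ge (- A) (measurable_fun_sum_scenery J mg)).
have := @prob_le_prod J f (fun=> 0) b c _ (expR (s * A)) uJ
  (expR_ge0 _) mE mf (fun i x => expR_ge0 _) fle.
move=> /(_ _)/le_trans; apply.
  move=> w /= Aw; rewrite /f -expR_sum -expRD -[leLHS]expR0 ler_expR -mulr_sumr.
  by rewrite mulNr subr_ge0 ler_wpM2l.
rewrite lee_fin -[in leRHS]addrA expRD ler_wpM2l ?expR_ge0//.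
apply: (@le_trans _ _ (\prod_(i <- J) expR (b i * s2 + c i * m4))).
  apply: ler_prod => i _; rewrite -addrA expR_ge1Dx andbT.
  have [_ iq] := integral_quartic EX0 EX4 0 (b i) (c i).
  rewrite addrA -lee_fin -iq; apply: integral_ge0 => w _; rewrite lee_fin.
  exact: le_trans (expR_ge0 _) (fle i (X w)).
rewrite -expR_sum ler_expR le_eqVlt; apply/orP; left; apply/eqP.
rewrite big_split /=; congr (_ + _).
  by rewrite mulr_sumr mulr_suml -sumrN; apply: eq_bigr => i _; rewrite /b; ring.
by rewrite mulr_sumr !mulr_suml; apply: eq_bigr => i _; rewrite /c; field.
Qed.

End SceneryTails.

(** * Upper bound along a fixed trajectory *)

Section UpperScenery.
Variables (R : realType) (I : choiceType) (J : seq I) (ell : I -> R).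
Hypothesis uJ : uniq J.
Hypothesis ell_ge0 : forall i, 0 <= ell i.
Hypothesis ell_ge1 : forall i, i \in J -> 1 <= ell i.

Lemma sum_ell_le_sq : \sum_(i <- J) ell i <= \sum_(i <- J) ell i ^+ 2.
Proof.
rewrite big_seq [leRHS]big_seq; apply: ler_sum => i iJ.
by rewrite expr2 ler_peMr// ell_ge1.
Qed.

(** If the second and third alternatives fail, the part U of T carried by the
vertices with ell z > tau is at most e y V by Cauchy-Schwarz, and
sqrt n <= sqrt Q makes this at most the fraction e of the required value of T. *)
Lemma large_ratio_split (z : I -> R) (n y s2 e tau : R) :
  0 < n -> n <= \sum_(i <- J) ell i -> 0 < y -> 0 < s2 -> 0 < e -> e < 1 ->
  y <= (\sum_(i <- J) ell i * z i) * Num.sqrt n /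
     (Num.sqrt (\sum_(i <- J) ell i * z i ^+ 2) *
      Num.sqrt (\sum_(i <- J) ell i ^+ 2)) ->
  [\/ (1 - e) ^+ 2 * y * Num.sqrt (\sum_(i <- J) ell i ^+ 2) * Num.sqrt s2
        <= \sum_(i <- J) ell i * z i * below_ind ell tau i (z i),
      e ^+ 2 * y ^+ 2 <= \sum_(i <- J) ell i * above_ind ell tau i (z i) |
      \sum_(i <- J) ell i * z i ^+ 2 <= (1 - e) * (\sum_(i <- J) ell i) * s2].
Proof.
move=> n0 nN y0 s20 e0 e1.
set T := \sum_(i <- J) ell i * z i; set V2 := \sum_(i <- J) ell i * z i ^+ 2.
set N := \sum_(i <- J) ell i in nN *.
have NQ := sum_ell_le_sq; rewrite -/N in NQ.
set Q := \sum_(i <- J) ell i ^+ 2 in NQ *.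
set B := \sum_(i <- J) _ * below_ind _ _ _ _; set W := \sum_(i <- J) _ * above_ind _ _ _ _.
move=> Hr.
have [W2|W2] := leP (e ^+ 2 * y ^+ 2) W; first exact: Or32.
have [V3|V3] := leP V2 ((1 - e) * N * s2); first exact: Or33.
apply: Or31.
have e10 : 0 < 1 - e by rewrite subr_gt0.
have N0 : 0 < N by exact: lt_le_trans nN.
have V20 : 0 < V2 by apply: lt_trans V3; rewrite mulr_gt0// mulr_gt0.
have Q0 : 0 < Q by exact: lt_le_trans NQ.
set V := Num.sqrt V2 in Hr; set L := Num.sqrt Q in Hr *; set r := Num.sqrt n in Hr.
set sg := Num.sqrt s2.
have V0 : 0 < V by rewrite sqrtr_gt0.
have L0 : 0 < L by rewrite sqrtr_gt0.
have r0 : 0 < r by rewrite sqrtr_gt0.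
have sg0 : 0 < sg by rewrite sqrtr_gt0.
have VE : V2 = V ^+ 2 by rewrite sqr_sqrtr// ltW.
have rL : r <= L by rewrite /r /L ler_sqrt ?(ltW Q0)//; exact: le_trans nN NQ.
have TE : T = B + \sum_(i <- J) ell i * z i * above_ind ell tau i (z i).
  rewrite -big_split /=; apply: eq_bigr => i _.
  by rewrite below_indE above_indE; case: leP => _; rewrite ?mulr1 ?mulr0 ?addr0 ?add0r.
set U := \sum_(i <- J) _ in TE.
have UV : U <= e * y * V.
  (* Minimizes the bound z <= (mu z^2 + 1/mu)/2 summed with weights ell. *)
  pose mu := e * y / V.
  have mu0 : 0 < mu by rewrite divr_gt0// mulr_gt0.
  have : U <= (mu * V2 + mu^-1 * W) / 2.
    rewrite /V2 /W !mulr_sumr -big_split /= mulr_suml; apply: ler_sum => i _.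
    rewrite above_indE; case: (tau < _); rewrite ?mulr1 ?mulr0 ?addr0; last first.
      by rewrite divr_ge0// mulr_ge0 ?(ltW mu0)// mulr_ge0// sqr_ge0.
    rewrite -subr_ge0.
    have -> : (mu * (ell i * z i ^+ 2) + mu^-1 * ell i) / 2 - ell i * z i =
      ell i * (mu * z i - 1) ^+ 2 / mu / 2 by field; rewrite gt_eqF.
    by rewrite divr_ge0// divr_ge0 ?(ltW mu0)// mulr_ge0// sqr_ge0.
  move/le_trans; apply.
  have -> : mu * V2 = e * y * V by rewrite /mu VE; field; rewrite gt_eqF.
  have : mu^-1 * W <= e * y * V.
    have -> : e * y * V = mu^-1 * (e ^+ 2 * y ^+ 2).
      by rewrite /mu; field; rewrite ?(gt_eqF V0) ?(gt_eqF e0) ?(gt_eqF y0).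
    by rewrite ler_pM2l ?invr_gt0// ltW.
  lra.
have Hr' : y * V * L <= T * r.
  by move: Hr; rewrite ler_pdivlMr ?mulr_gt0// mulrA.
have VL : (1 - e) * r * sg <= V.
  rewrite -[leLHS]ger0_norm; last by rewrite !mulr_ge0 ?ltW.
  rewrite -sqrtr_sqr ler_sqrt ?(ltW V20)//.
  rewrite !exprMn !sqr_sqrtr ?(ltW n0) ?(ltW s20)//.
  apply: le_trans (ltW V3); rewrite ler_pM2r//.
  apply: ler_pM => //; rewrite ?sqr_ge0 ?(ltW n0)// expr2 ler_piMl//; lra.
rewrite -(ler_pM2r r0).
have h1 : (1 - e) * y * V * L <= B * r.
  have -> : B = T - U by rewrite TE addrK.
  have : U * r <= e * y * V * L.
    apply: (@le_trans _ _ (e * y * V * r)); first by rewrite ler_pM2r.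
    by rewrite ler_wpM2l// !mulr_ge0 ?ltW.
  lra.
apply: le_trans h1.
have -> : (1 - e) ^+ 2 * y * L * sg * r = ((1 - e) * y * L) * ((1 - e) * r * sg) by ring.
have -> : (1 - e) * y * V * L = ((1 - e) * y * L) * V by ring.
by rewrite ler_wpM2l// !mulr_ge0 ?ltW.
Qed.

End UpperScenery.

Section UpperQuenched.
Variables (R : realType) (dO : measure_display) (O : measurableType dO).
Variables (P : probability O R) (I : choiceType).
Variables (X : {RV P >-> R}) (xi : I -> {RV P >-> R}).
Hypothesis xi_copies : independent_copies X xi.
Hypothesis EX0 : ('E_P[X] = 0)%E.
Hypothesis EX4 : ('E_P[fun w => (X w ^+ 4)%R] < +oo)%E.
Local Notation s2 := (second_moment X).
Local Notation m4 := (fourth_moment X).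
Hypothesis s2_gt0 : 0 < s2.
Variables (J : seq I) (cnt : I -> nat).
Hypothesis uJ : uniq J.
Hypothesis cnt_gt0 : forall i, i \in J -> (0 < cnt i)%N.
Let ell i : R := (cnt i)%:R.

Definition ratio_event (n y : R) : set O := [set w |
  (y <= (\sum_(i <- J) ell i * xi i w) * Num.sqrt n /
     (Num.sqrt (\sum_(i <- J) ell i * xi i w ^+ 2) *
      Num.sqrt (\sum_(i <- J) ell i ^+ 2)))%R].

Lemma measurable_ratio_event n y : measurable (ratio_event n y).
Proof.
pose T w := \sum_(i <- J) ell i * xi i w.
pose V2 w := \sum_(i <- J) ell i * xi i w ^+ 2.
pose Q := \sum_(i <- J) ell i ^+ 2.
have V20 w : 0 <= V2 w by apply: sumr_ge0 => i _; rewrite mulr_ge0// sqr_ge0.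
have -> : ratio_event n y = [set w | (y <= T w * Num.sqrt n *
    (V2 w `^ 2^-1 * Num.sqrt Q) `^ (-1))%R].
  apply/seteqP; split => w; rewrite /ratio_event /=;
  by rewrite powR12_sqrt// powR_inv1// mulr_ge0 ?sqrtr_ge0.
have mT : measurable_fun setT T.
  by apply: (measurable_fun_sum_scenery xi J (f := fun i x => ell i * x)) => i; exact: measurable_funM.
have mV2 : measurable_fun setT V2.
  apply: (measurable_fun_sum_scenery xi J (f := fun i x => ell i * x ^+ 2)) => i.
  by apply: measurable_funM => //; exact: measurable_funX.
apply: measurable_ge; apply: measurable_funM; first exact: measurable_funM.
apply: (measurableT_comp (f := fun x : R => x `^ (-1))) => //.
apply: measurable_funM => //.
exact: (measurableT_comp (f := fun x : R => x `^ 2^-1)).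
Qed.

(** The four exponential terms are the three alternatives of large_ratio_split and
the trajectories on which some vertex is visited more than m times. On the
latter the estimate for V fails, but exp(- th m) / p times the product is at
least 1, so they are absorbed by the same average over the walk. *)
Lemma ratio_upper (n y e th tau p m : R) :
  0 < n -> n <= \sum_(i <- J) ell i -> 0 < y -> 0 < e -> e < 1 ->
  0 < th -> 0 < p -> 0 < m ->
  tau = (e / 2) * Num.sqrt n * Num.sqrt s2 / y ->
  24 * (2 / th) ^+ 4 * m4 / tau ^+ 4 <= p ->
  (P (ratio_event n y) <=
   (expR (- (1 - e) ^+ 4 * (1 - expR (e / 2) / 2) * y ^+ 2)
    + (expR (- (th / 2) * (e ^+ 2 * y ^+ 2)) + expR (- th * m) / p) *
      \prod_(i <- J) (1 + p * expR (th * ell i))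
    + expR (- (e ^+ 2 * s2 ^+ 2 / (2 * m * m4) * \sum_(i <- J) ell i)))%:E)%E.
Proof.
move=> n0 nN y0 e0 e1 th0 p0 m0 tauE pE.
have ell_ge0 i : 0 <= ell i by exact: ler0n.
have ell_ge1 i : i \in J -> 1 <= ell i by move=> /cnt_gt0; rewrite ler1n.
have NQ := sum_ell_le_sq ell_ge0 ell_ge1.
set N := \sum_(i <- J) ell i in nN NQ *.
set Q := \sum_(i <- J) ell i ^+ 2 in NQ.
set PI := \prod_(i <- J) _.
have N0 : 0 < N by exact: lt_le_trans nN.
have Q0 : 0 < Q by exact: lt_le_trans NQ.
have m40 : 0 < m4 by exact: fourth_moment_gt0.
pose L := Num.sqrt Q; pose sg := Num.sqrt s2; pose r := Num.sqrt n.
have L0 : 0 < L by rewrite sqrtr_gt0.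
have r0 : 0 < r by rewrite sqrtr_gt0.
have sg0 : 0 < sg by rewrite sqrtr_gt0.
have rL : r <= L by rewrite /r /L ler_sqrt ?(ltW Q0)//; exact: le_trans nN NQ.
have LE : L ^+ 2 = Q by rewrite sqr_sqrtr// ltW.
have sgE : sg ^+ 2 = s2 by rewrite sqr_sqrtr// ltW.
have tau0 : 0 < tau by rewrite tauE !(divr_gt0, mulr_gt0).
pose E1 := [set w | ((1 - e) ^+ 2 * y * L * sg <=
  \sum_(i <- J) ell i * xi i w * below_ind ell tau i (xi i w))%R].
pose E2 := [set w | (e ^+ 2 * y ^+ 2 <= \sum_(i <- J) ell i * above_ind ell tau i (xi i w))%R].
pose E3 := [set w | (\sum_(i <- J) ell i * xi i w ^+ 2 <= (1 - e) * N * s2)%R].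
have mE1 : measurable E1.
  apply: measurable_ge; apply: (measurable_fun_sum_scenery xi J (f := fun i x => ell i * x * below_ind ell tau i x)) => i.
  by apply: measurable_funM; [exact: measurable_funM|exact: measurable_below_ind].
have mE2 : measurable E2.
  apply: measurable_ge; apply: (measurable_fun_sum_scenery xi J (f := fun i x => ell i * above_ind ell tau i x)) => i.
  by apply: measurable_funM => //; exact: measurable_above_ind.
have mE3 : measurable E3.
  have -> : E3 = [set w | (- ((1 - e) * N * s2) <= \sum_(i <- J) - (ell i * xi i w ^+ 2))%R].
    by apply/seteqP; split => w; rewrite /E3 /= sumrN lerN2.
  apply: measurable_ge; apply: (measurable_fun_sum_scenery xi J (f := fun i x => - (ell i * x ^+ 2))) => i.
  by apply: measurableT_comp => //; apply: measurable_funM => //; exact: measurable_funX.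
have sub : ratio_event n y `<=` (E1 `|` E2) `|` E3.
  move=> w; rewrite /ratio_event /= => Hw.
  by have [] := large_ratio_split ell_ge0 ell_ge1 tau n0 nN y0 s2_gt0 e0 e1 Hw;
    [left; left|left; right|right].
have mE12 : measurable (E1 `|` E2) by exact: measurableU.
apply: (@le_trans _ _ (P E1 + P E2 + P E3)%E).
  apply: (@le_trans _ _ (P ((E1 `|` E2) `|` E3))).
    apply: le_measure => //; rewrite inE; first exact: measurable_ratio_event.
    exact: measurableU.
  apply: (le_trans (measureU2 _ mE12 mE3)).
  by rewrite leeD2r// measureU2.
have B1 : (P E1 <= (expR (- (1 - e) ^+ 4 * (1 - expR (e / 2) / 2) * y ^+ 2))%:E)%E.
  (* The minimizer of - h A + h^2 Q s2 / 2 at A = (1-e)^2 y L sg. *)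
  pose h := (1 - e) ^+ 2 * y / (L * sg).
  have h0 : 0 <= h.
    by apply: divr_ge0; apply: mulr_ge0; rewrite ?sqr_ge0 ?(ltW y0) ?(ltW L0) ?(ltW sg0).
  apply: (le_trans (bounded_part_tail xi_copies EX0 EX4 uJ ell_ge0 _ h0 (ltW tau0))).
  rewrite lee_fin ler_expR -/Q.
  have hA : - h * ((1 - e) ^+ 2 * y * L * sg) = - (1 - e) ^+ 4 * y ^+ 2.
    by rewrite /h; field; rewrite ?gt_eqF.
  have hQ : h ^+ 2 * Q * s2 = (1 - e) ^+ 4 * y ^+ 2.
    by rewrite /h -LE -sgE; field; rewrite ?gt_eqF.
  rewrite hA hQ.
  have htau : h * tau <= e / 2.
    have -> : h * tau = (1 - e) ^+ 2 * (r / L) * (e / 2).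
      by rewrite /h tauE -/r -/sg; field; rewrite ?gt_eqF.
    rewrite ler_piMl ?divr_ge0 ?(ltW e0)//.
    have rL1 : r / L <= 1 by rewrite ler_pdivrMr// mul1r.
    have rL0 : 0 <= r / L by rewrite divr_ge0 ?ltW.
    have : (1 - e) ^+ 2 <= 1 by rewrite expr_le1//; lra.
    have := sqr_ge0 (1 - e); nra.
  have ex : expR (h * tau) <= expR (e / 2) by rewrite ler_expR.
  have : 0 <= (1 - e) ^+ 4 * y ^+ 2 by rewrite mulr_ge0 ?sqr_ge0 ?exprn_even_ge0.
  nra.
have PI0 : 0 < PI.
  by apply: prodr_gt0 => i _; rewrite addr_gt0// mulr_gt0// expR_gt0.
have B2 : (P E2 <= (expR (- (th / 2) * (e ^+ 2 * y ^+ 2)) * PI)%:E)%E.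
  have th20 : 0 <= th / 2 by rewrite divr_ge0 ?ltW.
  have := large_part_tail xi_copies EX0 EX4 ell uJ (e ^+ 2 * y ^+ 2) th20 tau0.
  move/le_trans; apply.
  rewrite lee_fin ler_wpM2l ?expR_ge0//; apply: ler_prod => i _.
  apply/andP; split.
    rewrite addr_ge0// mulr_ge0 ?(ltW m40)// divr_ge0 ?(exprn_even_ge0 tau)//.
    by rewrite mulr_ge0 ?expR_ge0// exprn_even_ge0.
  rewrite lerD2l.
  (* Half of the exponential weight absorbs the factor ell^4. *)
  have q : ell i ^+ 4 <= 24 * (2 / th) ^+ 4 * expR (th / 2 * ell i).
    have x0 : 0 <= th / 2 * ell i by rewrite mulr_ge0.
    have := expR_ge1Dxn 3 x0; rewrite (_ : 4`! = 24)%N// => q.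
    have {}q : (th / 2 * ell i) ^+ 4 <= 24 * expR (th / 2 * ell i) by lra.
    rewrite -mulrA mulrCA.
    have -> : ell i ^+ 4 = (2 / th) ^+ 4 * (th / 2 * ell i) ^+ 4.
      by field; rewrite gt_eqF.
    by rewrite ler_wpM2l// exprn_even_ge0.
  apply: (@le_trans _ _ (24 * (2 / th) ^+ 4 * m4 / tau ^+ 4 * expR (th * ell i))); last first.
    by rewrite ler_pM2r ?expR_gt0.
  have -> : expR (th * ell i) = expR (th / 2 * ell i) * expR (th / 2 * ell i).
    by rewrite -expRD; congr expR; field.
  have -> : 24 * (2 / th) ^+ 4 * m4 / tau ^+ 4 * (expR (th / 2 * ell i) * expR (th / 2 * ell i))
    = expR (th / 2 * ell i) * (24 * (2 / th) ^+ 4 * expR (th / 2 * ell i)) / tau ^+ 4 * m4.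
    by field; rewrite ?gt_eqF.
  rewrite ler_pM2r// ler_pM2r ?invr_gt0 ?exprn_gt0// ler_pM2l ?expR_gt0//.
have B3 : (P E3 <= (expR (- (e ^+ 2 * s2 ^+ 2 / (2 * m * m4) * N)) + expR (- th * m) / p * PI)%:E)%E.
  have [/hasP[i iJ /= mi]|/hasPn noti] := boolP (has (fun i => m < ell i) J).
    apply: (@le_trans _ _ 1%E); first exact: probability_le1.
    rewrite lee_fin -[leLHS]add0r lerD ?expR_ge0//.
    have : p * expR (th * m) <= PI.
      rewrite /PI (bigD1_seq i)//= -[leLHS]mulr1; apply: ler_pM => //.
      - by rewrite mulr_ge0 ?expR_ge0// ltW.
      - by rewrite -[leLHS]add0r lerD// ler_wpM2l ?(ltW p0)// ler_expR ler_pM2l// ltW.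
      - elim/big_rec: _ => // j x _ x1; rewrite -[leLHS]mulr1 ler_pM//.
        by rewrite lerDl mulr_ge0 ?expR_ge0// ltW.
    have eE : expR (- th * m) / p * (p * expR (th * m)) = 1.
      by rewrite mulrA divfK ?gt_eqF// -expRD mulNr addNr expR0.
    move=> h; apply: (@le_trans _ _ (expR (- th * m) / p * (p * expR (th * m)))).
      by rewrite eE.
    rewrite ler_wpM2l//.
    by rewrite divr_ge0 ?expR_ge0// ltW.
  have QmN : Q <= m * N.
    rewrite /Q /N mulr_sumr big_seq [leRHS]big_seq; apply: ler_sum => i iJ.
    by rewrite expr2 ler_wpM2r// leNgt noti.
  (* The minimizer of - s e N s2 + s^2 Q m4 / 2. *)
  pose s := e * N * s2 / (Q * m4).
  have s0 : 0 <= s.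
    by rewrite ltW// divr_gt0 ?mulr_gt0.
  apply: (le_trans (norm_lower_tail xi_copies EX0 EX4 uJ ell_ge0 _ s0)).
  rewrite lee_fin -[leLHS]addr0 lerD//; last first.
    by rewrite mulr_ge0 ?(ltW PI0)// divr_ge0 ?expR_ge0// ltW.
  rewrite ler_expR -/Q -/N.
  have -> : s * ((1 - e) * N * s2) - s * N * s2 + s ^+ 2 * Q * m4 / 2 =
    - (e ^+ 2 * s2 ^+ 2 / (2 * m4) * (N * (N / Q))).
    by rewrite /s; field; rewrite ?gt_eqF.
  have -> : e ^+ 2 * s2 ^+ 2 / (2 * m * m4) * N = e ^+ 2 * s2 ^+ 2 / (2 * m4) * (N * m^-1).
    by field; rewrite ?gt_eqF.
  rewrite lerN2 ler_wpM2l//; first by rewrite divr_ge0 ?mulr_ge0 ?sqr_ge0// ltW.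
  rewrite ler_pM2l// ler_pdivlMr// mulrC ler_pdivrMr// mulrC//.
apply: (le_trans (leeD (leeD B1 B2) B3)).
rewrite -!EFinD lee_fin mulrDl; lra.
Qed.

End UpperQuenched.

(** * Lower bound along a fixed trajectory *)

Section TiltNumerics.
Variable R : realType.

(** Leaving the window from below costs eta^2/2 in the exponent; kap, the relative
error of the quadratic approximation of the exponential, is chosen small enough
to preserve half of it. *)
Lemma tilt_below_exponent (eta kap Y : R) :
  kap = eta ^+ 2 / 12 -> 0 <= Y -> 0 <= eta -> eta <= 2^-1 ->
  eta * (1 - eta) * Y + (1 + kap) * ((1 - eta) ^+ 2 * Y / 2) <=
    (1 - 2 * kap) * Y / 2 - (eta ^+ 2 / 4) * Y.
Proof.
move=> kapE Y0 e0 e2.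
rewrite -subr_ge0.
have -> : (1 - 2 * kap) * Y / 2 - (eta ^+ 2 / 4) * Y -
  (eta * (1 - eta) * Y + (1 + kap) * ((1 - eta) ^+ 2 * Y / 2)) =
  Y * (eta ^+ 2 / 4 - kap * (1 + (1 - eta) ^+ 2 / 2)) by field.
rewrite mulr_ge0// kapE.
have : 0 <= eta ^+ 2 by rewrite sqr_ge0.
have : (1 - eta) ^+ 2 <= 1 by rewrite expr_le1//; lra.
nra.
Qed.

Lemma tilt_above_exponent (eta kap Y : R) :
  kap = eta ^+ 2 / 12 -> 0 <= Y -> 0 <= eta -> eta <= 2^-1 ->
  - (eta * (1 + eta) * Y) + (1 + kap) * ((1 + eta) ^+ 2 * Y / 2) <=
    (1 - 2 * kap) * Y / 2 - (eta ^+ 2 / 4) * Y.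
Proof.
move=> kapE Y0 e0 e2.
rewrite -subr_ge0.
have -> : (1 - 2 * kap) * Y / 2 - (eta ^+ 2 / 4) * Y -
  (- (eta * (1 + eta) * Y) + (1 + kap) * ((1 + eta) ^+ 2 * Y / 2)) =
  Y * (eta ^+ 2 / 4 - kap * (1 + (1 + eta) ^+ 2 / 2)) by field.
rewrite mulr_ge0// kapE.
have : 0 <= eta ^+ 2 by rewrite sqr_ge0.
have : (1 + eta) ^+ 2 <= 4 by nra.
nra.
Qed.

Lemma tilt_norm_exponent (eta kap s n N Q M m4 s2 Y A : R) :
  0 <= eta -> eta <= 2^-1 -> kap <= 2^-1 -> 0 <= s -> 0 <= s2 -> 0 <= m4 ->
  0 <= Y -> 0 <= M -> 0 <= n -> n <= N -> N <= (1 + eta) ^+ 2 * n -> Q <= M * N ->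
  - A - s * (1 + eta) * N * s2 + (s * N * s2 + 3 * Y + 3 * s ^+ 2 * Q * m4) <=
  - A + ((1 - 2 * kap) * Y / 2 - 16 * m4) +
   (- s * eta * n * s2 + 3 * Y + 12 * s ^+ 2 * M * n * m4 + 16 * m4).
Proof.
move=> e0 e2 k2 s0 s20 m40 Y0 M0 n0 nN Nn QMN.
have h1 : s * eta * s2 * n <= s * eta * s2 * N by rewrite ler_wpM2l// !mulr_ge0.
have N4 : N <= 4 * n by apply: (le_trans Nn); rewrite ler_wpM2r//; nra.
have h2 : s ^+ 2 * m4 * Q <= s ^+ 2 * m4 * (M * (4 * n)).
  rewrite ler_wpM2l ?mulr_ge0 ?sqr_ge0// (le_trans QMN)//.
  by rewrite ler_wpM2l.
have h3 : 0 <= (1 - 2 * kap) * Y by rewrite mulr_ge0//; lra.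
lra.
Qed.

Lemma sum_over_quarter (eta m4 n N : R) : 0 <= eta -> eta <= 2^-1 -> 0 <= m4 ->
  0 < n -> N <= (1 + eta) ^+ 2 * n -> 4 * m4 * N / n <= 16 * m4.
Proof.
move=> e0 e2 m40 n0 Nn; rewrite ler_pdivrMr//.
have -> : 16 * m4 * n = 4 * m4 * (4 * n) by ring.
rewrite ler_wpM2l ?mulr_ge0// (le_trans Nn)// ler_wpM2r ?(ltW n0)//; nra.
Qed.

Lemma expR_half_le (k : R) : 0 <= k -> k <= 2^-1 -> expR (k / 2) <= 1 + k.
Proof.
move=> k0 k2; apply: (le_trans (expR_le_geom _ _)); [lra|lra|].
by rewrite -[leLHS]mul1r ler_pdivrMr; [nra|lra].
Qed.

Lemma exponent_glue (A B E1 E2 D F m : R) : B + E2 <= D - F -> E1 <= E2 ->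
  A + B + E1 <= A + (D - m) + (- F + m).
Proof. by lra. Qed.

End TiltNumerics.

Section LowerQuenched.
Variables (R : realType) (dO : measure_display) (O : measurableType dO).
Variables (P : probability O R) (I : choiceType).
Variables (X : {RV P >-> R}) (xi : I -> {RV P >-> R}).
Hypothesis xi_copies : independent_copies X xi.
Hypothesis EX0 : ('E_P[X] = 0)%E.
Hypothesis EX4 : ('E_P[fun w => (X w ^+ 4)%R] < +oo)%E.
Local Notation s2 := (second_moment X).
Local Notation m4 := (fourth_moment X).
Hypothesis s2_gt0 : 0 < s2.
Variables (J : seq I) (cnt : I -> nat).
Hypothesis uJ : uniq J.
Hypothesis cnt_gt0 : forall i, i \in J -> (0 < cnt i)%N.
Let ell i : R := (cnt i)%:R.
Let ell_ge0 i : 0 <= ell i. Proof. exact: ler0n. Qed.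

(** A lower bound for a probability from functions G0, ..., G3 without subtracting
extended reals. *)
Lemma prob_ge_pointwise (E : set O) (G0 G1 G2 G3 : O -> R) (l0 u1 u2 u3 : R) :
  measurable E ->
  measurable_fun setT G0 -> measurable_fun setT G1 ->
  measurable_fun setT G2 -> measurable_fun setT G3 ->
  (forall w, 0 <= G0 w) -> (forall w, 0 <= G1 w) ->
  (forall w, 0 <= G2 w) -> (forall w, 0 <= G3 w) ->
  (forall w, ~ E w -> G0 w <= G1 w + G2 w + G3 w) ->
  (forall w, E w -> G0 w <= 1 + (G1 w + G2 w + G3 w)) ->
  (l0%:E <= \int[P]_w (G0 w)%:E)%E -> (\int[P]_w (G1 w)%:E <= u1%:E)%E ->
  (\int[P]_w (G2 w)%:E <= u2%:E)%E -> (\int[P]_w (G3 w)%:E <= u3%:E)%E ->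
  ((l0 - (u1 + u2 + u3))%:E <= P E)%E.
Proof.
move=> mE mG0 mG1 mG2 mG3 p0 p1 p2 p3 nE yE hl h1 h2 h3.
have mI : measurable_fun setT (fun w => \1_E w : R) by exact: measurable_indic.
have key : (l0%:E <= P E + (u1%:E + u2%:E + u3%:E))%E.
  apply: (le_trans hl).
  apply: (@le_trans _ _ (\int[P]_w ((\1_E w)%:E + ((G1 w)%:E + (G2 w)%:E + (G3 w)%:E)))%E).
    apply: ge0_le_integral => //.
    - by move=> w _; rewrite lee_fin.
    - exact/measurable_EFinP.
    - apply/measurable_EFinP; apply: measurable_funD => //.
      by apply: measurable_funD => //; exact: measurable_funD.
    - move=> w _; rewrite -!EFinD lee_fin indicE.
      have [/set_mem/yE//|Ew] := boolP (w \in E).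
      by rewrite add0r; apply: nE => wE; move: Ew; rewrite mem_set.
  have intD (f g : O -> R) : measurable_fun setT f -> measurable_fun setT g ->
      (forall w, 0 <= f w) -> (forall w, 0 <= g w) ->
      (\int[P]_w ((f w)%:E + (g w)%:E) = \int[P]_w (f w)%:E + \int[P]_w (g w)%:E)%E.
    move=> mf mg f0 g0; apply: ge0_integralD => //.
    - by move=> w _; rewrite lee_fin.
    - exact/measurable_EFinP.
    - by move=> w _; rewrite lee_fin.
    - exact/measurable_EFinP.
  under eq_integral do rewrite -!EFinD EFinD.
  rewrite intD//; last 2 first.
  - by apply: measurable_funD => //; exact: measurable_funD.
  - by move=> w; rewrite !addr_ge0.
  rewrite integral_indic// setIT leeD2l//.
  under eq_integral do rewrite EFinD.
  rewrite intD//; last 2 first.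
  - exact: measurable_funD.
  - by move=> w; rewrite addr_ge0.
  rewrite leeD//; under eq_integral do rewrite EFinD.
  by rewrite intD// leeD.
rewrite -!EFinD in key.
by rewrite EFinB leeBlDr.
Qed.

Definition bounded_ind (b : R) : R -> R := \1_[set x | `|x| <= b].

Lemma bounded_indE b x : bounded_ind b x = (`|x| <= b)%R%:R.
Proof.
rewrite /bounded_ind indicE; have [h|/negP h] := boolP (`|x| <= b).
  by rewrite mem_set.
by rewrite memNset.
Qed.

Lemma measurable_bounded_ind b : measurable_fun setT (bounded_ind b).
Proof.
apply: measurable_indic; rewrite (_ : [set x | _] = `[- b, b]%classic)//.
by apply/seteqP; split => x /=; rewrite in_itv/= ler_norml.
Qed.

(** The unnormalized density of the tilted scenery at one vertex. The parameter be
weighs the contribution to V^2; it is nonzero only where V is shown to be close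
to its mean. *)
Definition tilt (b al be : R) (i : I) (x : R) : R :=
  bounded_ind b x * expR (al * (ell i * x) + be * (ell i * x ^+ 2)).

Lemma tilt_ge0 b al be i x : 0 <= tilt b al be i x.
Proof. by rewrite /tilt bounded_indE mulr_ge0 ?expR_ge0. Qed.

Lemma measurable_tilt b al be i : measurable_fun setT (tilt b al be i).
Proof.
apply: measurable_funM; first exact: measurable_bounded_ind.
apply: measurableT_comp; first exact: measurable_expR.
apply: measurable_funD.
  by apply: measurable_funM => //; exact: measurable_funM.
by do 2 (apply: measurable_funM => //); exact: measurable_funX.
Qed.

Lemma prod_tilt b al be (z : I -> R) :
  \prod_(i <- J) tilt b al be i (z i) =
  \prod_(i <- J) bounded_ind b (z i) *
  expR (al * (\sum_(i <- J) ell i * z i) + be * (\sum_(i <- J) ell i * z i ^+ 2)).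
Proof.
rewrite big_split /= -expR_sum; congr (_ * expR _).
by rewrite big_split /= !mulr_sumr.
Qed.

Lemma tilt_le b al c M i x : 0 <= al -> 0 <= c -> 0 < b -> ell i <= M ->
  al * M * b <= c ->
  tilt b al 0 i x <=
    1 + al * ell i * x + (expR c * al ^+ 2 / 2) * ell i ^+ 2 * x ^+ 2 + 0 * x ^+ 4.
Proof.
move=> al0 c0 b0 lM albc.
have E1 : 1 <= expR c by rewrite -[leLHS]expR0 ler_expR.
set u := al * (ell i * x).
have -> : 1 + al * ell i * x + (expR c * al ^+ 2 / 2) * ell i ^+ 2 * x ^+ 2 + 0 * x ^+ 4
  = 1 + u + u ^+ 2 * expR c / 2 by rewrite /u; field.
rewrite /tilt bounded_indE mul0r addr0 -/u; have [xb|xb] := leP `|x| b.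
  rewrite mul1r; apply: expR_le_quadratic => //.
  apply: le_trans albc; rewrite /u -mulrA ler_wpM2l//.
  apply: (@le_trans _ _ (ell i * b)); last by rewrite ler_wpM2r// ltW.
  by rewrite ler_wpM2l// (le_trans (ler_norm _)).
rewrite mul0r; have := sqr_ge0 (1 + u); have := sqr_ge0 u; nra.
Qed.

(** Beyond the cut-off the density is 0, and the polynomial is made negative by its
quartic term: there |u| <= c |x| / b, hence 1 + u + u^2/2 <= 2 (x/b)^4. *)
Lemma tilt_ge b al c M i x : 0 <= al -> 0 <= c -> c <= 2^-1 -> 0 < b ->
  ell i <= M -> al * M * b <= c ->
  1 + al * ell i * x + ((1 - 2 * c) * al ^+ 2 / 2) * ell i ^+ 2 * x ^+ 2
    + - 2 / b ^+ 4 * x ^+ 4 <= tilt b al 0 i x.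
Proof.
move=> al0 c0 c2 b0 lM albc.
set u := al * (ell i * x).
have -> : 1 + al * ell i * x + ((1 - 2 * c) * al ^+ 2 / 2) * ell i ^+ 2 * x ^+ 2
    + - 2 / b ^+ 4 * x ^+ 4 =
  (1 + u + (1 - 2 * c) * u ^+ 2 / 2) - 2 * (`|x| / b) ^+ 4.
  have -> : (`|x| / b) ^+ 4 = x ^+ 4 / b ^+ 4.
    by rewrite expr_div_n -normrX ger0_norm// exprn_even_ge0.
  by rewrite /u; field; rewrite gt_eqF.
set q := `|x| / b.
have q0 : 0 <= q by rewrite divr_ge0// ltW.
have uq : `|u| <= c * q.
  rewrite /u /q !normrM (ger0_norm al0) (ger0_norm (ell_ge0 i)).
  apply: (@le_trans _ _ (al * M * b * (`|x| / b))); last by rewrite ler_wpM2r.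
  have -> : al * M * b * (`|x| / b) = al * (M * `|x|) by field; rewrite gt_eqF.
  by rewrite ler_wpM2l// ler_wpM2r.
rewrite /tilt bounded_indE mul0r addr0 -/u; have [xb|xb] := leP `|x| b.
  rewrite mul1r; apply: (@le_trans _ _ (1 + u + (1 - 2 * c) * u ^+ 2 / 2)).
    by rewrite gerBl mulr_ge0// exprn_ge0.
  apply: expR_ge_quadratic_abs => //; apply: (le_trans uq).
  by rewrite ler_piMr// ler_pdivrMr// mul1r.
rewrite mul0r.
have q1 : 1 <= q by rewrite ler_pdivlMr// mul1r ltW.
have q2 : 1 <= q ^+ 2 by rewrite exprn_ege1.
have /andP[u1' u1] : - (q / 2) <= u <= q / 2.
  by rewrite -ler_norml (le_trans uq)//; nra.
have u2 : u ^+ 2 <= (q / 2) ^+ 2 by nra.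
have u3 : (1 - 2 * c) * u ^+ 2 <= u ^+ 2 by rewrite ler_piMl ?sqr_ge0//; lra.
have q4 : q ^+ 4 = q ^+ 2 * q ^+ 2 by ring.
rewrite q4; nra.
Qed.

Lemma tilt2_le b al be M i x : 0 <= al -> 0 <= be -> 0 < b -> ell i <= M ->
  al * M * b <= 2^-1 -> be * M * b ^+ 2 <= 2^-1 ->
  tilt b al be i x <=
    1 + al * ell i * x + (be * ell i + 3 * al ^+ 2 * ell i ^+ 2) * x ^+ 2
      + 3 * be ^+ 2 * ell i ^+ 2 * x ^+ 4.
Proof.
move=> al0 be0 b0 lM hal hbe.
set p := al * (ell i * x); set q := be * (ell i * x ^+ 2).
have -> : 1 + al * ell i * x + (be * ell i + 3 * al ^+ 2 * ell i ^+ 2) * x ^+ 2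
      + 3 * be ^+ 2 * ell i ^+ 2 * x ^+ 4 = 1 + (p + q) + 3 * (p ^+ 2 + q ^+ 2).
  by rewrite /p /q; ring.
have pq : (p + q) ^+ 2 <= 2 * (p ^+ 2 + q ^+ 2).
  by have := sqr_ge0 (p - q); nra.
rewrite /tilt bounded_indE -/p -/q; have [xb|xb] := leP `|x| b; last first.
  rewrite mul0r; have := sqr_ge0 (1 + (p + q)); have := sqr_ge0 (p + q); nra.
rewrite mul1r.
have pq1 : p + q <= 1.
  have p1 : p <= 2^-1.
    apply: le_trans hal; rewrite /p -mulrA ler_wpM2l//.
    apply: (@le_trans _ _ (ell i * b)); last by rewrite ler_wpM2r// ltW.
    by rewrite ler_wpM2l// (le_trans (ler_norm _)).
  have q1 : q <= 2^-1.
    apply: le_trans hbe; rewrite /q -mulrA ler_wpM2l//.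
    apply: (@le_trans _ _ (ell i * b ^+ 2)); last by rewrite ler_wpM2r// sqr_ge0.
    by rewrite ler_wpM2l//; move: xb; rewrite ler_norml => /andP[]; nra.
  lra.
apply: (le_trans (expR_le_quadratic pq1 ler01)).
rewrite lerD2l.
have e3 := expR_le3 R; have e0 := expR_gt0 (1 : R).
have := sqr_ge0 (p + q); nra.
Qed.

Lemma integral_scale (C : R) (G : O -> R) : 0 <= C -> measurable_fun setT G ->
  (forall w, 0 <= G w) ->
  (\int[P]_w (C * G w)%:E = C%:E * \int[P]_w (G w)%:E)%E.
Proof.
move=> C0 mG G0; under eq_integral do rewrite EFinM.
rewrite ge0_integralZl//.
- exact/measurable_EFinP.
- by move=> w _; rewrite lee_fin.
Qed.

Let Q := \sum_(i <- J) ell i ^+ 2.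
Let N := \sum_(i <- J) ell i.

Lemma integral_tilt_le b al c M : 0 <= al -> 0 <= c -> 0 < b ->
  (forall i, ell i <= M) -> al * M * b <= c ->
  (\int[P]_w (\prod_(i <- J) tilt b al 0 i (xi i w))%:E <=
   (expR (expR c * al ^+ 2 * Q * s2 / 2))%:E)%E.
Proof.
move=> al0 c0 b0 lM albc.
have mf i := measurable_tilt b al 0 i.
have f0 i x := tilt_ge0 b al 0 i x.
have fle i x := tilt_le x al0 c0 b0 (lM i) albc.
apply: (le_trans (integral_prod_le xi_copies EX0 EX4 uJ mf f0 fle)).
rewrite lee_fin.
apply: (@le_trans _ _ (\prod_(i <- J) expR (expR c * al ^+ 2 / 2 * ell i ^+ 2 * s2))).
  apply: ler_prod => i _; rewrite mul0r addr0 expR_ge1Dx andbT addr_ge0//.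
  rewrite mulr_ge0 ?(second_moment_ge0 X)// mulr_ge0 ?sqr_ge0// divr_ge0//.
  by rewrite mulr_ge0 ?expR_ge0 ?sqr_ge0.
rewrite -expR_sum ler_expR le_eqVlt; apply/orP; left; apply/eqP.
by rewrite /Q mulr_sumr !mulr_suml; apply: eq_bigr => i _; field.
Qed.

Lemma integral_tilt2_le b al be M : 0 <= al -> 0 <= be -> 0 < b ->
  (forall i, ell i <= M) -> al * M * b <= 2^-1 -> be * M * b ^+ 2 <= 2^-1 ->
  (\int[P]_w (\prod_(i <- J) tilt b al be i (xi i w))%:E <=
   (expR (be * N * s2 + 3 * al ^+ 2 * Q * s2 + 3 * be ^+ 2 * Q * m4))%:E)%E.
Proof.
move=> al0 be0 b0 lM h1 h2.
have mf i := measurable_tilt b al be i.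
have f0 i x := tilt_ge0 b al be i x.
have fle i x := tilt2_le x al0 be0 b0 (lM i) h1 h2.
apply: (le_trans (integral_prod_le xi_copies EX0 EX4 uJ mf f0 fle)).
rewrite lee_fin.
have s20 := second_moment_ge0 X; have m40 := fourth_moment_ge0 X.
apply: (@le_trans _ _ (\prod_(i <- J) expR
   ((be * ell i + 3 * al ^+ 2 * ell i ^+ 2) * s2 + (3 * be ^+ 2 * ell i ^+ 2) * m4))).
  apply: ler_prod => i _; rewrite -addrA expR_ge1Dx andbT addr_ge0// addr_ge0//.
    rewrite mulr_ge0// addr_ge0 ?mulr_ge0 ?sqr_ge0//.
  by rewrite mulr_ge0// mulr_ge0 ?sqr_ge0// mulr_ge0 ?sqr_ge0.
rewrite -expR_sum ler_expR le_eqVlt; apply/orP; left; apply/eqP.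
rewrite /Q /N !mulr_sumr !mulr_suml -!big_split /=.
by apply: eq_bigr => i _; ring.
Qed.

(** The factor 1 + u - v is at least (1 + u)(1 - v), which separates the Gaussian gain
u from the loss v through the cut-off. The total loss is bounded because there
are at most N factors and b^4 is comparable to N. *)
Lemma integral_tilt_ge b al kap M : 0 <= al -> 0 <= kap -> kap <= 2^-1 -> 0 < b ->
  (forall i, ell i <= M) -> al * M * b <= kap / 2 ->
  al ^+ 2 * M ^+ 2 * s2 <= kap -> 4 * m4 <= b ^+ 4 ->
  ((expR ((1 - kap) ^+ 2 * al ^+ 2 * Q * s2 / 2 - 4 * m4 * N / b ^+ 4))%:E <=
  \int[P]_w (\prod_(i <- J) tilt b al 0 i (xi i w))%:E)%E.
Proof.
move=> al0 k0 k2 b0 lM albc alM m4b.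
have mf i := measurable_tilt b al 0 i.
have f0 i x := tilt_ge0 b al 0 i x.
have c0 : 0 <= kap / 2 by rewrite divr_ge0.
have c2 : kap / 2 <= 2^-1 by lra.
have fle i x := tilt_le x al0 c0 b0 (lM i) albc.
have fge i x := tilt_ge x al0 c0 c2 b0 (lM i) albc.
have s20 := second_moment_ge0 X; have m40 := fourth_moment_ge0 X.
have b40 : 0 < b ^+ 4 by rewrite exprn_gt0.
pose u i := (1 - kap) * al ^+ 2 * ell i ^+ 2 * s2 / 2.
pose v := 2 * m4 / b ^+ 4.
have v0 : 0 <= v by rewrite divr_ge0 ?mulr_ge0// ltW.
have v2 : v <= 2^-1 by rewrite /v ler_pdivrMr//; lra.
have k1 : 0 <= 1 - kap by lra.
have u0 i : 0 <= u i.
  by rewrite divr_ge0// mulr_ge0// mulr_ge0 ?sqr_ge0// mulr_ge0 ?sqr_ge0.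
have uk i : u i <= kap.
  apply: le_trans alM; rewrite /u.
  have : ell i ^+ 2 <= M ^+ 2 by rewrite lerXn2r ?nnegrE// (le_trans _ (lM i)).
  have a0 := sqr_ge0 al; have l0 := sqr_ge0 (ell i).
  move=> lM2.
  have p1 : al ^+ 2 * ell i ^+ 2 * s2 <= al ^+ 2 * M ^+ 2 * s2.
    by rewrite ler_wpM2r// ler_wpM2l.
  have p0 : 0 <= al ^+ 2 * ell i ^+ 2 * s2 by rewrite !mulr_ge0.
  apply: le_trans p1.
  have -> : (1 - kap) * al ^+ 2 * ell i ^+ 2 * s2 / 2 =
    (1 - kap) / 2 * (al ^+ 2 * ell i ^+ 2 * s2) by field.
  by rewrite ler_piMl//; lra.
have key i : expR ((1 - kap) * u i - 2 * v) <=
    1 + ((1 - 2 * (kap / 2)) * al ^+ 2 / 2 * ell i ^+ 2) * s2 + (- 2 / b ^+ 4) * m4.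
  have -> : 1 + ((1 - 2 * (kap / 2)) * al ^+ 2 / 2 * ell i ^+ 2) * s2 + (- 2 / b ^+ 4) * m4
     = 1 + u i - v by rewrite /u /v; field; rewrite gt_eqF.
  rewrite expRD; apply: (@le_trans _ _ ((1 + u i) * (1 - v))).
    apply: ler_pM; rewrite ?expR_ge0//.
      by apply: expR_ge_shrunk => //; lra.
    by rewrite -mulNr; exact: expR_le_1B.
  have := u0 i; nra.
apply: le_trans (integral_prod_ge xi_copies EX0 EX4 uJ mf f0 fle fge _); last first.
  by move=> i; apply: le_trans (key i); exact: expR_ge0.
rewrite lee_fin.
apply: (@le_trans _ _ (\prod_(i <- J) expR ((1 - kap) * u i - 2 * v))); last first.
  by apply: ler_prod => i _; rewrite key expR_ge0.
rewrite -expR_sum ler_expR.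
rewrite big_split /= lerD//.
  rewrite le_eqVlt; apply/orP; left; apply/eqP.
  by rewrite /Q mulr_sumr !mulr_suml; apply: eq_bigr => i _; rewrite /u; field.
rewrite sumrN lerN2.
have -> : 4 * m4 * N / b ^+ 4 = \sum_(i <- J) 2 * v * ell i.
  by rewrite -mulr_sumr /v /N; field; rewrite gt_eqF.
rewrite big_seq [leRHS]big_seq; apply: ler_sum => i iJ.
have l1 : 1 <= ell i by rewrite /ell ler1n cnt_gt0.
by rewrite ler_peMr// mulr_ge0.
Qed.

(** The arithmetic behind the choice of yp: the factor (1+eta)^2 / (1-eta) makes
room for the lower end of the window, for the excess of V^2 over N s2, and for
N > n. *)
Lemma ratio_ge (z : I -> R) (n y eta yp : R) :
  0 < n -> 0 < N -> 0 < y -> 0 < eta -> eta < 1 ->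
  yp = y * (1 + eta) ^+ 2 / (1 - eta) ->
  N <= (1 + eta) ^+ 2 * n ->
  (1 - eta) * yp * Num.sqrt Q * Num.sqrt s2 <= \sum_(i <- J) ell i * z i ->
  \sum_(i <- J) ell i * z i ^+ 2 <= (1 + eta) * N * s2 ->
  y <= (\sum_(i <- J) ell i * z i) * Num.sqrt n /
     (Num.sqrt (\sum_(i <- J) ell i * z i ^+ 2) * Num.sqrt Q).
Proof.
move=> n0 N0 y0 eta0 eta1 ypE Nn.
set T := \sum_(i <- J) ell i * z i; set V2 := \sum_(i <- J) ell i * z i ^+ 2.
have ell_ge1 i : i \in J -> 1 <= ell i by move=> /cnt_gt0; rewrite /ell ler1n.
have NQ : N <= Q by exact: (sum_ell_le_sq ell_ge0 ell_ge1).
have Q0 : 0 < Q by exact: lt_le_trans NQ.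
set L := Num.sqrt Q; set sg := Num.sqrt s2; set r := Num.sqrt n.
have L0 : 0 < L by rewrite sqrtr_gt0.
have sg0 : 0 < sg by rewrite sqrtr_gt0.
have r0 : 0 < r by rewrite sqrtr_gt0.
have -> : (1 - eta) * yp * L * sg = y * (1 + eta) ^+ 2 * L * sg.
  by rewrite ypE; field; rewrite subr_eq0 gt_eqF.
set t := y * _ * L * sg => tT VN.
have t0 : 0 < t by rewrite mulr_gt0// mulr_gt0// mulr_gt0// exprn_gt0// addr_gt0.
have V20 : 0 < V2.
  rewrite lt_neqAle; apply/andP; split; last first.
    by apply: sumr_ge0 => i _; rewrite mulr_ge0// sqr_ge0.
  apply/eqP => V20; pose mu := N / t.
  have mu0 : 0 < mu by rewrite divr_gt0.
  have : T <= (mu * V2 + N / mu) / 2.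
    rewrite /T /V2 /N mulr_sumr mulr_suml -big_split /= mulr_suml; apply: ler_sum => i _.
    rewrite -subr_ge0.
    have -> : (mu * (ell i * z i ^+ 2) + ell i / mu) / 2 - ell i * z i =
      ell i * (mu * z i - 1) ^+ 2 / mu / 2 by field; rewrite gt_eqF.
    by rewrite divr_ge0// divr_ge0 ?(ltW mu0)// mulr_ge0// sqr_ge0.
  rewrite -V20 mulr0 add0r (_ : N / mu = t); last first.
    by rewrite /mu; field; rewrite ?gt_eqF.
  by move=> h; have := le_trans tT h; rewrite ler_pdivlMr//; lra.
have V0 : 0 < Num.sqrt V2 by rewrite sqrtr_gt0.
rewrite ler_pdivlMr ?mulr_gt0//.
have VL : Num.sqrt V2 <= (1 + eta) ^+ 2 * r * sg.
  have e2 : 0 <= (1 + eta) ^+ 2 by rewrite sqr_ge0.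
  have p0 : 0 <= (1 + eta) ^+ 2 * r * sg by rewrite mulr_ge0 ?(ltW sg0)// mulr_ge0 ?(ltW r0).
  rewrite -[leRHS]ger0_norm// -sqrtr_sqr ler_sqrt ?sqr_ge0//.
  have rE : r ^+ 2 = n by rewrite sqr_sqrtr// ltW.
  have sgE : sg ^+ 2 = s2 by rewrite sqr_sqrtr// ltW.
  have -> : ((1 + eta) ^+ 2 * r * sg) ^+ 2 = (1 + eta) * (1 + eta) ^+ 2 * (1 + eta) * n * s2.
    by rewrite -rE -sgE; ring.
  apply: (le_trans VN); rewrite ler_pM2r//.
  apply: (@le_trans _ _ ((1 + eta) * ((1 + eta) ^+ 2 * n))); first by rewrite ler_pM2l ?addr_gt0.
  rewrite mulrA ler_wpM2r ?(ltW n0)//.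
  by rewrite ler_peMr ?lerDl ?(ltW eta0)// mulr_ge0// addr_ge0// ltW.
apply: (@le_trans _ _ (t * r)); last by rewrite ler_wpM2r// ltW.
have -> : t * r = y * (((1 + eta) ^+ 2 * r * sg) * L) by rewrite /t; ring.
by rewrite ler_pM2l// ler_pM2r.
Qed.

(** On the window t <= T <= tp the density of the tilt is at most exp(h tp) per unit of
mass, so the probability of the event is at least exp(- h tp) times the tilted
mass of the part of the window where V^2 is not too large. The three bad parts
are bounded by tilting with h - lam, with h + lam, and with the additional weight
s on V^2; each has at most a quarter of the total mass. *)
Lemma ratio_lower (n b M y eta s : R) :
  let kap := eta ^+ 2 / 12 in let yp := y * (1 + eta) ^+ 2 / (1 - eta) in
  0 < y -> 0 < eta -> eta <= 2^-1 -> 0 < b -> b ^+ 4 = n ->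
  (forall i, ell i <= M) -> n <= N -> N <= (1 + eta) ^+ 2 * n ->
  0 < s -> s * M * b ^+ 2 <= 2^-1 ->
  2 * yp / (Num.sqrt n * Num.sqrt s2) * M * b <= kap / 2 ->
  yp ^+ 2 * M ^+ 2 <= kap * n -> 4 * m4 <= n ->
  expR (- (eta ^+ 2 / 4) * yp ^+ 2 + 16 * m4) <= 4^-1 ->
  expR (- s * eta * n * s2 + 3 * yp ^+ 2 + 12 * s ^+ 2 * M * n * m4 + 16 * m4) <= 4^-1 ->
  ((4^-1 * expR (- (1 + eta) * yp ^+ 2 + (1 - 2 * kap) * yp ^+ 2 / 2 - 16 * m4))%:E
    <= P (ratio_event xi J cnt n y))%E.
Proof.
move=> kap yp y0 eta0 eta2 b0 bn lM nN Nn s0 sMb hMb hM m4n exp1 exp3.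
have n0 : 0 < n by rewrite -bn exprn_gt0.
have ell_ge1 i : i \in J -> 1 <= ell i by move=> /cnt_gt0; rewrite /ell ler1n.
have NQ : N <= Q by exact: (sum_ell_le_sq ell_ge0 ell_ge1).
have N0 : 0 < N by exact: lt_le_trans nN.
have Q0 : 0 < Q by exact: lt_le_trans NQ.
have m40 := fourth_moment_ge0 X.
have et1 : 0 < 1 - eta by lra.
have et2 : 0 < 1 + eta by lra.
have yp0 : 0 < yp by rewrite divr_gt0// mulr_gt0// exprn_gt0.
have kap0 : 0 < kap by rewrite divr_gt0 ?exprn_gt0.
have kapE : kap = eta ^+ 2 / 12 by [].
have eta2' : eta ^+ 2 <= 4^-1 by nra.
have kap2 : kap <= 2^-1 by lra.
pose L := Num.sqrt Q; pose sg := Num.sqrt s2; pose r := Num.sqrt n.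
have L0 : 0 < L by rewrite sqrtr_gt0.
have r0 : 0 < r by rewrite sqrtr_gt0.
have sg0 : 0 < sg by rewrite sqrtr_gt0.
have rL : r <= L by rewrite /r /L ler_sqrt ?(ltW Q0)//; exact: le_trans nN NQ.
have LE : L ^+ 2 = Q by rewrite sqr_sqrtr// ltW.
have sgE : sg ^+ 2 = s2 by rewrite sqr_sqrtr// ltW.
have rE : r ^+ 2 = n by rewrite sqr_sqrtr// ltW.
have nQ : n <= Q by exact: le_trans nN NQ.
have M0 : 0 <= M.
  move: N0; rewrite /N; case: (J) => [|i ? _]; first by rewrite big_nil ltxx.
  exact: le_trans (lM i).
(* Under the tilt h the sum T has mean yp L sg, the centre of the window [t, tp]. *)
pose h := yp / (L * sg); pose lam := eta * h.
have h0 : 0 < h by rewrite divr_gt0// mulr_gt0.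
have hQ : h ^+ 2 * Q * s2 = yp ^+ 2.
  by rewrite /h -LE -sgE; field; rewrite ?gt_eqF.
pose t := (1 - eta) * yp * L * sg; pose tp := (1 + eta) * yp * L * sg.
have hle : h <= yp / (r * sg).
  by rewrite /h ler_pM2l// lef_pV2 ?posrE ?mulr_gt0// ler_pM2r.
have h2 : 2 * h * M * b <= kap / 2.
  apply: le_trans hMb; rewrite -/r -/sg ler_wpM2r ?(ltW b0)// ler_wpM2r//.
  by rewrite -mulrA ler_pM2l.
have hMb0 : 0 <= h * M * b by rewrite mulr_ge0 ?(ltW b0)// mulr_ge0 ?(ltW h0).
have h1 : h * M * b <= kap / 2 by lra.
have hm : (h - lam) * M * b <= kap / 2.
  have -> : (h - lam) * M * b = (1 - eta) * (h * M * b) by rewrite /lam; ring.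
  by apply: (le_trans _ h1); rewrite ler_piMl//; lra.
have hp : (h + lam) * M * b <= kap / 2.
  have -> : (h + lam) * M * b = (1 + eta) * (h * M * b) by rewrite /lam; ring.
  apply: (@le_trans _ _ (2 * (h * M * b))); first by rewrite ler_wpM2r//; lra.
  lra.
have hm0 : 0 <= h - lam.
  have -> : h - lam = (1 - eta) * h by rewrite /lam; ring.
  by rewrite mulr_ge0 ?(ltW h0)//; lra.
have hp0 : 0 <= h + lam.
  have -> : h + lam = (1 + eta) * h by rewrite /lam; ring.
  by rewrite mulr_ge0 ?(ltW h0) ?(ltW et2).
have ck : expR (kap / 2) <= 1 + kap by exact: expR_half_le (ltW kap0) kap2.
have h2M : h ^+ 2 * M ^+ 2 * s2 <= kap.
  have -> : h ^+ 2 * M ^+ 2 * s2 = yp ^+ 2 * M ^+ 2 / Q.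
    by rewrite /h -LE -sgE; field; rewrite ?gt_eqF.
  by rewrite ler_pdivrMr// (le_trans hM)// ler_pM2l.
pose Z := expR ((1 - 2 * kap) * yp ^+ 2 / 2 - 16 * m4).
pose C0 := expR (- h * tp).
pose C1 := expR (- h * tp + lam * t).
pose C2 := expR (- h * tp - lam * tp).
pose C3 := expR (- h * tp - s * (1 + eta) * N * s2).
have Cge u : 0 <= expR u :> R by exact: expR_ge0.
have htp : h * tp = (1 + eta) * yp ^+ 2.
  by rewrite /h /tp; field; rewrite ?gt_eqF.
have lt_ : lam * t = eta * (1 - eta) * yp ^+ 2.
  by rewrite /lam /h /t; field; rewrite ?gt_eqF.
have ltp : lam * tp = eta * (1 + eta) * yp ^+ 2.
  by rewrite /lam /h /tp; field; rewrite ?gt_eqF.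
pose pr al be w := \prod_(i <- J) tilt b al be i (xi i w).
have mpr al be : measurable_fun setT (pr al be).
  by apply: (measurable_fun_prod_scenery xi J) => i; exact: measurable_tilt.
have pr0 al be w : 0 <= pr al be w by apply: prodr_ge0 => i _; exact: tilt_ge0.
have yp2 : 0 < yp ^+ 2 by rewrite exprn_gt0.
have lower : ((C0 * Z)%:E <= \int[P]_w (C0 * pr h 0 w)%:E)%E.
  rewrite (integral_scale (Cge _) (mpr _ _) (pr0 _ _)) EFinM.
  apply: lee_wpmul2l; first by rewrite lee_fin; exact: Cge.
  apply: le_trans (integral_tilt_ge (ltW h0) (ltW kap0) kap2 b0 lM h1 h2M _); last by rewrite bn.
  rewrite lee_fin ler_expR.
  have -> : (1 - kap) ^+ 2 * h ^+ 2 * Q * s2 / 2 = (1 - kap) ^+ 2 * yp ^+ 2 / 2.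
    by rewrite -hQ; field.
  apply: lerB; last by rewrite bn; exact: (sum_over_quarter (ltW eta0)).
  rewrite ler_pM2r ?invr_gt0// ler_pM2r//.
  have -> : (1 - kap) ^+ 2 = 1 - 2 * kap + kap ^+ 2 by ring.
  by rewrite lerDl sqr_ge0.
have scaled (C al be v : R) : 0 <= C ->
    (\int[P]_w (pr al be w)%:E <= (expR v)%:E)%E ->
    C * expR v <= C0 * Z / 4 ->
    (\int[P]_w (C * pr al be w)%:E <= (C0 * Z / 4)%:E)%E.
  move=> Cp hi hle'; rewrite (integral_scale Cp (mpr _ _) (pr0 _ _)).
  apply: (@le_trans _ _ (C%:E * (expR v)%:E)%E).
    by apply: lee_wpmul2l; rewrite ?lee_fin.
  by rewrite -EFinM lee_fin.
have exp4 (u v1 v2 : R) : expR u <= 4^-1 -> v1 <= v2 + u -> expR v1 <= expR v2 / 4.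
  move=> hu hv; apply: (@le_trans _ _ (expR (v2 + u))); first by rewrite ler_expR.
  by rewrite expRD ler_pM2l ?expR_gt0.
have kl1 := tilt_below_exponent kapE (ltW yp2) (ltW eta0) eta2.
have kl2 := tilt_above_exponent kapE (ltW yp2) (ltW eta0) eta2.
have c0 : 0 <= kap / 2 by rewrite divr_ge0// ltW.
have up1 : (\int[P]_w (C1 * pr (h - lam) 0 w)%:E <= (C0 * Z / 4)%:E)%E.
  apply: (scaled _ _ _ (expR (kap / 2) * (h - lam) ^+ 2 * Q * s2 / 2)); first exact: Cge.
    exact: (integral_tilt_le hm0 c0 b0 lM hm).
  rewrite /C1 /C0 /Z -!expRD; apply: (exp4 _ _ _ exp1).
  have -> : expR (kap / 2) * (h - lam) ^+ 2 * Q * s2 / 2 =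
      expR (kap / 2) * ((1 - eta) ^+ 2 * yp ^+ 2 / 2).
    by rewrite -hQ /lam; field.
  have q0 : 0 <= (1 - eta) ^+ 2 * yp ^+ 2 / 2.
    by rewrite divr_ge0// mulr_ge0 ?sqr_ge0// ltW.
  by rewrite lt_ [- (eta ^+ 2 / 4) * _]mulNr; exact: exponent_glue kl1 (ler_wpM2r q0 ck).
have up2 : (\int[P]_w (C2 * pr (h + lam) 0 w)%:E <= (C0 * Z / 4)%:E)%E.
  apply: (scaled _ _ _ (expR (kap / 2) * (h + lam) ^+ 2 * Q * s2 / 2)); first exact: Cge.
    exact: (integral_tilt_le hp0 c0 b0 lM hp).
  rewrite /C2 /C0 /Z -!expRD; apply: (exp4 _ _ _ exp1).
  have -> : expR (kap / 2) * (h + lam) ^+ 2 * Q * s2 / 2 =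
      expR (kap / 2) * ((1 + eta) ^+ 2 * yp ^+ 2 / 2).
    by rewrite -hQ /lam; field.
  have q0 : 0 <= (1 + eta) ^+ 2 * yp ^+ 2 / 2.
    by rewrite divr_ge0// mulr_ge0 ?sqr_ge0// ltW.
  by rewrite ltp [- (eta ^+ 2 / 4) * _]mulNr; exact: exponent_glue kl2 (ler_wpM2r q0 ck).
have QMN : Q <= M * N.
  rewrite /Q /N mulr_sumr; apply: ler_sum => i _.
  by rewrite expr2 ler_wpM2r.
have up3 : (\int[P]_w (C3 * pr h s w)%:E <= (C0 * Z / 4)%:E)%E.
  apply: (scaled _ _ _ (s * N * s2 + 3 * h ^+ 2 * Q * s2 + 3 * s ^+ 2 * Q * m4)); first exact: Cge.
    have h1' : h * M * b <= 2^-1.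
      by apply: (le_trans h1); rewrite ler_pdivrMr// (le_trans kap2)// ler_peMr// ler1n.
    exact: (integral_tilt2_le (ltW h0) (ltW s0) b0 lM h1' sMb).
  rewrite /C3 /C0 /Z -!expRD; apply: (exp4 _ _ _ exp3).
  have -> : 3 * h ^+ 2 * Q * s2 = 3 * yp ^+ 2 by rewrite -hQ; ring.
  rewrite [- h * _]mulNr.
  exact: (tilt_norm_exponent (h * tp) (ltW eta0) eta2 kap2 (ltW s0) (ltW s2_gt0) m40 (ltW yp2) M0 (ltW n0) nN Nn QMN).
have mE := measurable_ratio_event xi J cnt n y.
have := @prob_ge_pointwise (ratio_event xi J cnt n y)
  (fun w => C0 * pr h 0 w) (fun w => C1 * pr (h - lam) 0 w)
  (fun w => C2 * pr (h + lam) 0 w) (fun w => C3 * pr h s w)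
  (C0 * Z) (C0 * Z / 4) (C0 * Z / 4) (C0 * Z / 4) mE.
have mC (C : R) al be : measurable_fun setT (fun w => C * pr al be w).
  exact: measurable_funM.
have C0p (u al be : R) w : 0 <= expR u * pr al be w by rewrite mulr_ge0.
have ind01 w : 0 <= \prod_(i <- J) bounded_ind b (xi i w) <= 1.
  apply/andP; split; first by apply: prodr_ge0 => i _; rewrite bounded_indE.
  elim/big_rec: _ => // i x _ x1; rewrite bounded_indE.
  by case: (`|xi i w| <= b); rewrite ?mul1r ?mul0r.
have cases w : C0 * pr h 0 w <= C1 * pr (h - lam) 0 w + C2 * pr (h + lam) 0 w + C3 * pr h s w
    \/ ratio_event xi J cnt n y w /\ C0 * pr h 0 w <= 1.
  have C1p := C0p (- h * tp + lam * t) (h - lam) 0 w.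
  have C2p := C0p (- h * tp - lam * tp) (h + lam) 0 w.
  have C3p := C0p (- h * tp - s * (1 + eta) * N * s2) h s w.
  have /andP[W0 W1] := ind01 w.
  have prE (u al be : R) : expR u * pr al be w =
      (\prod_(i <- J) bounded_ind b (xi i w)) * expR (u + (al * (\sum_(i <- J) ell i * xi i w)
        + be * (\sum_(i <- J) ell i * xi i w ^+ 2))).
    by rewrite /pr prod_tilt mulrCA -expRD.
  rewrite -/C1 in C1p; rewrite -/C2 in C2p; rewrite -/C3 in C3p.
  set T := \sum_(i <- J) ell i * xi i w in prE.
  set V2 := \sum_(i <- J) ell i * xi i w ^+ 2 in prE.
  have lam0 : 0 < lam by rewrite mulr_gt0.
  have [Tt|tT] := ltP T t.
    left; apply: (@le_trans _ _ (C1 * pr (h - lam) 0 w)); last first.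
      by rewrite -addrA lerDl addr_ge0.
    rewrite /C0 /C1 !prE ler_wpM2l// ler_expR -subr_ge0.
    have -> : - h * tp + lam * t + ((h - lam) * T + 0 * V2) - (- h * tp + (h * T + 0 * V2)) =
      lam * (t - T) by ring.
    by rewrite mulr_ge0 ?(ltW lam0)// subr_ge0 ltW.
  have [Tt|tTp] := ltP tp T.
    left; apply: (@le_trans _ _ (C2 * pr (h + lam) 0 w)); last first.
      by rewrite addrAC lerDr addr_ge0.
    rewrite /C0 /C2 !prE ler_wpM2l// ler_expR -subr_ge0.
    have -> : - h * tp - lam * tp + ((h + lam) * T + 0 * V2) - (- h * tp + (h * T + 0 * V2)) =
      lam * (T - tp) by ring.
    by rewrite mulr_ge0 ?(ltW lam0)// subr_ge0 ltW.
  have [Vt|tV] := ltP ((1 + eta) * N * s2) V2.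
    left; apply: (@le_trans _ _ (C3 * pr h s w)); last first.
      by rewrite lerDr addr_ge0.
    rewrite /C0 /C3 !prE ler_wpM2l// ler_expR -subr_ge0.
    have -> : - h * tp - s * (1 + eta) * N * s2 + (h * T + s * V2) - (- h * tp + (h * T + 0 * V2)) =
      s * (V2 - (1 + eta) * N * s2) by ring.
    by rewrite mulr_ge0 ?(ltW s0)// subr_ge0 ltW.
  right; split.
    have et1' : eta < 1 by rewrite -subr_gt0.
    exact: (ratio_ge n0 N0 y0 eta0 et1' (erefl yp) Nn tT tV).
  rewrite /C0 prE -[leRHS]mulr1; apply: ler_pM => //.
  rewrite -expR0 ler_expR mul0r addr0 mulNr addrC subr_le0.
  by rewrite ler_pM2l.
move=> /(_ (mC _ _ _) (mC _ _ _) (mC _ _ _) (mC _ _ _)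
  (C0p _ _ _) (C0p _ _ _) (C0p _ _ _) (C0p _ _ _)) main.
apply: le_trans (main _ _ lower up1 up2 up3).
- rewrite lee_fin.
  have -> : C0 * Z - (C0 * Z / 4 + C0 * Z / 4 + C0 * Z / 4) = 4^-1 * (C0 * Z) by field.
  rewrite ler_pM2l ?invr_gt0// /C0 /Z -expRD ler_expR [- h * _]mulNr htp.
  by rewrite addrA mulNr.
- by move=> w nE; have [//|[wE _]] := cases w; case: nE.
- move=> w wE; have [h3|[_ h3]] := cases w.
    by apply: (le_trans h3); rewrite lerDr.
  apply: (le_trans h3); rewrite lerDl.
  by rewrite /C1 /C2 /C3; do 2 (apply: addr_ge0; last exact: C0p); exact: C0p.
Qed.

End LowerQuenched.

(** * Decomposition of the joint law along trajectories *)

Section Bridge.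
Variables (R : realType) (d : nat).
Hypothesis d_ge2 : (2 <= d)%N.
Local Notation V := (vertex d).
Variables (d1 : measure_display) (O1 : measurableType d1) (P1 : probability O1 R).
Variables (d2 : measure_display) (O2 : measurableType d2) (P2 : probability O2 R).
Variable S : nat -> O2 -> V.
Hypothesis srwS : simple_random_walk P2 S.

(** The trajectory is read off as a sequence of vertices of prescribed length, which
makes the walk up to a given time a finite object. *)
Definition cylinder (s : seq V) : set O2 :=
  [set w | [seq S k w | k <- iota 0 (size s)] = s].

Definition joint_event (E : seq V -> set O1) (n : nat) : set (O1 * O2) :=
  [set w | E [seq S k w.2 | k <- iota 0 n.+1] w.1].

Lemma measurable_cylinder s : measurable (cylinder s).
Proof.
have -> : cylinder s = \bigcap_(k in [set k | (k < size s)%N]) (S k @^-1` [set nth [::] s k]).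
  apply/seteqP; split => w /=.
    move=> ws k /= ks; rewrite -[in RHS]ws (nth_map 0%N) ?size_iota//.
    by rewrite nth_iota.
  move=> ws; apply: (@eq_from_nth _ [::]); first by rewrite size_map size_iota.
  move=> k; rewrite size_map size_iota => ks.
  by rewrite (nth_map 0%N) ?size_iota// nth_iota// add0n; exact: ws.
apply: fin_bigcap_measurable; first exact: finite_II.
by move=> k _; exact: (srw_measurable srwS).
Qed.

Fixpoint path_prob (v : V) (s : seq V) : R :=
  if s is w :: s' then srw_kernel R v w * path_prob w s' else 1.

Lemma path_prob_rcons v s w :
  path_prob v (rcons s w) = path_prob v s * srw_kernel R (last v s) w.
Proof.
elim: s v => [|u s IH] v /=; first by rewrite mulr1 mul1r.
by rewrite IH mulrA.
Qed.

Lemma cylinder_prob s : P2 (cylinder (Defs.root d :: s)) = (path_prob (Defs.root d) s)%:E.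
Proof.
pose x k := nth [::] (Defs.root d :: s) k.
have cylE (n : nat) : (n <= size s)%N ->
    P2 [set w | forall k, (k <= n)%N -> S k w = x k] = (path_prob (Defs.root d) (take n s))%:E.
  elim: n => [|n IH] ns.
    rewrite take0 /= -(srw_start srwS); congr (P2 _); apply/seteqP; split => w /=.
      by move=> /(_ 0%N (leqnn _)).
    by move=> w0 k; rewrite leqn0 => /eqP ->.
  rewrite (srw_step srwS) IH ?(ltnW ns)// -EFinM (take_nth [::])// path_prob_rcons.
  congr (_ * srw_kernel _ _ _)%:E.
  rewrite (last_nth [::]) size_take ns /x.
  by case: n ns {IH} => [//|n] ns; rewrite /= nth_take.
rewrite -[in RHS](take_size s) -cylE//; congr (P2 _); apply/seteqP; split => w /=.
  move=> [w0 ws] k; rewrite /x; case: k => [_|k ks] //=.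
  by rewrite -[in RHS]ws (nth_map 0%N) ?size_iota// nth_iota.
move=> ws; congr cons; first exact: (ws 0%N).
apply: (@eq_from_nth _ [::]); first by rewrite size_map size_iota.
move=> k; rewrite size_map size_iota => ks.
by rewrite (nth_map 0%N) ?size_iota// nth_iota//; exact: (ws k.+1).
Qed.

Fixpoint walk_paths (k : nat) (v : V) : seq (seq V) :=
  if k is k'.+1 then [seq v :: s | s <- flatten [seq walk_paths k' w | w <- neighbors v]]
  else [:: [:: v]].

Lemma size_walk_paths k v s : s \in walk_paths k v -> size s = k.+1.
Proof.
elim: k v s => [|k IH] v s /=; first by rewrite inE => /eqP ->.
move=> /mapP[s' /flattenP[r /mapP[w _ ->]] /IH ss' ->] /=.
by rewrite ss'.
Qed.

Lemma head_walk_paths k v s : s \in walk_paths k v -> exists s', s = v :: s'.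
Proof.
case: k => [|k] /=; first by rewrite inE => /eqP ->; exists [::].
by move=> /mapP[s' _ ->]; exists s'.
Qed.

Lemma uniq_walk_paths k v : uniq (walk_paths k v).
Proof.
elim: k v => [//|k IH] v /=.
rewrite map_inj_uniq; last by move=> s t [].
elim: (neighbors v) (neighbors_uniq v) => [//|w r IHr] /= /andP[wr ur].
rewrite cat_uniq IH IHr// andbT; apply/hasPn => s /flattenP[t /mapP[u ur' ->]] su.
apply/negP => sw; have [s1 E1] := head_walk_paths su; have [s2 E2] := head_walk_paths sw.
by move: E1; rewrite E2 => -[wu _]; move: wr; rewrite wu ur'.
Qed.

Lemma walk_mean_walk_paths k v (F : seq V -> R) :
  walk_mean k F v = \sum_(s <- walk_paths k v) path_prob v (behead s) * F s.
Proof.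
elim: k v F => [|k IH] v F /=; first by rewrite big_seq1 mul1r.
rewrite big_map big_flatten big_map /step_mean mulr_suml.
rewrite big_seq [RHS]big_seq; apply: eq_bigr => w wv; rewrite IH mulr_suml.
rewrite big_seq [RHS]big_seq; apply: eq_bigr => s /head_walk_paths[s' ->] /=.
by rewrite /srw_kernel wv mul1r; ring.
Qed.

Lemma joint_eventE (E : seq V -> set O1) n (s : seq V) : size s = n.+1 ->
  E s `*` cylinder s `<=` joint_event E n.
Proof.
move=> sn [w1 w2] [Es cw]; move: cw; rewrite /cylinder /joint_event /mkset sn.
by move=> ->.
Qed.

Lemma measurable_joint_event (E : seq V -> set O1) n :
  (forall s, measurable (E s)) -> measurable (joint_event E n).
Proof.
move=> mE.
pose F (k : nat) : set (O1 * O2) :=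
  if @unpickle (seq (seq 'I_d)) k is Some s then
    if size s == n.+1 then E s `*` cylinder s else set0 else set0.
have -> : joint_event E n = \bigcup_k F k.
  apply/seteqP; split => [[w1 w2]|[w1 w2] [k _]].
    rewrite /joint_event /mkset; set s := map _ _ => Ew.
    have ss : size s = n.+1 by rewrite /s size_map size_iota.
    exists (pickle (s : seq (seq 'I_d))) => //.
    by rewrite /F pickleK ss eqxx; split => //; rewrite /cylinder /mkset ss.
  rewrite /F; case: unpickle => [s|//]; case: eqP => // sn.
  exact: joint_eventE.
apply: bigcupT_measurable => k; rewrite /F; case: unpickle => [s|//].
by case: eqP => // _; apply: measurableX => //; exact: measurable_cylinder.
Qed.

Lemma sum_rect_le (E : seq V -> set O1) n (r : seq (seq V)) :
  (forall s, measurable (E s)) -> uniq r -> (forall s, s \in r -> size s = n.+1) ->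
  (\sum_(s <- r) P1 (E s) * P2 (cylinder s) <= (P1 \x P2) (joint_event E n))%E.
Proof.
move=> mE ur rn.
have mrect s : measurable (E s `*` cylinder s).
  by apply: measurableX => //; exact: measurable_cylinder.
pose U (r : seq (seq V)) := \big[setU/set0]_(s <- r) (E s `*` cylinder s).
have mU q : measurable (U q) by apply: bigsetU_measurable => s _.
have UP q w : U q w -> exists2 s, s \in q & (E s `*` cylinder s) w.
  rewrite /U; elim: q => [|s q IH]; first by rewrite big_nil.
  rewrite big_cons => -[h|/IH[t tq h]]; first by exists s => //; exact: mem_head.
  by exists t => //; rewrite inE tq orbT.
apply: (@le_trans _ _ ((P1 \x P2)%E (U r))); last first.
  apply: le_measure; rewrite ?inE//; first exact: measurable_joint_event.
  by move=> w /UP[s /rn sn]; exact: joint_eventE.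
elim: r ur rn => [|s r IH] /=; first by rewrite big_nil measure_ge0.
move=> /andP[sr ur] rn.
rewrite /U !big_cons -/(U r) measureU//; last first.
  apply/seteqP; split => // w [[_ ws] /UP[t tr [_ wt]]].
  have st : size s = size t by rewrite !rn ?mem_head// inE tr orbT.
  by move: wt ws; rewrite /cylinder /= st => -> ts; rewrite -ts tr in sr.
rewrite -(product_measure1E P1 P2 (mE s) (measurable_cylinder s)).
apply: leeD => //; apply: IH => // t tr; apply: rn.
by rewrite inE tr orbT.
Qed.

(** The trajectories that are not paths of the tree form a null set. Rather than
treating it separately, the sum over paths is shown to be a lower bound both for
the event and for its complement; the two lower bounds add up to 1. *)
Lemma joint_prob (E : seq V -> set O1) n : (forall s, measurable (E s)) ->
  (P1 \x P2)%E (joint_event E n) =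
  (walk_mean n (fun s => fine (P1 (E s))) (Defs.root d))%:E.
Proof.
move=> mE.
pose r := walk_paths n (Defs.root d).
pose p s := path_prob (Defs.root d) (behead s).
have rn s : s \in r -> size s = n.+1 by exact: size_walk_paths.
have cylP s : s \in r -> P2 (cylinder s) = (p s)%:E.
  by move=> /head_walk_paths[s' ->]; exact: cylinder_prob.
have ur : uniq r by exact: uniq_walk_paths.
have le (F : seq V -> set O1) : (forall s, measurable (F s)) ->
    ((walk_mean n (fun s => fine (P1 (F s))) (Defs.root d))%:E <= (P1 \x P2)%E (joint_event F n))%E.
  move=> mF; apply: le_trans (sum_rect_le mF ur rn).
  rewrite walk_mean_walk_paths -sumEFin big_seq [leRHS]big_seq; apply: lee_sum => s sr.
  by rewrite cylP// EFinM muleC fineK// fin_num_measure.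
have h1 := le E mE.
have mEc s : measurable (~` E s) by exact: measurableC.
have := le _ mEc.
have -> : joint_event (fun s => ~` E s) n = ~` joint_event E n by [].
have mA := measurable_joint_event n mE.
have PT : ((P1 \x P2) (joint_event E n) + (P1 \x P2) (~` joint_event E n) = 1)%E.
  rewrite -measureU//; [|exact: measurableC|exact: setICr].
  rewrite setUv; transitivity ((P1 \x P2)%E (setT `*` setT)); first by rewrite setXTT.
  apply: (eq_trans (product_measure1E P1 P2 measurableT measurableT)).
  transitivity (1 * 1 : \bar R)%E; last by rewrite mule1.
  by congr (_ * _)%E; exact: probability_setT.
have sum1 : walk_mean n (fun s => fine (P1 (E s))) (Defs.root d) +
    walk_mean n (fun s => fine (P1 (~` E s))) (Defs.root d) = 1.
  rewrite -walk_meanD -[RHS](walk_mean_cst d_ge2 n 1 (Defs.root d)).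
  apply: eq_walk_mean => s _.
  by rewrite (probability_setC P1 (mE s)) fineB ?fin_num_measure//= addrC subrK.
move: PT h1; set a := (P1 \x P2)%E _; set a' := (P1 \x P2)%E _.
have a0 : (0 <= a)%E by exact: measure_ge0.
have a'0 : (0 <= a')%E by exact: measure_ge0.
move: a a' a0 a'0 => [a| |] [a'| |]//=; rewrite !lee_fin => a0 a'0 [aa'] h1 h2.
by congr EFin; apply/eqP; rewrite eq_le h1 andbT; lra.
Qed.

End Bridge.

(** * Averaging over the trajectory *)

Section TailBounds.
Variables (R : realType) (d : nat).
Hypothesis d_ge2 : (2 <= d)%N.
Local Notation V := (vertex d).
Variables (d1 : measure_display) (O1 : measurableType d1) (P1 : probability O1 R).
Variables (X : {RV P1 >-> R}) (xi : V -> {RV P1 >-> R}).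
Variables (d2 : measure_display) (O2 : measurableType d2) (P2 : probability O2 R).
Variable S : nat -> O2 -> V.
Hypothesis xi_copies : independent_copies X xi.
Hypothesis EX0 : ('E_P1[X] = 0)%E.
Hypothesis EX4 : ('E_P1[fun w => (X w ^+ 4)%R] < +oo)%E.
Local Notation s2 := (second_moment X).
Local Notation m4 := (fourth_moment X).
Hypothesis s2_gt0 : 0 < s2.
Hypothesis srwS : simple_random_walk P2 S.

Definition visit_count (s : seq V) (v : V) : nat := count_mem v s.

Lemma sum_visit_count (s : seq V) (f : V -> R) :
  \sum_(v <- undup s) (visit_count s v)%:R * f v = \sum_(v <- s) f v.
Proof.
rewrite -(big_undup_iterop_count +%R s xpredT f); apply: eq_bigr => v _.
by rewrite mulr_natl.
Qed.

Lemma self_normalized_ratioE (t : nat -> V) (z : V -> R) n :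
  let s := [seq t k | k <- iota 0 n.+1] in
  self_normalized_ratio t z n =
  (\sum_(v <- undup s) (visit_count s v)%:R * z v) * Num.sqrt n%:R /
     (Num.sqrt (\sum_(v <- undup s) (visit_count s v)%:R * z v ^+ 2) *
      Num.sqrt (\sum_(v <- undup s) (visit_count s v)%:R ^+ 2)).
Proof.
move=> s.
have sumE (f : V -> R) : \sum_(0 <= k < n.+1) f (t k) =
    \sum_(v <- undup s) (visit_count s v)%:R * f v.
  by rewrite sum_visit_count /s big_map /index_iota subn0.
have ltE v : local_time t n v = visit_count s v.
  rewrite /visit_count /local_time /s /index_iota subn0.
  elim: (iota 0 n.+1) => [|k r IH]; first by rewrite big_nil.
  by rewrite big_cons IH.
rewrite /self_normalized_ratio /rwrs /self_norm /local_time_norm2 sumE.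
rewrite sum_local_time (sumE (fun v => z v ^+ 2)); congr (_ / (_ * Num.sqrt _)).
transitivity (\sum_(v \in [set: V]) ((local_time t n v)%:R * (local_time t n v)%:R : R)).
  by apply: eq_fsbigr => v _; rewrite expr2.
rewrite sum_local_time (sumE (fun v => (local_time t n v)%:R)).
by apply: eq_bigr => v _; rewrite ltE expr2.
Qed.

Definition quenched_event (n : nat) (y : R) (s : seq V) : set O1 :=
  ratio_event xi (undup s) (visit_count s) n%:R y.

Definition annealed_prob (n : nat) (y : R) : R :=
  walk_mean n (fun s => fine (P1 (quenched_event n y s))) (Defs.root d).

Lemma tail_annealed (n : nat) (y : R) :
  (P1 \x P2)%E [set w : O1 * O2 |
     y <= self_normalized_ratio (S^~ w.2) (fun v => xi v w.1) n] = (annealed_prob n y)%:E.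
Proof.
rewrite -(joint_prob d_ge2 P1 srwS (E := quenched_event n y)); last first.
  by move=> s; exact: measurable_ratio_event.
congr ((P1 \x P2)%E _); apply/seteqP; split => -[w1 w2];
by rewrite /joint_event /quenched_event /ratio_event /= self_normalized_ratioE.
Qed.

Let K : R := visit_base R d.
Let th : R := ln K.
Let B : R := visit_cst R d.

Lemma visit_rate_gt0 : 0 < th.
Proof. by rewrite ln_gt0//; exact: visit_base_gt1. Qed.

Lemma expR_visit_rate k : expR (th * k%:R) = K ^+ k.
Proof.
rewrite mulrC expRM_natl lnK// posrE (lt_trans ltr01)//.
exact: visit_base_gt1.
Qed.

Lemma visit_count_gt0 (s : seq V) v : v \in undup s -> (0 < visit_count s v)%N.
Proof. by rewrite mem_undup -has_pred1 has_count. Qed.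

Lemma sum_visit_count1 n (s : seq V) : size s = n.+1 ->
  \sum_(v <- undup s) (visit_count s v)%:R = n.+1%:R :> R.
Proof.
move=> sn; rewrite -sn -[RHS]mulr_natl mulr1.
have := sum_visit_count s (fun=> 1); under eq_bigr do rewrite mulr1.
by move=> ->; rewrite big_const_seq iter_addr addr0 count_predT.
Qed.

Let visits_prod (p : R) (s : seq V) : R :=
  \prod_(v <- undup s) (1 + p * expR (th * (visit_count s v)%:R)).

Lemma walk_visits_le (p : R) n : 0 <= p ->
  walk_mean n (visits_prod p) (Defs.root d) <=
  (1 + p * B * Num.sqrt n.+1%:R) ^+ n.+1.
Proof.
move=> p0; apply: le_trans (walk_visits_prod_le d_ge2 n p0).
apply: walk_mean_le => s _; rewrite le_eqVlt; apply/orP; left; apply/eqP.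
by apply: eq_bigr => v _; rewrite expR_visit_rate.
Qed.

Lemma annealed_upper (n : nat) (y e tau p m : R) :
  (0 < n)%N -> 0 < y -> 0 < e -> e < 1 -> 0 < p -> 0 < m ->
  tau = (e / 2) * Num.sqrt n%:R * Num.sqrt s2 / y ->
  24 * (2 / th) ^+ 4 * m4 / tau ^+ 4 <= p ->
  annealed_prob n y <=
   expR (- (1 - e) ^+ 4 * (1 - expR (e / 2) / 2) * y ^+ 2)
    + (expR (- (th / 2) * (e ^+ 2 * y ^+ 2)) + expR (- th * m) / p) *
      (1 + p * B * Num.sqrt n.+1%:R) ^+ n.+1
    + expR (- (e ^+ 2 * s2 ^+ 2 / (2 * m * m4) * n.+1%:R)).
Proof.
move=> n0 y0 e0 e1 p0 m0 tauE pE.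
have nR0 : 0 < n%:R :> R by rewrite ltr0n.
set a := expR _; set c := expR _ + _; set g := expR (- (_ / _ * _)).
have c0 : 0 <= c by rewrite addr_ge0 ?divr_ge0 ?expR_ge0// ltW.
apply: (@le_trans _ _ (walk_mean n (fun s => (a + g) + c * visits_prod p s) (Defs.root d))).
  apply: walk_mean_le => s sn.
  rewrite -lee_fin fineK ?fin_num_measure//; last exact: measurable_ratio_event.
  have nN : n%:R <= \sum_(v <- undup s) (visit_count s v)%:R :> R.
    by rewrite (sum_visit_count1 sn) ler_nat.
  have := ratio_upper xi_copies EX0 EX4 s2_gt0 (undup_uniq s) (@visit_count_gt0 s)
    nR0 nN y0 e0 e1 visit_rate_gt0 p0 m0 tauE pE.
  by rewrite (sum_visit_count1 sn) -/a -/c -/g -/(visits_prod p s) addrAC.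
rewrite walk_meanD walk_mean_cst// walk_meanZ addrAC lerD2r lerD2l ler_wpM2l//.
by apply: walk_visits_le; exact: ltW.
Qed.

(** A trajectory on which some vertex is visited more than M times contributes at most
0 to the integrand below, since there c times the product is at least 1; on the
other ones ratio_lower applies and the product is only subtracted. *)
Lemma annealed_lower (n : nat) (b M y eta s p : R) :
  let kap := eta ^+ 2 / 12 in let yp := y * (1 + eta) ^+ 2 / (1 - eta) in
  (0 < n)%N -> 0 < y -> 0 < eta -> eta <= 2^-1 -> 0 < b -> b ^+ 4 = n%:R -> 0 < p ->
  n.+1%:R <= (1 + eta) ^+ 2 * n%:R ->
  0 < s -> s * M * b ^+ 2 <= 2^-1 ->
  2 * yp / (Num.sqrt n%:R * Num.sqrt s2) * M * b <= kap / 2 ->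
  yp ^+ 2 * M ^+ 2 <= kap * n%:R -> 4 * m4 <= n%:R ->
  expR (- (eta ^+ 2 / 4) * yp ^+ 2 + 16 * m4) <= 4^-1 ->
  expR (- s * eta * n%:R * s2 + 3 * yp ^+ 2 + 12 * s ^+ 2 * M * n%:R * m4 + 16 * m4) <= 4^-1 ->
  expR (- th * M) / p * (1 + p * B * Num.sqrt n.+1%:R) ^+ n.+1 <= 2^-1 ->
  8^-1 * expR (- (1 + eta) * yp ^+ 2 + (1 - 2 * kap) * yp ^+ 2 / 2 - 16 * m4)
    <= annealed_prob n y.
Proof.
move=> kap yp n0 y0 eta0 eta2 b0 bn p0 Nn s0 sMb hMb hM m4n exp1 exp3 good.
set c := expR (- th * M) / p in good.
have c0 : 0 <= c by rewrite divr_ge0 ?expR_ge0// ltW.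
set a := expR (- (1 + eta) * _ + _ - _).
have a0 : 0 < a by exact: expR_gt0.
apply: (@le_trans _ _ (walk_mean n (fun s => 4^-1 * a + (- (4^-1 * a * c)) * visits_prod p s) (Defs.root d))).
  rewrite walk_meanD walk_mean_cst// walk_meanZ.
  have h : c * walk_mean n (visits_prod p) (Defs.root d) <= 2^-1.
    apply: le_trans good; rewrite ler_wpM2l//.
    by apply: walk_visits_le; exact: ltW.
  rewrite mulNr -mulrA -[leLHS]mulrC.
  have := ler_wpM2l (_ : 0 <= 4^-1 * a) h; rewrite mulr_ge0 ?(ltW a0)// => /(_ isT).
  by rewrite -!mulrA; lra.
apply: walk_mean_le => q qn.
have vp1 : forall r : seq V, 0 <= \prod_(v <- r) (1 + p * expR (th * (visit_count q v)%:R)).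
  by move=> r; apply: prodr_ge0 => v _; rewrite addr_ge0// mulr_ge0 ?expR_ge0// ltW.
have [/hasP[v vq /= mv]|/hasPn noti] := boolP (has (fun v => M < (visit_count q v)%:R) (undup q)).
  apply: (@le_trans _ _ 0); last first.
    by apply: fine_ge0; exact: measure_ge0.
  have cv : 1 <= c * visits_prod p q.
    have h1 : p * expR (th * M) <= visits_prod p q.
      rewrite /visits_prod (bigD1_seq v) ?undup_uniq//= -[leLHS]mulr1; apply: ler_pM => //.
      - by rewrite mulr_ge0 ?expR_ge0// ltW.
      - by rewrite -[leLHS]add0r lerD// ler_wpM2l ?(ltW p0)// ler_expR ler_pM2l ?visit_rate_gt0// ltW.
      - elim/big_rec: _ => // j x _ x1; rewrite -[leLHS]mulr1 ler_pM//.
        by rewrite lerDl mulr_ge0 ?expR_ge0// ltW.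
    apply: (@le_trans _ _ (c * (p * expR (th * M)))); last by rewrite ler_wpM2l.
    by rewrite /c mulrA divfK ?gt_eqF// -expRD mulNr addNr expR0.
  rewrite mulNr subr_le0 -[leRHS]mulrA ler_peMr//.
  by rewrite mulr_ge0 ?(ltW a0).
apply: (@le_trans _ _ (4^-1 * a)).
  rewrite mulNr gerBl mulr_ge0 ?vp1// mulr_ge0// mulr_ge0 ?(ltW a0)//.
rewrite -lee_fin fineK ?fin_num_measure//; last exact: measurable_ratio_event.
have nN : n%:R <= \sum_(v <- undup q) (visit_count q v)%:R :> R.
  by rewrite (sum_visit_count1 qn) ler_nat.
have Nn' : \sum_(v <- undup q) (visit_count q v)%:R <= (1 + eta) ^+ 2 * n%:R.
  by rewrite (sum_visit_count1 qn).
apply: (ratio_lower xi_copies EX0 EX4 s2_gt0 (undup_uniq q) (@visit_count_gt0 q)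
  y0 eta0 eta2 b0 bn _ nN Nn' s0 sMb hMb hM m4n exp1 exp3).
have M0 : 0 <= M.
  have [v vq] : exists v, v \in undup q.
    by case: q qn {vp1 noti nN Nn'} => // v q _; exists v; rewrite mem_undup mem_head.
  by have := noti v vq; rewrite -leNgt; apply: le_trans.
move=> v; have [vq|vq] := boolP (v \in undup q); first by rewrite leNgt noti.
by rewrite /visit_count (count_memPn _) // -mem_undup.
Qed.

End TailBounds.

(** * Choice of the parameters *)

Section Asymptotics.
Variable R : realType.

(** The constant is hidden behind an existential so that no factorial is ever
computed. *)
Lemma expRN_le_power (k : nat) :
  exists2 C : R, 0 < C & forall x, 0 < x -> expR (- x) <= C / x ^+ k.+1.
Proof.
exists k.+1`!%:R; first by rewrite ltr0n fact_gt0.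
move=> x x0; have := expR_ge1Dxn k (ltW x0).
have : 0 < k.+1`!%:R :> R by rewrite ltr0n fact_gt0.
move: (k.+1`!%:R : R) => F F0 h.
have xk : 0 < x ^+ k.+1 by rewrite exprn_gt0.
rewrite expRN -[leRHS]invf_div lef_pV2 ?posrE ?expR_gt0 ?divr_gt0//; lra.
Qed.

Lemma power_exp_small (k : nat) (a eps : R) : 0 < a -> 0 < eps ->
  exists R0 : R, forall r, R0 <= r -> r ^+ k * expR (- a * r) <= eps.
Proof.
move=> a0 e0; have [C C0 HC] := expRN_le_power k.
have ak : 0 < a ^+ k.+1 by rewrite exprn_gt0.
exists (1 + C / a ^+ k.+1 / eps) => r rR.
have Ce0 : 0 <= C / a ^+ k.+1 / eps by rewrite ltW// !divr_gt0.
have r0 : 0 < r by lra.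
rewrite mulNr; apply: (@le_trans _ _ (r ^+ k * (C / (a * r) ^+ k.+1))).
  by rewrite ler_wpM2l ?exprn_ge0 ?(ltW r0)// HC// mulr_gt0.
have -> : r ^+ k * (C / (a * r) ^+ k.+1) = C / a ^+ k.+1 / r.
  have rk : 0 < r ^+ k by rewrite exprn_gt0.
  rewrite exprMn [r ^+ k.+1]exprS.
  move: (r ^+ k) (a ^+ k.+1) rk ak => u v u0 v0.
  by field; rewrite ?gt_eqF.
rewrite ler_pdivrMr// [leRHS]mulrC -ler_pdivrMr//; lra.
Qed.

Lemma power_exp_small12 (a b eps : R) : 0 < a -> 0 <= b -> 0 < eps ->
  exists R0 : R, forall r, R0 <= r -> r ^+ 48 * expR (- a * r ^+ 12 + b * r ^+ 8) <= eps.
Proof.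
move=> a0 b0 e0; have [R0 HR] := power_exp_small 48 (divr_gt0 a0 (ltr0n R 2)) e0.
exists (1 + `|R0| + 2 * b / a) => r rR.
have ba0 : 0 <= 2 * b / a by rewrite divr_ge0 ?mulr_ge0// ltW.
have r1 : 1 <= r by have := normr_ge0 R0; lra.
have rR0 : R0 <= r by have := ler_norm R0; lra.
have rb : b <= a / 2 * r.
  have : 2 * b / a <= r by have := normr_ge0 R0; lra.
  by rewrite ler_pdivrMr//; lra.
apply: le_trans (HR r rR0); rewrite ler_wpM2l ?exprn_ge0 ?(le_trans ler01)//.
rewrite ler_expR.
have r8 : r <= r ^+ 12 by rewrite -[leLHS]expr1 ler_weXn2l.
have r9 : r * r ^+ 8 <= r ^+ 12 by rewrite -exprS ler_weXn2l.
have h1 : b * r ^+ 8 <= a / 2 * r ^+ 12.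
  apply: (@le_trans _ _ (a / 2 * r * r ^+ 8)).
    by rewrite ler_wpM2r// exprn_ge0// (le_trans ler01).
  by rewrite -mulrA ler_wpM2l// divr_ge0// ltW.
have h2 : a / 2 * r <= a / 2 * r ^+ 12 by rewrite ler_wpM2l// divr_ge0// ltW.
by rewrite !mulNr; lra.
Qed.

Lemma exp_small11 (a b c : R) : 0 < a -> 0 <= b -> 0 <= c ->
  exists R0 : R, forall r, R0 <= r -> expR (- a * r ^+ 11 + b * r ^+ 8 + c) <= 4^-1.
Proof.
move=> a0 b0 c0; exists (2 + c + (b + 1) / a) => r rR.
have ba0 : 0 <= (b + 1) / a by rewrite divr_ge0 ?addr_ge0// ltW.
have r1 : 1 <= r by lra.
have rb : b + 1 <= a * r.
  have : (b + 1) / a <= r by lra.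
  by rewrite ler_pdivrMr// mulrC.
have r8 : r <= r ^+ 8 by rewrite -[leLHS]expr1 ler_weXn2l.
have r9 : r * r ^+ 8 <= r ^+ 11 by rewrite -exprS ler_weXn2l.
have r80 : 0 <= r ^+ 8 by lra.
have h1 : (b + 1) * r ^+ 8 <= a * r ^+ 11.
  apply: (@le_trans _ _ (a * r * r ^+ 8)); first by rewrite ler_wpM2r.
  by rewrite -mulrA ler_wpM2l// ltW.
apply: (@le_trans _ _ (expR (- 2))); first by rewrite ler_expR; lra.
rewrite expRN lef_pV2 ?posrE ?expR_gt0//.
by have := @expR_ge_quadratic R 2 (ler0n R 2); lra.
Qed.

Lemma exp_small2 (a c : R) : 0 < a ->
  exists Y0 : R, forall y, Y0 <= y -> expR (- a * y ^+ 2 + c) <= 4^-1.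
Proof.
move=> a0; exists (1 + (2 + `|c|) / a) => y yY.
have c0 := normr_ge0 c.
have q0 : 0 <= (2 + `|c|) / a by rewrite divr_ge0 ?addr_ge0// ltW.
have y1 : 1 <= y by lra.
have y2 : y <= y ^+ 2 by rewrite -[leLHS]expr1 ler_weXn2l.
have h : 2 + `|c| <= a * y ^+ 2.
  have : (2 + `|c|) / a <= y ^+ 2 by lra.
  by rewrite ler_pdivrMr// mulrC.
apply: (@le_trans _ _ (expR (- 2))).
  by rewrite ler_expR; have := ler_norm c; lra.
rewrite expRN lef_pV2 ?posrE ?expR_gt0//.
by have := @expR_ge_quadratic R 2 (ler0n R 2); lra.
Qed.

Lemma power_1Dx_le (k : nat) (u : R) : 0 <= u -> (1 + u) ^+ k <= expR (k%:R * u).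
Proof.
move=> u0; rewrite expRM_natl lerXn2r ?nnegrE ?expR_ge0 ?addr_ge0//.
exact: expR_ge1Dx.
Qed.

Lemma succ_three_halves (n : nat) (r : R) : 1 <= r -> n%:R = r ^+ 24 ->
  n.+1%:R * Num.sqrt n.+1%:R <= 4 * r ^+ 36.
Proof.
move=> r1 nr.
have r24 : 1 <= r ^+ 24 by rewrite exprn_ege1.
have n2 : n.+1%:R <= 2 * r ^+ 24 by rewrite -natr1 nr; lra.
have r0 : 0 <= r by lra.
have s2 : Num.sqrt n.+1%:R <= 2 * r ^+ 12.
  have q0 : 0 <= 2 * r ^+ 12 by rewrite mulr_ge0// exprn_ge0.
  rewrite -[leRHS]ger0_norm// -sqrtr_sqr ler_sqrt ?sqr_ge0// exprMn -exprM.
  by apply: (le_trans n2); rewrite ler_wpM2r ?exprn_ge0//; lra.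
apply: (@le_trans _ _ (2 * r ^+ 24 * (2 * r ^+ 12))).
  by apply: ler_pM => //; exact: sqrtr_ge0.
have -> : 2 * r ^+ 24 * (2 * r ^+ 12) = 4 * (r ^+ 24 * r ^+ 12) by ring.
by rewrite -exprD.
Qed.

Lemma thresholds_le (a b c r : R) : 1 + `|a| + `|b| + `|c| <= r ->
  [/\ 1 <= r, a <= r, b <= r & c <= r].
Proof.
move=> h; have := ler_norm a; have := ler_norm b; have := ler_norm c.
have := normr_ge0 a; have := normr_ge0 b; have := normr_ge0 c.
by move=> *; split; lra.
Qed.

(** With n = r^24 every threshold is a power of r: y <= r^4 says y <= n^(1/6), and
the bound m = r^12 on the local times satisfies y^2 << r^12 and y^2 << n / m.
The average over the walk contributes exp(C y^4 / r^12), which y^4 <= y^2 r^8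
turns into exp(o(y^2)). *)
Lemma upper_exponents (e th B sigma2 mu4 c : R) :
  0 < e -> e < 1 -> 0 < th -> 0 <= B -> 0 < sigma2 -> 0 < mu4 -> 0 < c ->
  c / 2 < (1 - e) ^+ 4 * (1 - expR (e / 2) / 2) -> c < th * e ^+ 2 ->
  exists Y0 R0 : R, forall (n : nat) (y r : R), Y0 <= y -> R0 <= r ->
    y <= r ^+ 4 -> n%:R = r ^+ 24 ->
    [/\ (0 < n)%N, 0 < y &
    let tau := (e / 2) * Num.sqrt n%:R * Num.sqrt sigma2 / y in
    let p := 24 * (2 / th) ^+ 4 * mu4 / tau ^+ 4 in
    [/\ 0 < r, 0 < p &
    expR (- (1 - e) ^+ 4 * (1 - expR (e / 2) / 2) * y ^+ 2)
    + (expR (- (th / 2) * (e ^+ 2 * y ^+ 2)) + expR (- th * r ^+ 12) / p) *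
      (1 + p * B * Num.sqrt n.+1%:R) ^+ n.+1
    + expR (- (e ^+ 2 * sigma2 ^+ 2 / (2 * r ^+ 12 * mu4) * n.+1%:R))
    <= expR (- (c / 2) * y ^+ 2)]].
Proof.
move=> e0 e1 th0 B0 s0 m0 c0 hc1 hc2.
set al := (1 - e) ^+ 4 * (1 - expR (e / 2) / 2) in hc1 *.
(* The constant with p = C y^4 / n^2. *)
pose C := 24 * (2 / th) ^+ 4 * mu4 * 16 / (e ^+ 4 * sigma2 ^+ 2).
have C0 : 0 < C.
  rewrite divr_gt0//; last by rewrite mulr_gt0// exprn_gt0.
  by rewrite mulr_gt0// mulr_gt0// mulr_gt0// exprn_gt0// divr_gt0.
have [del [del0 d1 d2]] : exists del, [/\ 0 < del, c / 2 + del <= al & c / 2 + del <= th / 2 * e ^+ 2].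
  exists (Num.min (al - c / 2) (th / 2 * e ^+ 2 - c / 2)); split.
  - by rewrite lt_min; apply/andP; split; lra.
  - have : Num.min (al - c / 2) (th / 2 * e ^+ 2 - c / 2) <= al - c / 2 by rewrite ge_min lexx.
    lra.
  - have : Num.min (al - c / 2) (th / 2 * e ^+ 2 - c / 2) <= th / 2 * e ^+ 2 - c / 2.
      by rewrite ge_min lexx orbT.
    lra.
have [Y1 HY1] := exp_small2 0 (divr_gt0 del0 (ltr0n R 2)).
have b0 : 0 <= c / 2 + del / 2 by rewrite addr_ge0// divr_ge0// ltW.
have C40 : 0 < C / 4 by rewrite divr_gt0.
have [R1 HR1] := power_exp_small12 th0 b0 C40.
pose c3 := e ^+ 2 * sigma2 ^+ 2 / (2 * mu4).
have c30 : 0 < c3 by rewrite divr_gt0 ?mulr_gt0// exprn_gt0.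
have c20 : 0 <= c / 2 by rewrite divr_ge0// ltW.
have q4 : 0 < 4^-1 :> R by rewrite invr_gt0.
have [R2 HR2] := power_exp_small12 c30 c20 q4.
pose R3 := 4 * B * C / (del / 2).
exists (1 + `|Y1| + `|Y1| + `|Y1|), (1 + `|R1| + `|R2| + `|R3|) => n y r yY rR yr nr.
have [y1 yY1 _ _] := thresholds_le yY.
have [r1 rR1 rR2 rR3] := thresholds_le rR.
have y0 : 0 < y by exact: lt_le_trans y1.
have r0 : 0 < r by exact: lt_le_trans r1.
have y2r : y ^+ 2 <= r ^+ 8.
  have -> : r ^+ 8 = (r ^+ 4) ^+ 2 by rewrite -exprM.
  by rewrite lerXn2r ?nnegrE// ltW// exprn_gt0.
split=> //.
  by rewrite -(ltr0n R) nr exprn_gt0.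
move=> tau p.
have sqn : Num.sqrt n%:R = r ^+ 12.
  have r24 : r ^+ 24 = (r ^+ 12) ^+ 2 by rewrite -exprM.
  by rewrite nr r24 sqrtr_sqr ger0_norm// exprn_ge0// ltW.
have pE : p = C * y ^+ 4 / r ^+ 48.
  rewrite /p /tau sqn /C.
  have -> : sigma2 ^+ 2 = Num.sqrt sigma2 ^+ 4.
    by rewrite -[in LHS](sqr_sqrtr (ltW s0)) -exprM.
  have -> : r ^+ 48 = (r ^+ 12) ^+ 4 by rewrite -exprM.
  have q0 : 0 < r ^+ 12 by rewrite exprn_gt0.
  have sg0 : 0 < Num.sqrt sigma2 by rewrite sqrtr_gt0.
  move: (r ^+ 12) q0 (Num.sqrt sigma2) sg0 => q q0 sg sg0.
  by field; rewrite ?gt_eqF.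
have p0 : 0 < p by rewrite pE divr_gt0 ?(exprn_gt0 48)// mulr_gt0// exprn_gt0.
split=> //.
set W := (1 + _) ^+ n.+1; set E := expR (- (c / 2) * y ^+ 2).
have y20 : 0 <= y ^+ 2 by rewrite sqr_ge0.
have del2 : 0 <= del / 2 by rewrite divr_ge0// ltW.
have r48 : 0 < r ^+ 48 by rewrite exprn_gt0.
have WE : W <= expR (del / 2 * y ^+ 2).
  have u0 : 0 <= p * B * Num.sqrt n.+1%:R by rewrite mulr_ge0 ?sqrtr_ge0// mulr_ge0// ltW.
  apply: (le_trans (power_1Dx_le n.+1 u0)); rewrite ler_expR.
  have -> : n.+1%:R * (p * B * Num.sqrt n.+1%:R) = p * B * (n.+1%:R * Num.sqrt n.+1%:R) by ring.
  have pB : 0 <= p * B by rewrite mulr_ge0// ltW.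
  apply: (le_trans (ler_wpM2l pB (succ_three_halves r1 nr))).
  have -> : p * B * (4 * r ^+ 36) = 4 * B * C * y ^+ 2 * (y ^+ 2 / r ^+ 12).
    have r48E : r ^+ 48 = r ^+ 36 * r ^+ 12 by rewrite -exprD.
    have q1 : 0 < r ^+ 36 by rewrite exprn_gt0.
    have q2 : 0 < r ^+ 12 by rewrite exprn_gt0.
    rewrite pE r48E; move: (r ^+ 36) (r ^+ 12) q1 q2 => q q' q1 q2.
    by field; rewrite ?gt_eqF.
  have yr1 : y ^+ 2 / r ^+ 12 <= r^-1.
    rewrite ler_pdivrMr ?exprn_gt0// (le_trans y2r)//.
    by rewrite [r ^+ 12]exprS mulKf ?gt_eqF// ler_weXn2l.
  apply: (@le_trans _ _ (4 * B * C * y ^+ 2 * r^-1)).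
    by rewrite ler_wpM2l// mulr_ge0// mulr_ge0 ?(ltW C0)// mulr_ge0.
  rewrite mulrAC ler_wpM2r// ler_pdivrMr// [leRHS]mulrC -ler_pdivrMr//.
  by rewrite divr_gt0.
have E1 : expR (- (del / 2) * y ^+ 2) <= 4^-1 by have := HY1 y yY1; rewrite addr0.
have E0 : 0 <= E by exact: expR_ge0.
have glue u v : u <= - (c / 2) * y ^+ 2 + v -> expR v <= 4^-1 -> expR u <= E / 4.
  move=> uv v4; apply: (@le_trans _ _ (E * expR v)); last by rewrite ler_wpM2l.
  by rewrite -expRD ler_expR.
have T1 : expR (- (1 - e) ^+ 4 * (1 - expR (e / 2) / 2) * y ^+ 2) <= E / 4.
  apply: (glue _ _ _ E1); rewrite mulNr -/al -mulrDl ler_wpM2r//.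
  by rewrite -opprD lerN2 (le_trans _ d1)// lerD2l ler_pdivrMr// ler_peMr ?(ltW del0)// ler1n.
have T2 : expR (- (th / 2) * (e ^+ 2 * y ^+ 2)) * W <= E / 4.
  apply: (@le_trans _ _ (expR (- (th / 2) * (e ^+ 2 * y ^+ 2)) * expR (del / 2 * y ^+ 2))).
    by rewrite ler_wpM2l// expR_ge0.
  rewrite -expRD; apply: (glue _ _ _ E1).
  have -> : - (th / 2) * (e ^+ 2 * y ^+ 2) = - (th / 2 * e ^+ 2) * y ^+ 2 by ring.
  rewrite -!mulrDl ler_wpM2r//; clear - d2; lra.
have T3 : expR (- th * r ^+ 12) / p * W <= E / 4.
  have ip : p^-1 <= r ^+ 48 / C.
    have Cy : 0 < C * y ^+ 4 by rewrite mulr_gt0// exprn_gt0.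
    by rewrite pE invf_div ler_pM2l// lef_pV2 ?posrE// ler_peMr ?(ltW C0)// exprn_ege1.
  apply: (@le_trans _ _ (expR (- th * r ^+ 12) * (r ^+ 48 / C) * expR (del / 2 * y ^+ 2))).
    apply: ler_pM => //.
    - by rewrite divr_ge0 ?expR_ge0// ltW.
    - by rewrite exprn_ge0// addr_ge0// mulr_ge0 ?sqrtr_ge0// mulr_ge0// ltW.
    - by rewrite ler_wpM2l// expR_ge0.
  have -> : expR (- th * r ^+ 12) * (r ^+ 48 / C) * expR (del / 2 * y ^+ 2) =
     E * (r ^+ 48 * expR (- th * r ^+ 12 + (c / 2 + del / 2) * y ^+ 2)) / C.
    have -> : expR (- th * r ^+ 12 + (c / 2 + del / 2) * y ^+ 2) =
       expR (- th * r ^+ 12) * expR (del / 2 * y ^+ 2) * expR (c / 2 * y ^+ 2).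
      by rewrite -!expRD; congr expR; ring.
    have EE : E * expR (c / 2 * y ^+ 2) = 1.
      by rewrite /E -expRD mulNr addNr expR0.
    move: EE; set e1' := expR (- th * _); set e2' := expR (del / 2 * _); set e3' := expR (c / 2 * _).
    move=> EE; rewrite -[LHS]mulr1 -EE.
    by move: (r ^+ 48) => q; field; rewrite gt_eqF.
  rewrite -mulrA ler_wpM2l// ler_pdivrMr//.
  apply: (@le_trans _ _ (C / 4)); last by rewrite mulrC.
  apply: le_trans (HR1 r rR1); rewrite ler_wpM2l ?(ltW r48)// ler_expR lerD2l.
  by rewrite ler_wpM2l.
have T4 : expR (- (e ^+ 2 * sigma2 ^+ 2 / (2 * r ^+ 12 * mu4) * n.+1%:R)) <= E / 4.
  apply: (glue _ (- c3 * r ^+ 12 + c / 2 * r ^+ 8)); last first.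
    apply: le_trans (HR2 r rR2); rewrite ler_peMl ?expR_ge0//.
    by rewrite exprn_ege1.
  have -> : e ^+ 2 * sigma2 ^+ 2 / (2 * r ^+ 12 * mu4) * n.+1%:R = c3 * (n.+1%:R / r ^+ 12).
    have q2 : 0 < r ^+ 12 by rewrite exprn_gt0.
    rewrite /c3; move: (r ^+ 12) q2 => q q2.
    by field; rewrite ?gt_eqF.
  have h1 : c3 * r ^+ 12 <= c3 * (n.+1%:R / r ^+ 12).
    rewrite ler_wpM2l ?(ltW c30)// ler_pdivlMr ?exprn_gt0// -exprD -nr.
    by rewrite ler_nat.
  have h2 : c / 2 * y ^+ 2 <= c / 2 * r ^+ 8 by rewrite ler_wpM2l.
  by rewrite !mulNr; clear - h1 h2; lra.
clear - T1 T2 T3 T4.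
rewrite mulrDl; lra.
Qed.

Lemma thresholds_all (l : seq R) (r : R) :
  \sum_(a <- l) `|a| <= r -> all (fun a => a <= r) l.
Proof.
move=> h; apply/allP => a al; apply: le_trans h.
rewrite (big_rem a al) /=; apply: (le_trans (ler_norm a)).
by rewrite lerDl sumr_ge0.
Qed.

(** The cut-off b = r^6 = n^(1/4) keeps the total loss n m4 / b^4 bounded. The bound
M = r on the local times makes h M b, which is of order y r^7 / r^12, tend to 0;
the weight s is the largest one with s M b^2 <= 1/2, and s N is of order r^11,
well above y^2 <= r^8. *)
Lemma lower_exponents (eta th B sigma2 mu4 : R) :
  0 < eta -> eta <= 2^-1 -> 0 < th -> 0 <= B -> 0 < sigma2 -> 0 <= mu4 ->
  exists Y0 R0 : R, forall (n : nat) (y r : R), Y0 <= y -> R0 <= r ->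
    y <= r ^+ 4 -> n%:R = r ^+ 24 ->
    let kap := eta ^+ 2 / 12 in let yp := y * (1 + eta) ^+ 2 / (1 - eta) in
    let b := r ^+ 6 in let s := (2 * r ^+ 13)^-1 in let p := (r ^+ 48)^-1 in
    [/\ [/\ (0 < n)%N, 1 <= y, 0 < r & b ^+ 4 = n%:R],
      [/\ n.+1%:R <= (1 + eta) ^+ 2 * n%:R, s * r * b ^+ 2 <= 2^-1,
        2 * yp / (Num.sqrt n%:R * Num.sqrt sigma2) * r * b <= kap / 2,
        yp ^+ 2 * r ^+ 2 <= kap * n%:R & 4 * mu4 <= n%:R] &
      [/\ expR (- (eta ^+ 2 / 4) * yp ^+ 2 + 16 * mu4) <= 4^-1,
        expR (- s * eta * n%:R * sigma2 + 3 * yp ^+ 2 +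
          12 * s ^+ 2 * r * n%:R * mu4 + 16 * mu4) <= 4^-1 &
        expR (- th * r) / p * (1 + p * B * Num.sqrt n.+1%:R) ^+ n.+1 <= 2^-1]].
Proof.
move=> e0 e2 th0 B0 s0 m0.
pose kap := eta ^+ 2 / 12.
have k0 : 0 < kap by rewrite divr_gt0// exprn_gt0.
have e20 : 0 < eta ^+ 2 / 4 by rewrite divr_gt0// exprn_gt0.
have [Y1 HY1] := exp_small2 (16 * mu4) e20.
pose a := eta * sigma2 / 2.
have a0 : 0 < a by rewrite divr_gt0// mulr_gt0.
have m190 : 0 <= 19 * mu4 by rewrite mulr_ge0.
have [R1 HR1] := exp_small11 a0 (ler0n R 243) m190.
have q6 : 0 < 6^-1 :> R by rewrite invr_gt0.
have [R2 HR2] := power_exp_small 48 th0 q6.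
pose sg := Num.sqrt sigma2.
have sg0 : 0 < sg by rewrite sqrtr_gt0.
exists (1 + `|Y1| + `|Y1| + `|Y1|).
exists (\sum_(a <- [:: 1; R1; R2; eta^-1; 18 / (kap * sg); 81 / kap; 4 * mu4; 4 * B]) `|a|).
move=> n y r yY /thresholds_all rR yr nr kap' yp b s p.
have [y1 yY1 _ _] := thresholds_le yY.
move: rR; rewrite [X in is_true X]/= andbT => /and5P[r1 rR1 rR2 rR3 /and4P[rR4 rR5 rR6 rR7]].
have y0 : 0 < y by exact: lt_le_trans y1.
have r0 : 0 < r by exact: lt_le_trans r1.
have rk k : 0 < r ^+ k by rewrite exprn_gt0.
have rle j k : (j <= k)%N -> r ^+ j <= r ^+ k by move=> jk; rewrite ler_weXn2l.
have rle1 k : r <= r ^+ k.+1 by rewrite -[leLHS]expr1 ler_weXn2l.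
have y2r : y ^+ 2 <= r ^+ 8.
  have -> : r ^+ 8 = (r ^+ 4) ^+ 2 by rewrite -exprM.
  by rewrite lerXn2r ?nnegrE// ltW.
have et : 0 < 1 - eta by clear - e2; lra.
have yp_ge : y <= yp.
  rewrite /yp ler_pdivlMr// ler_pM2l//; clear - e0; nra.
have yp_le : yp <= 9 / 2 * y.
  rewrite /yp ler_pdivrMr//.
  have -> : 9 / 2 * y * (1 - eta) = y * (9 / 2 * (1 - eta)) by ring.
  rewrite ler_pM2l//; clear - e0 e2; nra.
have yp0 : 0 < yp by exact: lt_le_trans yp_ge.
have yp2 : yp ^+ 2 <= 81 * y ^+ 2.
  have -> : 81 * y ^+ 2 = (9 * y) ^+ 2 by ring.
  by rewrite lerXn2r ?nnegrE ?(ltW yp0)//; clear - yp_le y0; lra.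
have sqn : Num.sqrt n%:R = r ^+ 12.
  have r24 : r ^+ 24 = (r ^+ 12) ^+ 2 by rewrite -exprM.
  by rewrite nr r24 sqrtr_sqr ger0_norm// ltW.
split; split => //.
- by rewrite -(ltr0n R) nr.
- by rewrite /b nr -exprM.
- rewrite -natr1 nr.
  have h : 1 <= eta * r ^+ 24.
    by rewrite -ler_pdivrMl// mulr1 (le_trans rR3).
  have := rk 24; move: (r ^+ 24) h; clear - e0 => q h q0; nra.
- rewrite /s /b -exprM.
  have -> : (2 * r ^+ 13)^-1 * r * r ^+ (6 * 2) = 2^-1 * (r ^+ 13)^-1 * r ^+ 13.
    by rewrite invfM [r ^+ 13 in RHS]exprS; ring.
  by rewrite mulfVK ?gt_eqF.
- rewrite sqn -/sg.
  have -> : 2 * yp / (r ^+ 12 * sg) * r * b = 2 * yp / (r ^+ 5 * sg).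
    have -> : r ^+ 12 = r ^+ 5 * (r * r ^+ 6) by rewrite -exprS -exprD.
    rewrite /b; have := rk 5; have := rk 6.
    move: (r ^+ 5) (r ^+ 6) => u v v0 u0.
    by field; rewrite ?gt_eqF.
  apply: (@le_trans _ _ (9 / (r * sg))).
    have -> : 9 / (r * sg) = 9 * r ^+ 4 / (r ^+ 5 * sg).
      rewrite [r ^+ 5]exprS; have := rk 4; move: (r ^+ 4) => u u0.
      by field; rewrite ?gt_eqF.
    rewrite ler_pM2r ?invr_gt0 ?mulr_gt0//; clear - yr yp_le; lra.
  rewrite ler_pdivrMr ?mulr_gt0//.
  move: rR4; rewrite ler_pdivrMr ?mulr_gt0// => h.
  have -> : kap' / 2 * (r * sg) = r * (kap * sg) / 2 by rewrite /kap' /kap; ring.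
  clear - h; lra.
- apply: (@le_trans _ _ (81 * r ^+ 8 * r ^+ 2)).
    rewrite ler_pM2r ?rk// (le_trans yp2)// ler_pM2l//.
  rewrite -mulrA -exprD nr.
  apply: (@le_trans _ _ (kap * r * r ^+ 10)); last first.
    by rewrite -mulrA ler_pM2l// -exprS rle.
  rewrite ler_pM2r ?rk//.
  by move: rR5; rewrite ler_pdivrMr// mulrC.
- by rewrite nr (le_trans rR6).
- by apply: HY1; exact: le_trans yp_ge.
- apply: le_trans (HR1 r rR1); rewrite ler_expR.
  have h1 : - s * eta * n%:R * sigma2 = - a * r ^+ 11.
    have r24 : r ^+ 24 = r ^+ 13 * r ^+ 11 by rewrite -exprD.
    rewrite /s /a nr r24.
    have := rk 13; move: (r ^+ 13) (r ^+ 11) => u v u0.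
    by field; rewrite ?gt_eqF.
  have h2 : 12 * s ^+ 2 * r * n%:R * mu4 <= 3 * mu4.
    have -> : 12 * s ^+ 2 * r * n%:R * mu4 = 3 * mu4 * r^-1.
      rewrite /s nr.
      have -> : r ^+ 24 = (r ^+ 13) ^+ 2 / r ^+ 2.
        by rewrite -exprM -expfB// gt_eqF.
      have := rk 13; move: (r ^+ 13) => u u0.
      by field; rewrite ?gt_eqF.
    by rewrite ler_piMr ?mulr_ge0// invf_le1.
  rewrite h1.
  have h3 : 3 * yp ^+ 2 <= 243 * r ^+ 8.
    by clear - yp2 y2r; lra.
  by clear - h2 h3; lra.
- have W : (1 + p * B * Num.sqrt n.+1%:R) ^+ n.+1 <= 3.
    have u0 : 0 <= p * B * Num.sqrt n.+1%:R.
      by rewrite mulr_ge0 ?sqrtr_ge0// mulr_ge0// invr_ge0 ltW.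
    apply: (le_trans (power_1Dx_le n.+1 u0)); apply: le_trans (expR_le3 R).
    rewrite ler_expR.
    have -> : n.+1%:R * (p * B * Num.sqrt n.+1%:R) = p * B * (n.+1%:R * Num.sqrt n.+1%:R) by ring.
    have pB : 0 <= p * B by rewrite mulr_ge0// invr_ge0 ltW.
    apply: (le_trans (ler_wpM2l pB (succ_three_halves r1 nr))).
    have -> : p * B * (4 * r ^+ 36) = 4 * B / r ^+ 12.
      have r48 : r ^+ 48 = r ^+ 36 * r ^+ 12 by rewrite -exprD.
      rewrite /p r48.
      have := rk 36; have := rk 12; move: (r ^+ 36) (r ^+ 12) => u v v0 u1.
      by field; rewrite ?gt_eqF.
    by rewrite ler_pdivrMr ?rk// mul1r (le_trans rR7).
  have h := HR2 r rR2.
  rewrite /p invrK [expR _ * _]mulrC.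
  apply: (@le_trans _ _ (6^-1 * 3)); last by clear; lra.
  apply: ler_pM => //.
    by rewrite mulr_ge0 ?expR_ge0// ltW.
  by rewrite exprn_ge0// addr_ge0// mulr_ge0 ?sqrtr_ge0// mulr_ge0// invr_ge0 ltW.
Qed.

End Asymptotics.

(** * Limits superior and inferior of the rate *)

Section LimitGlue.
Variable R : realType.

Lemma limn_esup_le (u : nat -> \bar R) (l : \bar R) :
  (\forall n \near \oo, (u n <= l)%E) -> (limn_esup u <= l)%E.
Proof.
move=> ul; apply: (@le_trans _ _ (ereal_sup (u @` [set n | (u n <= l)%E]))).
  by apply: ereal_inf_lbound; exists [set n | (u n <= l)%E].
by apply: ge_ereal_sup => _ [n un <-].
Qed.

Lemma limn_einf_ge (u : nat -> \bar R) (l : \bar R) :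
  (\forall n \near \oo, (l <= u n)%E) -> (l <= limn_einf u)%E.
Proof.
move=> ul; rewrite /limn_einf leeNr; apply: limn_esup_le.
by apply: filterS ul => n; rewrite leeN2.
Qed.

Lemma rate_le (y a k : R) : 0 < y -> a <= expR (- k * y ^+ 2) ->
  ((y ^- 2)%:E * lne a%:E <= (- k)%:E)%E.
Proof.
move=> y0 ak; have y2 : 0 < y ^- 2 by rewrite invr_gt0 exprn_gt0.
have [a0|a0] := leP a 0; first by rewrite /= a0 gt0_muleNy ?lte_fin// leNye.
rewrite lne_EFin// -EFinM lee_fin ler_pdivrMl ?exprn_gt0//.
by rewrite -ler_expR lnK ?posrE// mulrC.
Qed.

Lemma rate_ge (y a k : R) : 0 < y -> expR (- k * y ^+ 2) <= a ->
  ((- k)%:E <= (y ^- 2)%:E * lne a%:E)%E.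
Proof.
move=> y0 ak; have a0 : 0 < a by apply: lt_le_trans ak; exact: expR_gt0.
rewrite lne_EFin// -EFinM lee_fin ler_pdivlMl ?exprn_gt0//.
by rewrite -ler_expR lnK ?posrE// mulrC.
Qed.

(** All thresholds are powers of n^(1/24), see upper_exponents and
lower_exponents. *)
Definition root24 (n : nat) : R := n%:R `^ 24^-1.

Lemma root24K n : root24 n ^+ 24 = n%:R.
Proof.
by rewrite -powR_mulrn ?powR_ge0// -powRrM mulVf// powRr1.
Qed.

Lemma root24_ge (A : R) : \forall n \near \oo, A <= root24 n.
Proof.
near=> n.
have An : `|A| ^+ 24 <= n%:R by near: n; exact: nbhs_infty_ger.
apply: (le_trans (ler_norm A)).
by rewrite -(ler_pXn2r (n := 24))// ?nnegrE ?powR_ge0// root24K.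
Unshelve. all: by end_near. Qed.

Lemma eventually_le_root24 (y : nat -> R) :
  y n / (n%:R `^ (6%:R^-1)) @[n --> \oo] --> (0 : R) ->
  \forall n \near \oo, y n <= root24 n ^+ 4.
Proof.
move=> /cvgrPdist_le/(_ 1 ltr01) h; near=> n.
have n0 : (0 < n)%N by near: n; exact: nbhs_infty_gt.
have : `|0 - y n / (n%:R `^ (6%:R^-1))| <= 1 by near: n.
rewrite sub0r normrN => /(le_trans (ler_norm _)).
have p0 : 0 < n%:R `^ (6%:R^-1) :> R by rewrite powR_gt0// ltr0n.
rewrite ler_pdivrMr// mul1r => /le_trans; apply.
rewrite -powR_mulrn ?powR_ge0// -powRrM le_eqVlt; apply/orP; left; apply/eqP.
by congr (_ `^ _); field.
Unshelve. all: by end_near. Qed.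

(** The exponent of ratio_lower per unit of y^2 tends to 1/2 linearly in eta. *)
Lemma tilt_cost_le (eta : R) : 0 <= eta -> eta <= 2^-1 ->
  ((1 + eta) ^+ 2 / (1 - eta)) ^+ 2 * (2^-1 + eta + eta ^+ 2 / 12) <= 2^-1 + 75 * eta.
Proof.
move=> e0 e2.
have et : 0 < 1 - eta by lra.
have g1 : (1 + eta) ^+ 2 / (1 - eta) <= 1 + 7 * eta.
  by rewrite ler_pdivrMr//; nra.
have g0 : 0 <= (1 + eta) ^+ 2 / (1 - eta) by rewrite divr_ge0 ?sqr_ge0// ltW.
have g2 : ((1 + eta) ^+ 2 / (1 - eta)) ^+ 2 <= 1 + 39 * eta.
  apply: (@le_trans _ _ ((1 + 7 * eta) ^+ 2)); last by nra.
  by rewrite lerXn2r ?nnegrE// addr_ge0// mulr_ge0.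
have e3 : 2^-1 + eta + eta ^+ 2 / 12 <= 2^-1 + 2 * eta by nra.
apply: (@le_trans _ _ ((1 + 39 * eta) * (2^-1 + 2 * eta))); last by nra.
apply: ler_pM => //; first by rewrite sqr_ge0.
by rewrite addr_ge0 ?addr_ge0 ?invr_ge0// divr_ge0 ?sqr_ge0.
Qed.

End LimitGlue.

(** * Exponential rates and the constants *)

Section TailRates.
Variables (R : realType) (d : nat).
Hypothesis d_ge2 : (2 <= d)%N.
Local Notation V := (vertex d).
Variables (d1 : measure_display) (O1 : measurableType d1) (P1 : probability O1 R).
Variables (X : {RV P1 >-> R}) (xi : V -> {RV P1 >-> R}).
Variables (d2 : measure_display) (O2 : measurableType d2) (P2 : probability O2 R).
Variable S : nat -> O2 -> V.
Hypothesis xi_copies : independent_copies X xi.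
Hypothesis EX0 : ('E_P1[X] = 0)%E.
Hypothesis EX4 : ('E_P1[fun w => (X w ^+ 4)%R] < +oo)%E.
Local Notation s2 := (second_moment X).
Local Notation m4 := (fourth_moment X).
Hypothesis s2_gt0 : 0 < s2.
Hypothesis srwS : simple_random_walk P2 S.
Variable y : nat -> R.
Hypothesis y_gt0 : forall n, 0 < y n.
Hypothesis y_infty : y n @[n --> \oo] --> +oo.
Hypothesis y_small : y n / (n%:R `^ (6%:R^-1)) @[n --> \oo] --> (0 : R).

Let rate n : \bar R := ((y n ^- 2)%:E * lne (annealed_prob xi n (y n))%:E)%E.
Let th : R := ln (visit_base R d).

Lemma limsup_rate_le (e c : R) : 0 < e -> e < 1 -> 0 < c ->
  c / 2 < (1 - e) ^+ 4 * (1 - expR (e / 2) / 2) -> c < th * e ^+ 2 ->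
  (limn_esup rate <= (- (c / 2))%:E)%E.
Proof.
move=> e0 e1 c0 hc1 hc2.
have th0 : 0 < th by exact: visit_rate_gt0.
have B0 : 0 <= visit_cst R d.
  by apply: le_trans (visit_cst_ge1 R d_ge2); exact: ler01.
have m40 := fourth_moment_gt0 EX0 EX4 s2_gt0.
have [Y0 [R0 H]] := upper_exponents e0 e1 th0 B0 s2_gt0 m40 c0 hc1 hc2.
apply: limn_esup_le; near=> n.
have yY : Y0 <= y n by near: n; exact: (cvgryPge _).1.
have rR : R0 <= root24 R n by near: n; exact: root24_ge.
have yr : y n <= root24 R n ^+ 4 by near: n; exact: eventually_le_root24.
have [n0 y0 [r0 p0 He]] := H n (y n) (root24 R n) yY rR yr (esym (root24K R n)).
apply: rate_le => //; apply: le_trans He.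
apply: (annealed_upper d_ge2 xi_copies EX0 EX4 s2_gt0 n0 y0 e0 e1 p0 _ (erefl _) (lexx _)).
by rewrite exprn_gt0.
Unshelve. all: by end_near. Qed.

Lemma liminf_rate_ge : ((- (2%:R^-1))%:E <= limn_einf rate)%E.
Proof.
have th0 : 0 < th by exact: visit_rate_gt0.
have B0 : 0 <= visit_cst R d.
  by apply: le_trans (visit_cst_ge1 R d_ge2); exact: ler01.
have m40 := fourth_moment_ge0 X.
apply/lee_subgt0Pr => eps eps0.
(* By tilt_cost_le the loss 75 eta is then at most half of eps; the other half
   pays for the prefactors. *)
pose eta := Num.min 2^-1 (eps / 150).
have eta0 : 0 < eta by rewrite lt_min invr_gt0 ltr0n divr_gt0.
have eta2 : eta <= 2^-1 by rewrite ge_min lexx.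
have etae : 75 * eta <= eps / 2.
  have : eta <= eps / 150 by rewrite ge_min lexx orbT.
  by rewrite ler_pdivlMr//; lra.
have [Y0 [R0 H]] := lower_exponents eta0 eta2 th0 B0 s2_gt0 m40.
rewrite -EFinB; apply: limn_einf_ge; near=> n.
have yY : Y0 <= y n by near: n; exact: (cvgryPge _).1.
have yE : (16 * m4 + 7) * (2 / eps) <= y n by near: n; exact: (cvgryPge _).1.
have rR : R0 <= root24 R n by near: n; exact: root24_ge.
have yr : y n <= root24 R n ^+ 4 by near: n; exact: eventually_le_root24.
have [[n0 y1 r0 bn] [h1 h2 h3 h4 h5] [h6 h7 h8]] :=
  H n (y n) (root24 R n) yY rR yr (esym (root24K R n)).
set r := root24 R n in rR yr r0 bn h2 h3 h4 h7 h8.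
have r6 : 0 < r ^+ 6 by rewrite exprn_gt0.
have p0 : 0 < (r ^+ 48)^-1 by rewrite invr_gt0 exprn_gt0.
have s0 : 0 < (2 * r ^+ 13)^-1 by rewrite invr_gt0 mulr_gt0// exprn_gt0.
have := annealed_lower d_ge2 xi_copies EX0 EX4 s2_gt0 n0 (y_gt0 n) eta0 eta2 r6 bn p0
  h1 s0 h2 h3 h4 h5 h6 h7 h8.
have -> : - 2^-1 - eps = - (2^-1 + eps) by rewrite opprD.
move=> lower; apply: rate_ge => //; apply: le_trans lower.
apply: (@le_trans _ _ (expR (- 7) * expR (- (2^-1 + eps / 2) * y n ^+ 2 - 16 * m4))).
  rewrite -expRD ler_expR.
  have y2 : y n <= y n ^+ 2 by rewrite -[leLHS]expr1 ler_weXn2l.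
  have : 16 * m4 + 7 <= eps / 2 * y n ^+ 2.
    have := le_trans yE y2.
    have e20 : 0 < eps / 2 by rewrite divr_gt0.
    rewrite -(ler_pM2l e20) => h; apply: le_trans h.
    have -> : eps / 2 * ((16 * m4 + 7) * (2 / eps)) = 16 * m4 + 7.
      by field; rewrite gt_eqF.
    exact: lexx.
  by move: (y n ^+ 2) => z; lra.
apply: ler_pM; rewrite ?expR_ge0//.
  rewrite expRN lef_pV2 ?posrE ?expR_gt0//.
  by have := @expR_ge1Dx R 7; lra.
rewrite ler_expR lerB//.
have -> : y n * (1 + eta) ^+ 2 / (1 - eta) = y n * ((1 + eta) ^+ 2 / (1 - eta)).
  by rewrite -mulrA.
have := tilt_cost_le (ltW eta0) eta2; move: ((1 + eta) ^+ 2 / (1 - eta)) => g.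
rewrite exprMn.
have y20 : 0 <= y n ^+ 2 by rewrite sqr_ge0.
move: (g ^+ 2) (y n ^+ 2) y20 => g2 z z0 tc.
have tc' : g2 * (2^-1 + eta + eta ^+ 2 / 12) <= 2^-1 + eps / 2.
  by apply: (le_trans tc); rewrite lerD2l.
have := ler_wpM2l z0 tc'; rewrite -subr_ge0 => tc2.
rewrite -subr_ge0; apply: (le_trans tc2); rewrite le_eqVlt; apply/orP; left.
by apply/eqP; field.
Unshelve. all: by end_near. Qed.

End TailRates.

Section RateConstant.
Variable R : realType.

(** The fourth root of the rate th at which local times decay exponentially. *)
Definition visit_rate_root (d : nat) : R := Num.sqrt (Num.sqrt (ln (visit_base R d))).

(** With e = 1/(1+t) this is (1-e)^5. The main term of the upper bound allows any
constant below (1-e)^4 (2 - exp(e/2)), and the heavily visited vertices any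
constant below th e^2 = t^4/(1+t)^2; both exceed (1-e)^5. *)
Definition rate_constant (d : nat) : R :=
  (visit_rate_root d / (1 + visit_rate_root d)) ^+ 5.

Lemma visit_rate_root_gt0 d : (2 <= d)%N -> 0 < visit_rate_root d.
Proof. by move=> d2; rewrite !sqrtr_gt0 visit_rate_gt0. Qed.

Lemma visit_rate_root4 d : (2 <= d)%N -> visit_rate_root d ^+ 4 = ln (visit_base R d).
Proof.
move=> d2; rewrite (exprM _ 2 2) !sqr_sqrtr ?sqrtr_ge0//.
exact/ltW/visit_rate_gt0.
Qed.

Lemma heat_decay_nonincreasing d e : (2 <= d)%N -> (d <= e)%N -> heat_decay R e <= heat_decay R d.
Proof.
move=> d2 de; rewrite /heat_decay ler_pdivrMr// mulrAC ler_pdivlMr// -!mulrA ler_pM2l//.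
set a := Num.sqrt d%:R; set b := Num.sqrt e%:R.
have aE : a ^+ 2 = d%:R by rewrite sqr_sqrtr.
have bE : b ^+ 2 = e%:R by rewrite sqr_sqrtr.
have a1 : 1 <= a by rewrite -[leLHS]sqrtr1 ler_sqrt// ler1n; lia.
have ab : a <= b by rewrite ler_sqrt// ler_nat.
rewrite -(natr1 d) -(natr1 e) -aE -bE -subr_ge0.
have -> : a * (b ^+ 2 + 1) - b * (a ^+ 2 + 1) = (a * b - 1) * (b - a) by ring.
by rewrite mulr_ge0 ?subr_ge0// mulr_ege1// (le_trans a1).
Qed.

Lemma visit_rate_root_nondecreasing d e : (2 <= d)%N -> (d <= e)%N ->
  visit_rate_root d <= visit_rate_root e.
Proof.
move=> d2 de; have e2 : (2 <= e)%N by exact: leq_trans de.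
have sd := heat_decay_gt0 R d2; have se := heat_decay_gt0 R e2.
rewrite /visit_rate_root !ler_sqrt ?sqrtr_ge0 ?(ltW (visit_rate_gt0 _ _))//.
rewrite ler_ln ?posrE ?(lt_trans ltr01 (visit_base_gt1 _ _))//.
rewrite /visit_base lef_pV2 ?posrE ?decay_qroot_gt0// /decay_qroot ler_sqrt ?sqrtr_ge0//.
by rewrite ler_sqrt ?(ltW sd)// heat_decay_nonincreasing.
Qed.

Lemma rate_constant_gt0 d : (2 <= d)%N -> 0 < rate_constant d.
Proof.
move=> /visit_rate_root_gt0 t0.
by rewrite exprn_gt0// divr_gt0// addr_gt0.
Qed.

Lemma rate_constant_nondecreasing d e : (2 <= d)%N -> (d <= e)%N ->
  rate_constant d <= rate_constant e.
Proof.
move=> d2 de; have e2 : (2 <= e)%N by exact: leq_trans de.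
have td := visit_rate_root_gt0 d2; have te := visit_rate_root_gt0 e2.
have tde := visit_rate_root_nondecreasing d2 de.
rewrite /rate_constant.
move: (visit_rate_root d) (visit_rate_root e) td te tde => t u t0 u0 tu.
have t1 : 0 < 1 + t by rewrite addr_gt0.
have u1 : 0 < 1 + u by rewrite addr_gt0.
rewrite lerXn2r ?nnegrE ?divr_ge0 ?(ltW t0) ?(ltW u0) ?(ltW t1) ?(ltW u1)//.
rewrite ler_pdivrMr// mulrAC ler_pdivlMr//; nra.
Qed.

Lemma visit_rate_root_infty : visit_rate_root d @[d --> \oo] --> +oo.
Proof.
apply/cvgryPge => A; near=> d.
have d2 : (2 <= d)%N by near: d; exact: nbhs_infty_ge.
pose a := 4 * `|A| ^+ 4.
have dA : (2 * expR a) ^+ 2 <= d%:R by near: d; exact: nbhs_infty_ger.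
apply: (le_trans (ler_norm A)).
rewrite -(ler_pXn2r (n := 4))// ?nnegrE ?(ltW (visit_rate_root_gt0 d2))//.
rewrite visit_rate_root4// -[leLHS]expRK ler_ln ?posrE ?expR_gt0//; last first.
  exact: lt_trans ltr01 (visit_base_gt1 R d2).
rewrite -(ler_pXn2r (n := 4))// ?nnegrE ?expR_ge0//; last first.
  exact/ltW/(lt_trans ltr01)/visit_base_gt1.
have -> : expR (`|A| ^+ 4) ^+ 4 = expR a by rewrite /a expRM_natl.
have s0 := heat_decay_gt0 R d2.
have -> : visit_base R d ^+ 4 = (heat_decay R d)^-1.
  rewrite /visit_base exprVn; congr _^-1.
  by rewrite (exprM _ 2 2) !sqr_sqrtr ?sqrtr_ge0// ltW.
pose s : R := Num.sqrt d%:R.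
have sE : s ^+ 2 = d%:R by rewrite sqr_sqrtr.
have s1 : 0 < s by rewrite sqrtr_gt0 ltr0n; lia.
rewrite /heat_decay -/s invf_div ler_pdivlMr ?mulr_gt0//.
have as_ : 2 * expR a <= s.
  rewrite -(ler_pXn2r (n := 2))// ?nnegrE ?sE// ?mulr_ge0 ?expR_ge0 ?(ltW s1)//.
apply: (@le_trans _ _ (s * s)); last by rewrite -expr2 sE ler_nat.
by rewrite mulrA [expR a * 2]mulrC ler_pM2r.
Unshelve. all: by end_near. Qed.

Lemma rate_constant_cvg : rate_constant d @[d --> \oo] --> (1 : R).
Proof.
apply/cvgrPdist_le => eps eps0; near=> d.
have d2 : (2 <= d)%N by near: d; exact: nbhs_infty_ge.
have tA : 5 / eps <= visit_rate_root d.
  by near: d; exact: (cvgryPge _).1 visit_rate_root_infty _.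
have t0 := visit_rate_root_gt0 d2.
rewrite /rate_constant; move: (visit_rate_root d) tA t0 => t tA t0.
have t1 : 0 < 1 + t by rewrite addr_gt0.
have -> : t / (1 + t) = 1 - (1 + t)^-1 by field; rewrite gt_eqF.
set u := (1 + t)^-1.
have u0 : 0 < u by rewrite invr_gt0.
have u1 : u <= 1 by rewrite invf_le1// lerDl ltW.
have u5 : 5 * u <= eps.
  rewrite -ler_pdivlMl// mulrC -[leRHS]invf_div lef_pV2 ?posrE ?divr_gt0//.
  by apply: (le_trans tA); rewrite lerDr.
have v0 : 0 <= 1 - u by rewrite subr_ge0.
have v1 : (1 - u) ^+ 5 <= 1 by rewrite exprn_ile1//; lra.
rewrite ger0_norm ?subr_ge0//; apply: le_trans u5.
rewrite lerBlDr -lerBlDl.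
have q0 : 0 <= u ^+ 2 by rewrite sqr_ge0.
have h2 : 1 - 2 * u <= (1 - u) ^+ 2 by nra.
have w0 : 0 <= (1 - u) ^+ 2 by rewrite sqr_ge0.
have h4 : 1 - 4 * u <= (1 - u) ^+ 4.
  rewrite (exprM _ 2 2); apply: (@le_trans _ _ (2 * (1 - u) ^+ 2 - 1)); first by lra.
  have := sqr_ge0 ((1 - u) ^+ 2 - 1); lra.
have -> : (1 - u) ^+ 5 = (1 - u) ^+ 4 * (1 - u) by rewrite exprSr.
have w4 : (1 - u) ^+ 4 <= 1 by rewrite exprn_ile1//; lra.
have : (1 - (1 - u) ^+ 4) * (1 - u) <= 1 - (1 - u) ^+ 4.
  by rewrite ler_piMr ?subr_ge0// gerBl ltW.
move: ((1 - u) ^+ 4) h4 => q; lra.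
Unshelve. all: by end_near. Qed.

End RateConstant.

(** * The theorem *)

Lemma fourth_of_sixth_moment (R : realType) (d : measure_display)
    (O : measurableType d) (P : probability O R) (X : {RV P >-> R}) :
  ('E_P[fun w => (X w ^+ 6)%R] < +oo)%E -> ('E_P[fun w => (X w ^+ 4)%R] < +oo)%E.
Proof.
rewrite !unlock => h6.
have mX : measurable_fun setT X by exact: measurable_funP.
apply: (@le_lt_trans _ _ (\int[P]_w (1%:E + (X w ^+ 6)%:E))%E).
  apply: ge0_le_integral => //.
  - by move=> w _; rewrite lee_fin exprn_even_ge0.
  - by apply/measurable_EFinP; exact: measurable_funX.
  - apply/measurable_EFinP; apply: measurable_funD => //; exact: measurable_funX.
  - move=> w _; rewrite -EFinD lee_fin.
    have x20 : 0 <= X w ^+ 2 by rewrite sqr_ge0.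
    have -> : X w ^+ 4 = X w ^+ 2 ^+ 2 by rewrite -exprM.
    have -> : X w ^+ 6 = X w ^+ 2 ^+ 3 by rewrite -exprM.
    move: (X w ^+ 2) x20 => t t0; have := sqr_ge0 (t - 1); nra.
rewrite ge0_integralD//.
- rewrite integral_cst// mul1e lte_add_pinfty//.
  by rewrite (le_lt_trans (probability_le1 _ _))// ltry.
- by move=> w _; rewrite lee_fin exprn_even_ge0.
- by apply/measurable_EFinP; exact: measurable_funX.
Qed.

Lemma second_moment_gt0 (R : realType) (d : measure_display)
    (O : measurableType d) (P : probability O R) (X : {RV P >-> R}) :
  ('E_P[fun w => (X w ^+ 4)%R] < +oo)%E ->
  (0 < 'E_P[fun w => (X w ^+ 2)%R])%E -> 0 < second_moment X.
Proof.
move=> h4 h2; apply: fine_gt0; rewrite h2 /=.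
rewrite unlock -ge0_fin_numE; last first.
  by apply: integral_ge0 => w _; rewrite lee_fin sqr_ge0.
by apply: integrable_fin_num => //; exact: (integrable_power_le4 h4).
Qed.

Theorem theorem2p1 (R : realType) :
  exists c : nat -> R,
    [/\ forall d : nat, (2 <= d)%N -> 0 < c d,
        forall d e : nat, (2 <= d)%N -> (d <= e)%N -> c d <= c e,
        c d @[d --> \oo] --> (1 : R)
      & forall d : nat, (2 <= d)%N ->
        forall (d1 : measure_display) (O1 : measurableType d1)
               (P1 : probability O1 R)
               (X : {RV P1 >-> R}) (xi : vertex d -> {RV P1 >-> R})
               (d2 : measure_display) (O2 : measurableType d2)
               (P2 : probability O2 R) (S : nat -> O2 -> vertex d)
               (y : nat -> R),
        independent_copies X xi ->
        'E_P1[X]%E = 0%E ->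
        (0 < 'E_P1[fun w => (X w ^+ 2)%R])%E ->
        simple_random_walk P2 S ->
        (forall n : nat, 0 < y n) ->
        y n @[n --> \oo] --> +oo ->
        let tail (n : nat) : \bar R :=
          (P1 \x P2)%E [set w : O1 * O2 |
            y n <= self_normalized_ratio (S^~ w.2) (fun v => xi v w.1) n] in
        let rate (n : nat) : \bar R := ((y n ^- 2)%:E * lne (tail n))%E in
        (('E_P1[fun w => (X w ^+ 4)%R] < +oo)%E ->
         y n / (n%:R `^ (6%:R^-1)) @[n --> \oo] --> (0 : R) ->
         (limn_esup rate <= (- (c d / 2%:R))%:E)%E)
        /\
        (('E_P1[fun w => (X w ^+ 6)%R] < +oo)%E ->
         y n / (n%:R `^ (6%:R^-1)) @[n --> \oo] --> (0 : R) ->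
         ((- (2%:R^-1))%:E <= limn_einf rate)%E)].
Proof.
exists (rate_constant R); split.
- exact: rate_constant_gt0.
- exact: rate_constant_nondecreasing.
- exact: rate_constant_cvg.
move=> d d_ge2 d1 O1 P1 X xi d2 O2 P2 S y xi_copies EX0 EX2 srwS y_gt0 y_infty tail rate.
have rateE : rate = fun n => ((y n ^- 2)%:E * lne (annealed_prob xi n (y n))%:E)%E.
  by apply/funext => n; rewrite /rate /tail (tail_annealed d_ge2 xi srwS).
rewrite rateE; split => [EX4 y_small|EX6 y_small].
  have s2_gt0 := second_moment_gt0 EX4 EX2.
  have t0 := visit_rate_root_gt0 R d_ge2.
  have tE := visit_rate_root4 R d_ge2.
  have c0 := rate_constant_gt0 R d_ge2.
  move: t0 tE c0; rewrite /rate_constant; set t := visit_rate_root R d => t0 tE c0.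
  pose e := (1 + t)^-1.
  have t1 : 0 < 1 + t by rewrite addr_gt0.
  have e0 : 0 < e by rewrite invr_gt0.
  have e1 : e < 1 by rewrite invf_lt1// ltrDl.
  have te : t / (1 + t) = 1 - e by rewrite /e; field; rewrite gt_eqF.
  apply: (limsup_rate_le d_ge2 xi_copies EX0 EX4 s2_gt0 y_infty y_small e0 e1 c0).
    have e2 : expR (e / 2) < 1 + e.
      have h : expR (e / 2) <= (1 - e / 2)^-1 by apply: expR_le_geom; lra.
      apply: (le_lt_trans h); rewrite -[ltLHS]mul1r ltr_pdivrMr; [nra|lra].
    have p4 : 0 < (1 - e) ^+ 4 by rewrite exprn_gt0// subr_gt0.
    by rewrite te exprSr -mulrA ltr_pM2l//; lra.
  rewrite -tE.
  have -> : t ^+ 4 * e ^+ 2 = t ^+ 4 * (1 + t) ^+ 3 / (1 + t) ^+ 5.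
    by rewrite /e; field; rewrite gt_eqF.
  rewrite expr_div_n ltr_pM2r ?invr_gt0 ?exprn_gt0// exprSr ltr_pM2l ?exprn_gt0//.
  nra.
have EX4 := fourth_of_sixth_moment EX6.
have s2_gt0 := second_moment_gt0 EX4 EX2.
exact: (liminf_rate_ge d_ge2 xi_copies EX0 EX4 s2_gt0 y_gt0 y_infty y_small).
Qed.
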